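(* Let $d=3$, $a=r=0$, and $$\omega(x)=c_me^{-|x|^2/2},\qquad c_m:=\frac{m}{(2\pi)^{3/2}}.$$ If $m>1$, let $R>0$ be the unique solution of $$\operatorname{erf}\Bigl(\frac{R}{\sqrt2}\Bigr)=\frac1m,\qquad \operatorname{erf}(z):=\frac{2}{\sqrt\pi}\int_0^ze^{-u^2}\,du,$$ and let $U$ be the (continuous) solution of $$\Delta U=\omega\ \text{ in }\mathbb{R}^3\setminus\overline{B_R(0)},\qquad U=0\ \text{ in }B_R(0),\qquad U(x)\to0\ \text{ as }|x|\to\infty .$$ Then the measure $\phi:=\omega-\Delta U$ (in the sense of distributions on $\mathbb{R}^3$) is $$\phi=c_me^{-|x|^2/2}\mathbf{1}_{B_R(0)}\,dx+\frac{c_me^{-R^2/2}}{R}\,\mathcal{H}^2\llcorner\partial B_R(0),$$ and $\phi$ is a zero-flux stationary probability measure, i.e. a probability measure with $\phi\,(K_0*\omega-K_0*\phi)=0$. If $m=1$, the limiting (as $R\to\infty$) stationary probability is $\phi=\omega$, which is a zero-flux stationary probability measure.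
   Context: $K_0(x)=\nabla|x|=x/|x|$ for $x\neq0$, $K_0(0)=0$. $\mathcal{H}^2\llcorner\partial B_R(0)$ is the surface measure on the sphere of radius $R$. Zero-flux stationary means $\int_{\mathbb{R}^3}\xi(x)\cdot(K_0*\omega(x)-K_0*\phi(x))\,d\phi(x)=0$ for all $\xi\in C_c^\infty(\mathbb{R}^3;\mathbb{R}^3)$. *)

(* Defs.v *)
From HB Require Import structures.
From mathcomp Require Import all_boot all_order all_algebra.
From mathcomp Require Import all_classical all_reals all_analysis.

Set Implicit Arguments.
Unset Strict Implicit.
Unset Printing Implicit Defensive.

Import Order.TTheory GRing.Theory Num.Theory.
Import numFieldNormedType.Exports.

Local Open Scope classical_set_scope.
Local Open Scope ring_scope.

(* The library's norm on a product is the max norm: it gives the usual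
   topology, but the Euclidean norm [enorm] has to be defined separately. *)
Notation R3 R := (R * R * R)%type.

(* The same carrier with the product Borel structure on which the library's
   [lebesgue_measure] products live. *)
Notation mR3 R :=
  (measurableTypeR R * measurableTypeR R * measurableTypeR R)%type.

Section Euclidean.
Context {R : realType}.
Implicit Types x y : R3 R.

Definition dot x y : R := x.1.1 * y.1.1 + x.1.2 * y.1.2 + x.2 * y.2.

Definition enorm x : R := Num.sqrt (dot x x).

Definition eball (r : R) : set (R3 R) := [set x | enorm x < r].

Definition basis3 (i : 'I_3) : R3 R :=
  ((i == 0 :> nat)%N%:R, (i == 1 :> nat)%N%:R, (i == 2 :> nat)%N%:R).

Definition leb2 := (@lebesgue_measure R \x @lebesgue_measure R)%E.

Definition leb3 := (leb2 \x @lebesgue_measure R)%E.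

(* Spherical parametrization of the sphere of radius r, p = (polar angle,
   azimuth); its area element is r^2 sin p.1. *)
Definition sph (r : R) (p : R * R) : R3 R :=
  (r * sin p.1 * cos p.2, r * sin p.1 * sin p.2, r * cos p.1).

Definition sphere_measure (r : R) (A : set (mR3 R)) : \bar R :=
  (\int[leb2]_(p in `[0%R, pi] `*` `[0%R, (2 * pi)%R])
     (r ^+ 2 * sin p.1 * \1_A (sph r p))%:E)%E.

End Euclidean.

Section Calculus.
Context {R : realType} {V : normedModType R}.
Implicit Types f : R3 R -> V.

Definition pder (s : seq 'I_3) f : R3 R -> V :=
  foldr (fun i g => 'D_(basis3 i) g) f s.

Definition laplacian f (x : R3 R) : V := \sum_(i < 3) pder [:: i; i] f x.

Definition C2_on (A : set (R3 R)) f : Prop := forall x, A x ->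
  (forall s i, (size s < 2)%N -> derivable (pder s f) x (basis3 i)) /\
  (forall s, (size s <= 2)%N -> {for x, continuous (pder s f)}).

Definition smooth f : Prop := forall s,
  continuous (pder s f) /\ forall x i, derivable (pder s f) x (basis3 i).

Definition test_function f : Prop :=
  smooth f /\ compact (closure [set x | f x != 0]).

End Calculus.

Section Model.
Context {R : realType}.

(* The second integral only contributes when z < 0. *)
Definition erf (z : R) : R :=
  2 / Num.sqrt pi *
  (\int[lebesgue_measure]_(u in `[0, z]) expR (- u ^+ 2) -
   \int[lebesgue_measure]_(u in `[z, 0]) expR (- u ^+ 2)).

Definition cm (m : R) : R := m / (2 * pi) `^ (3 / 2).

Definition omega (m : R) (x : R3 R) : R := cm m * expR (- enorm x ^+ 2 / 2).

(* K0 0 = 0 since 0^-1 = 0. *)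
Definition K0 (x : R3 R) : R3 R := (enorm x)^-1 *: x.

Definition vint (mu : {measure set (mR3 R) -> \bar R})
    (F : R3 R -> R3 R) : R3 R :=
  (\int[mu]_x (F x).1.1, \int[mu]_x (F x).1.2, \int[mu]_x (F x).2).

Definition K0_conv_density (w : R3 R -> R) (x : R3 R) : R3 R :=
  vint leb3 (fun y => w y *: K0 (x - y)).

Definition K0_conv_measure (mu : {measure set (mR3 R) -> \bar R})
    (x : R3 R) : R3 R :=
  vint mu (fun y => K0 (x - y)).

Definition zero_flux_stationary (w : R3 R -> R)
    (phi : {measure set (mR3 R) -> \bar R}) : Prop :=
  forall xi : R3 R -> R3 R, test_function xi ->
    \int[phi]_x dot (xi x) (K0_conv_density w x - K0_conv_measure phi x) = 0.

Definition exterior_solution (w : R3 R -> R) (r : R) (U : R3 R -> R) : Prop :=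
  [/\ continuous U,
      C2_on [set x | r < enorm x] U,
      forall x, r < enorm x -> laplacian U x = w x,
      forall x, eball r x -> U x = 0 &
      forall eps : R, 0 < eps ->
        exists M : R, forall x, M < enorm x -> `|U x| < eps].

Definition distribution_eq_measure (w U : R3 R -> R)
    (phi : {measure set (mR3 R) -> \bar R}) : Prop :=
  forall eta : R3 R -> R, test_function eta ->
    \int[phi]_x eta x =
    \int[leb3]_x (w x * eta x) - \int[leb3]_x (U x * laplacian eta x).

Definition gaussian_measure (m : R) (A : set (mR3 R)) : \bar R :=
  (\int[leb3]_(x in A) (omega m x)%:E)%E.

Definition phi_measure (m r : R) (A : set (mR3 R)) : \bar R :=
  (gaussian_measure m (A `&` eball r)
   + (cm m * expR (- r ^+ 2 / 2) / r)%:E * sphere_measure r A)%E.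

End Model.

(* Main.v *)
(** The exterior solution is radial:
    U(x) = - c_m (G(|x|) - G(R)) / |x| for |x| >= R, where G(s) is the integral
    of exp(- u^2 / 2) over [0, s]; uniqueness is the maximum principle applied
    to the difference of two solutions plus eps |x|^2. Testing U against a
    Laplacian, one integration by parts (limits of difference quotients, as
    Lebesgue measure is translation invariant) gives an exterior integral of
    grad U . grad eta; in polar coordinates this is an integral of a total
    derivative along each ray, and the boundary terms form the surface measure
    on the sphere of radius R.
    For the zero-flux property, rotation invariance reduces the convolution of
    K_0 with a uniform sphere of radius s to a one-variable integral, which
    shows that it is linear, x |-> (8 pi / (3 s)) x, inside that sphere. Hence
    the part of omega outside the ball of radius R and the surface charge have
    the same convolution with K_0 in the ball, and phi vanishes outside. As
    R tends to infinity the density error and the surface mass tend to 0. *)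
Require Import Defs.
From HB Require Import structures.
From mathcomp Require Import all_boot all_order all_algebra.
From mathcomp Require Import all_classical all_reals all_analysis.
From mathcomp Require Import measurable_realfun ring lra.

Set Implicit Arguments.
Unset Strict Implicit.
Unset Printing Implicit Defensive.

Import Order.TTheory GRing.Theory Num.Theory.
Import numFieldNormedType.Exports.

Local Open Scope classical_set_scope.
Local Open Scope ring_scope.

(** * Derivatives along lines *)

(** The surface density [c_m exp(- R^2 / 2) / R] has to fit three conditions. It is minus the outer
    radial derivative of [U] at [R], hence the singular part of [omega - laplacian U]. A sphere of
    radius [s] contributes [8 pi / (3 s)] times [x] at a point [x] inside it, so the exterior part
    of [omega] contributes a multiple of the integral of [s exp(- s^2 / 2)] over [s > R], that is of
    [exp(- R^2 / 2)], and a shell of this density contributes the same. Its mass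
    [4 pi c_m R exp(- R^2 / 2)] is the boundary term lost when [s^2 exp(- s^2 / 2)] is integrated by
    parts over the ball: the total mass is [m erf(R / sqrt 2)], and the equation for [R] says that
    [phi] is a probability.

    All changes of variables in space are assembled by Tonelli from one-variable substitutions:
    [x = y cot t] and [y = s sin t] give polar coordinates, and translations at fixed other
    coordinates give shears. Spherical coordinates single out an axis and hide the symmetry of the
    surface measure; this is why sphere integrals are turned into volume integrals before being
    rotated. *)

Section derivation_rules.
Context {R : realType} {V : normedModType R}.
Implicit Types (f g : V -> R) (x v : V).

Lemma scaleRE (a b : R) : a *: b = a * b. Proof. by []. Qed.

(** Both sides have the same difference quotients. Restricting to a line makes the one-variable
    chain rule available for functions on [V] that are only known to have a directional
    derivative. *)
Lemma is_derive_lineP f x v d :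
  is_derive x v f d <-> is_derive (0 : R) 1 (fun h : R => f (h *: v + x)) d.
Proof.
have E : (fun h : R => h^-1 *: (((fun h : R => f (h *: v + x)) \o shift 0) (h *: 1)
     - f (0 *: v + x))) = (fun h => h^-1 *: ((f \o shift x) (h *: v) - f x)).
  by apply/funext => h; rewrite /= !scaleRE mulr1 addr0 scale0r add0r.
split=> -[ex dv]; split.
- by rewrite /derivable E.
- by rewrite /derive E.
- by rewrite /derivable -E.
- by rewrite /derive -E.
Qed.

Lemma der_cst (c : R) x v : is_derive x v (fun=> c) 0.
Proof. exact: is_derive_cst. Qed.

Lemma derD f g x v (df dg : R) : is_derive x v f df -> is_derive x v g dg ->
  is_derive x v (fun y => f y + g y) (df + dg).
Proof. by move=> hf hg; exact: is_deriveD. Qed.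

Lemma derN f x v (df : R) : is_derive x v f df ->
  is_derive x v (fun y => - f y) (- df).
Proof. by move=> hf; exact: is_deriveN. Qed.

Lemma derM f g x v (df dg : R) : is_derive x v f df -> is_derive x v g dg ->
  is_derive x v (fun y => f y * g y) (df * g x + f x * dg).
Proof.
move=> hf hg; apply: (is_derive_eq (is_deriveM hf hg)).
by rewrite !scaleRE addrC (mulrC (g x)).
Qed.

Lemma derZ f x v (c df : R) : is_derive x v f df ->
  is_derive x v (fun y => c * f y) (c * df).
Proof. by move=> hf; exact: is_deriveZ. Qed.

Lemma der_comp (h : R -> R) f x v (df dh : R) : is_derive x v f df ->
  is_derive (f x) 1 h dh -> is_derive x v (fun y => h (f y)) (dh * df).
Proof.
move=> /is_derive_lineP hf hh; apply/is_derive_lineP.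
have hh' : is_derive ((fun t : R => f (t *: v + x)) 0) 1 h dh.
  by rewrite scale0r add0r.
exact: (@is_derive1_comp _ h (fun t : R => f (t *: v + x)) 0 _ _ hh' hf).
Qed.

Lemma derivable_continuous1 (h : R -> R) (t d : R) : is_derive t 1 h d ->
  {for t, continuous h}.
Proof.
move=> hd; apply: differentiable_continuous; apply/derivable1_diffP.
exact: @ex_derive _ _ _ _ _ _ _ hd.
Qed.

Lemma derV1 (t : R) : t != 0 -> is_derive t 1 (@GRing.inv R) (- t ^- 2).
Proof.
move=> t0.
have [ex dv] : is_derive t 1 (fun y : R => y) 1 by exact: is_derive_id.
split; first exact: (derivableV t0 ex).
by rewrite (deriveV t0 ex) dv scaleRE mulr1.
Qed.

Lemma derV f x v (df : R) : f x != 0 -> is_derive x v f df ->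
  is_derive x v (fun y => (f y)^-1) (- df / f x ^+ 2).
Proof.
move=> fx hf; apply: (is_derive_eq (der_comp hf (derV1 fx))).
by rewrite mulNr mulrC mulNr.
Qed.

Lemma derX f x v n (df : R) : is_derive x v f df ->
  is_derive x v (fun y => f y ^+ n) (n%:R * f x ^+ n.-1 * df).
Proof.
move=> hf; have := is_deriveX n hf.
by rewrite (_ : f ^+ n = (fun y => f y ^+ n))//; apply/funext => y; rewrite exprfctE.
Qed.

End derivation_rules.

Section FTC.
Variable R : realType.
Local Notation leb := (@lebesgue_measure R).

Lemma FTC2_is_derive (f F : R -> R) (a b : R) : a < b ->
  {in `[a, b], continuous f} ->
  {in `]a, b[, forall x : R, is_derive x 1 F (f x)} ->
  {in `[a, b], continuous F} ->
  (\int[leb]_(x in `[a, b]) (f x)%:E = (F b)%:E - (F a)%:E)%E.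
Proof.
move=> ab cf dF cF; apply: continuous_FTC2 => //.
- by apply: continuous_in_subspaceT => x /set_mem /=; exact: cf.
- split.
  + by move=> x /dF h; exact: @ex_derive _ _ _ _ _ _ _ h.
  + by apply: cvg_at_right_filter; apply: cF; rewrite in_itv/= lexx ltW.
  + by apply: cvg_at_left_filter; apply: cF; rewrite in_itv/= lexx ltW.
- by move=> x /dF h; rewrite derive1E; exact: @derive_val _ _ _ _ _ _ _ h.
Qed.

End FTC.

(** * Changes of variables for integrals *)

Section density.
Context d (T : measurableType d) (R : realType).
Variable mu : {measure set T -> \bar R}.

(** The proofs [mk] and [k0] are arguments so that a measure structure, which rests on them, can be
    attached to the term itself. *)
Definition density (k : T -> R) (mk : measurable_fun setT k)
    (k0 : forall x, 0 <= k x) (A : set T) : \bar R :=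
  (\int[mu]_(x in A) (k x)%:E)%E.

Variables (k : T -> R) (mk : measurable_fun setT k) (k0 : forall x, 0 <= k x).

Let density0 : density mk k0 set0 = 0%E.
Proof. by rewrite /density integral_set0. Qed.

Let density_ge0 A : (0 <= density mk k0 A)%E.
Proof. by apply: integral_ge0 => x _; rewrite lee_fin. Qed.

Let density_sigma_additive : semi_sigma_additive (density mk k0).
Proof.
move=> F mF tF mUF; rewrite /density ge0_integral_bigcup//.
- apply: is_cvg_ereal_nneg_natsum_cond => n _ _.
  by apply: integral_ge0 => x _; rewrite lee_fin.
- by apply/measurable_EFinP; exact: measurable_funTS.
- by move=> x _; rewrite lee_fin.
Qed.

HB.instance Definition _ := isMeasure.Build _ _ _
  (density mk k0) density0 density_ge0 density_sigma_additive.

Import HBNNSimple.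

(** On the indicator of a level set both sides agree by definition of [density]; sums give simple
    functions, and monotone convergence along [nnsfun_approx] gives the rest. *)
Lemma ge0_integral_density (f : T -> \bar R) :
  measurable_fun setT f -> (forall x, 0 <= f x)%E ->
  (\int[density mk k0]_x f x = \int[mu]_x (f x * (k x)%:E))%E.
Proof.
move=> mf f0; pose f_ := nnsfun_approx measurableT mf.
have f_E x : EFin \o f_^~ x @ \oo --> f x.
  by apply: cvg_nnsfun_approx => // *; exact: f0.
transitivity (limn (fun n => \int[density mk k0]_x (f_ n x)%:E))%E.
  rewrite -monotone_convergence//.
  - by apply: eq_integral => x _; apply/esym/cvg_lim => //; exact: f_E.
  - by move=> n; exact/measurable_EFinP.
  - by move=> n x _; rewrite lee_fin.
  - by move=> x _ m n mn; rewrite lee_fin; exact/lefP/nd_nnsfun_approx.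
have -> : (\int[mu]_x (f x * (k x)%:E) =
    limn (fun n => \int[mu]_x ((f_ n x)%:E * (k x)%:E)))%E.
  rewrite -monotone_convergence//.
  - apply: eq_integral => x _; apply/esym/cvg_lim => //.
    by apply: cvgeZr => //; exact: f_E.
  - move=> n; apply: emeasurable_funM; exact/measurable_EFinP.
  - by move=> n x _; rewrite mule_ge0// lee_fin.
  - move=> x _ m n mn; rewrite lee_wpmul2r ?lee_fin//.
    exact/lefP/nd_nnsfun_approx.
congr (limn _); apply/funext => n.
have fE x : (f_ n x)%:E = (\sum_(r \in range (f_ n))
    (r * \1_(f_ n @^-1` [set r]) x)%:E)%E by rewrite fimfunE -fsumEFin.
rewrite [LHS](eq_integral (fun x => \sum_(r \in range (f_ n))
    (r * \1_(f_ n @^-1` [set r]) x)%:E)%E) => [|x _]; last exact: fE.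
rewrite [RHS](eq_integral (fun x => \sum_(r \in range (f_ n))
    ((r * \1_(f_ n @^-1` [set r]) x)%:E * (k x)%:E))%E) => [|x _]; last first.
  by rewrite fE ge0_mule_fsuml// => r; rewrite EFinM nnfun_muleindic_ge0.
rewrite /= !ge0_integral_fsum//.
- apply: eq_fsbigr => r /set_mem [x _ rE].
  have r0 : 0 <= r by rewrite -rE.
  under eq_integral do rewrite EFinM.
  under [RHS]eq_integral do rewrite EFinM -muleA.
  rewrite !ge0_integralZl//.
  + congr (_ * _)%E; rewrite integral_indic// setIT /= /density [LHS]integral_mkcond.
    apply: eq_integral => y _; rewrite patchE indicE.
    by case: ifPn => _; rewrite ?mul1e ?mul0e.
  + by apply: emeasurable_funM; apply/measurable_EFinP.
  + by move=> y _; rewrite mule_ge0// lee_fin.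
  + exact/measurable_EFinP.
- move=> r; apply: emeasurable_funM; apply/measurable_EFinP => //.
  exact/measurable_funM.
- by move=> r x _; rewrite mule_ge0 ?lee_fin// -lee_fin EFinM nnfun_muleindic_ge0.
- by move=> r; apply/measurable_EFinP/measurable_funM.
- by move=> r x _; rewrite EFinM nnfun_muleindic_ge0.
Qed.

End density.

(** * Change-of-variables identities between two measures *)

Section transfer.
Context d1 d2 (T1 : measurableType d1) (T2 : measurableType d2) (R : realType).
Local Open Scope ereal_scope.

(** This says that [m2] is the image under [phi] of the measure with density [k] with respect to
    [m1]. It is stated on nonnegative functions, where Tonelli applies freely; signed integrals are
    recovered below. *)
Definition transfer (m1 : {measure set T1 -> \bar R})
    (m2 : {measure set T2 -> \bar R}) (phi : T1 -> T2) (k : T1 -> R) :=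
  forall f : T2 -> \bar R, measurable_fun setT f -> (forall x, 0 <= f x) ->
    \int[m2]_x f x = \int[m1]_t (f (phi t) * (k t)%:E).

Variables (m1 : {measure set T1 -> \bar R}) (m2 : {measure set T2 -> \bar R}).
Variables (phi : T1 -> T2) (k : T1 -> R).
Hypothesis k0 : forall t, (0 <= k t)%R.
Hypothesis tr : transfer m1 m2 phi k.

(** Since [k] is nonnegative, it factors out of positive and negative parts, so the identity holds
    on each part separately. *)
Lemma transfer_integral (f : T2 -> \bar R) : measurable_fun setT f ->
  \int[m2]_x f x = \int[m1]_t (f (phi t) * (k t)%:E).
Proof.
move=> mf; rewrite integralE [RHS]integralE.
rewrite !tr//; [|exact: measurable_funeneg|exact: measurable_funepos].
congr (_ - _); apply: eq_integral => t _.
  have /(congr1 (@^~ t)) := ge0_funeposM (f \o phi) (k0 t).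
  by rewrite !funeposE /= => E; rewrite [LHS]muleC -E muleC.
have /(congr1 (@^~ t)) := ge0_funenegM (f \o phi) (k0 t).
by rewrite !funenegE /= => E; rewrite [LHS]muleC -E muleC.
Qed.

Lemma transfer_integrable (f : T2 -> \bar R) : measurable_fun setT phi ->
  measurable_fun setT k -> measurable_fun setT f ->
  m2.-integrable setT f <-> m1.-integrable setT (fun t => f (phi t) * (k t)%:E).
Proof.
move=> mphi mk mf.
have E : \int[m2]_x `|f x| = \int[m1]_t `|f (phi t) * (k t)%:E|.
  rewrite tr//; last exact: measurableT_comp.
  by apply: eq_integral => t _; rewrite abseM [X in _ = _ * X]gee0_abs// lee_fin.
split=> /integrableP[_ fi]; apply/integrableP; split => //.
- apply: emeasurable_funM; last exact/measurable_EFinP.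
  exact: measurableT_comp mphi.
- by rewrite -E.
- by rewrite E.
Qed.

Lemma transfer_Rintegral (f : T2 -> R) : measurable_fun setT f ->
  (\int[m2]_x f x = \int[m1]_t (f (phi t) * k t))%R.
Proof.
move=> mf; rewrite /Rintegral transfer_integral//; exact/measurable_EFinP.
Qed.

End transfer.

Section product_transfer.
Context d1 d2 (T1 : measurableType d1) (T2 : measurableType d2) (R : realType).
Variables (m1 : {sigma_finite_measure set T1 -> \bar R}).
Variables (m2 : {sigma_finite_measure set T2 -> \bar R}).
Local Open Scope ereal_scope.

Lemma tonelli12 (f : T1 * T2 -> \bar R) : measurable_fun setT f ->
  (forall x, 0 <= f x) ->
  \int[m1 \x m2]_z f z = \int[m1]_x \int[m2]_y f (x, y).
Proof. by move=> mf f0; rewrite fubini_tonelli1. Qed.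

Lemma tonelli21 (f : T1 * T2 -> \bar R) : measurable_fun setT f ->
  (forall x, 0 <= f x) ->
  \int[m1 \x m2]_z f z = \int[m2]_y \int[m1]_x f (x, y).
Proof. by move=> mf f0; rewrite fubini_tonelli2. Qed.

End product_transfer.

(** * Lebesgue measure on the plane and in space *)

Section leb23.
Variable R : realType.
Local Notation leb := (@lebesgue_measure R).

(** The squares of half-side [n] exhaust the plane. The instance built from this lets Tonelli apply
    to [leb3], whose first factor is [leb2]. *)
Lemma sigma_finite_leb2 : sigma_finite setT (@leb2 R).
Proof.
exists (fun n => `[(- n%:R), n%:R] `*` `[(- n%:R), n%:R] :
  set (measurableTypeR R * measurableTypeR R)).
  apply/esym/seteqP; split=> // -[x y] _.
  exists (Num.truncn (Num.max `|x| `|y|)).+1 => //=; rewrite !in_itv/= -!ler_norml.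
  have := truncnS_gt (Num.max `|x| `|y|); rewrite gt_max => /andP[hx hy].
  by rewrite !ltW.
move=> n; split; first exact: measurableX.
rewrite /leb2 product_measure1E//= !lebesgue_measure_itv/=.
by case: ifPn => _; rewrite ?mule0 ?ltry// -EFinD -EFinM ltry.
Qed.

HB.instance Definition _ := Measure.on (@leb2 R).
HB.instance Definition _ :=
  @Measure_isSigmaFinite.Build _ _ _ (@leb2 R) sigma_finite_leb2.
HB.instance Definition _ := Measure.on (@leb3 R).

(** This and the next two lemmas put each of the three coordinates innermost in turn, as the three
    kinds of shears require. *)
Lemma tonelli3 (f : mR3 R -> \bar R) : measurable_fun setT f ->
  (forall x, 0 <= f x)%E ->
  (\int[leb3]_x f x = \int[leb]_z \int[leb]_y \int[leb]_x f (x, y, z))%E.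
Proof.
move=> mf f0; rewrite [LHS](@tonelli21 _ _ _ _ _ (@leb2 R) leb f mf f0).
apply: eq_integral => z _.
by rewrite /leb2 tonelli21//; exact: measurableT_comp mf _.
Qed.

Lemma tonelli3' (f : mR3 R -> \bar R) : measurable_fun setT f ->
  (forall x, 0 <= f x)%E ->
  (\int[leb3]_x f x = \int[leb]_z \int[leb]_x \int[leb]_y f (x, y, z))%E.
Proof.
move=> mf f0; rewrite [LHS](@tonelli21 _ _ _ _ _ (@leb2 R) leb f mf f0).
apply: eq_integral => z _.
by rewrite /leb2 tonelli12//; exact: measurableT_comp mf _.
Qed.

Lemma tonelli3'' (f : mR3 R -> \bar R) : measurable_fun setT f ->
  (forall x, 0 <= f x)%E ->
  (\int[leb3]_x f x = \int[leb2]_p \int[leb]_z f (p.1, p.2, z))%E.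
Proof.
move=> mf f0; rewrite [LHS](@tonelli12 _ _ _ _ _ (@leb2 R) leb f mf f0).
by apply: eq_integral => -[x y] _.
Qed.

End leb23.

(** * Open sets of the max-norm topology are product Borel sets *)

Section measurable_R3.
Variable R : realType.

(** The topology of [R3] and the sigma-algebra of [mR3] come from different structures. An open set
    is the union of the countably many boxes [box t], with rational centre and side controlled by
    [t.2], that it contains. *)
Lemma open_measurable_R3 (A : set (mR3 R)) :
  open (A : set (R3 R)) -> measurable A.
Proof.
move=> oA.
pose box (t : rat * rat * rat * nat) : set (mR3 R) :=
  (ball (ratr t.1.1.1 : R) t.2.+1%:R^-1 `*` ball (ratr t.1.1.2 : R) t.2.+1%:R^-1)
  `*` ball (ratr t.1.2 : R) t.2.+1%:R^-1.
pose F n : set (mR3 R) := if unpickle n is Some t then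
  (if pselect (box t `<=` A) then box t else set0) else set0.
suff -> : A = \bigcup_n F n.
  apply: bigcup_measurable => n _; rewrite /F; case: unpickle => // t.
  case: pselect => [bA|_] /=; last by [].
  by apply: measurableX; [apply: measurableX|]; exact: measurable_ball.
apply/seteqP; split => [z Az|z [n _]]; last first.
  by rewrite /F; case: unpickle => [t|//]; case: pselect => [bA|_] //=; exact: bA.
have [e /= e0 eA] := (nbhs_ballP _ _).1 (open_nbhs_nbhs (conj oA Az)).
have [n ne] : exists n : nat, n.+1%:R^-1 < e / 2 :> R.
  have e20 : 0 < e / 2 by rewrite divr_gt0.
  have /cvgrPdist_lt/(_ _ e20)[n _ /(_ n (leqnn n))] := @cvg_harmonic R.
  by rewrite sub0r normrN ger0_norm ?invr_ge0// => ?; exists n.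
have n0 : 0 < n.+1%:R^-1 :> R by rewrite invr_gt0.
have pick (x : R) : exists q : rat, ball x n.+1%:R^-1 (ratr q).
  have [||y [bxy [q _ qy]]] := @dense_rat R (ball x n.+1%:R^-1).
  - by exists x; exact: ballxx.
  - exact: ball_open.
  by exists q; rewrite qy.
have [a ha] := pick z.1.1; have [b hb] := pick z.1.2; have [c hc] := pick z.2.
have bz : box (a, b, c, n) z by split; [split|]; exact: ball_sym.
have bA : box (a, b, c, n) `<=` A.
  move=> w [[wa wb] wc]; apply: eA.
  have tri (x y q : R) : ball x n.+1%:R^-1 q -> ball q n.+1%:R^-1 y -> ball x e y.
    move=> xq qy; apply: le_ball (ball_triangle xq qy).
    by rewrite (splitr e) lerD// ltW.
  by split; [split|]; [exact: tri ha wa|exact: tri hb wb|exact: tri hc wc].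
have Fz : F (pickle (a, b, c, n)) z by rewrite /F pickleK; case: pselect.
exact: (@bigcup_sup _ _ _ setT F I _ Fz).
Qed.

Lemma continuous_measurable_R3 (f : R3 R -> R) :
  continuous f -> measurable_fun setT (f : mR3 R -> R).
Proof.
move=> /continuousP cf.
apply: (measurability _ (RGenOInfty.measurableE R)) => //.
move=> _ [_ [x ->] <-]; rewrite setTI; apply: open_measurable_R3.
by apply: cf; exact: interval_open.
Qed.

End measurable_R3.

(** * One-variable substitutions *)

Section substitution.
Variable R : realType.
Local Notation leb := (@lebesgue_measure R).
Implicit Types (T k : R -> R).

(** Lebesgue measure is characterized by its values on half-open intervals, so a substitution only
    has to be checked on the preimages of these. *)
Lemma transfer_of_oc (T k : measurableTypeR R -> measurableTypeR R) :
  measurable_fun setT T -> measurable_fun setT k -> (forall x, 0 <= k x) ->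
  (forall a b, a < b -> (\int[leb]_(x in T @^-1` `]a, b]) (k x)%:E = (b - a)%:E)%E) ->
  transfer leb leb T k.
Proof.
move=> mT mk k0 H f mf f0.
pose nu := pushforward (density leb mk k0) (T : _ -> measurableTypeR R).
have E : forall A, measurable A -> leb A = nu A.
  apply: lebesgue_measure_unique => _ [[a b] _ <-].
  rewrite /nu /pushforward /density/= lebesgue_measure_itv/= lte_fin.
  case: ifPn => [ab|]; first exact/esym/H.
  rewrite -leNgt => ba; rewrite set_itv_ge; last by rewrite bnd_simp -leNgt.
  exact/esym/measure0.
rewrite (eq_measure_integral nu); last by move=> A mA _; exact: E.
rewrite ge0_integral_pushforward// preimage_setT.
rewrite ge0_integral_density//; last by move=> x; exact: f0.
exact: (measurableT_comp mf mT).
Qed.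

Lemma transfer_affine (a b : R) : a != 0 ->
  transfer leb leb (fun x => a * x + b) (fun=> `|a|).
Proof.
move=> a0; have mT : measurable_fun setT (fun x : measurableTypeR R => a * x + b).
  by apply: measurable_funD => //; exact: measurable_funM.
apply: transfer_of_oc => // c d cd.
rewrite integral_cst//; last by rewrite -[X in measurable X]setTI; exact: mT.
have [ap|an|] := ltgtP a 0; last by move/eqP; rewrite (negbTE a0).
- have -> : (fun x => a * x + b) @^-1` `]c, d] = `[(d - b) / a, (c - b) / a[%classic.
    apply/seteqP; split => x /=; rewrite !in_itv/= ler_ndivrMr// ltr_ndivlMr//;
    by rewrite lerBrDr ltrBlDr mulrC andbC.
  rewrite /= lebesgue_measure_itv/= lte_fin ltr_nM2r ?invr_lt0//.
  rewrite ltrD2r cd -EFinD -EFinM ltr0_norm//; congr EFin; field.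
  by rewrite lt_eqF.
- have -> : (fun x => a * x + b) @^-1` `]c, d] = `](c - b) / a, (d - b) / a]%classic.
    apply/seteqP; split => x /=; rewrite !in_itv/= ltr_pdivrMr// ler_pdivlMr//;
    by rewrite lerBrDr ltrBlDr mulrC.
  rewrite /= lebesgue_measure_itv/= lte_fin ltr_pM2r ?invr_gt0//.
  rewrite ltrD2r cd -EFinD -EFinM gtr0_norm//; congr EFin; field.
  by rewrite gt_eqF.
Qed.

Definition acot (x : R) : R := pi / 2 - atan x.

Lemma acot_itv x : 0 < acot x < pi.
Proof.
rewrite /acot subr_gt0 atan_ltpi2/= ltrBlDr -ltrBlDl.
by rewrite [X in X < _](_ : _ = - (pi / 2)) ?atan_gtNpi2//; field.
Qed.

Lemma acotK x : cos (acot x) / sin (acot x) = x.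
Proof.
rewrite /acot -{3}(atanK x) /tan addrC.
rewrite cosDpihalf sinDpihalf sinN cosN opprK//.
Qed.

Lemma ltr_cot (s t : R) : 0 < s < pi -> 0 < t < pi ->
  (cos s / sin s < cos t / sin t) = (t < s).
Proof.
move=> hs ht.
have E u : cos u / sin u = tan (pi / 2 - u).
  by rewrite /tan addrC cosDpihalf sinDpihalf sinN cosN opprK.
rewrite !E ltr_tan ?ltrD2l ?ltrN2// in_itv/=.
  by case/andP: hs => s0 sp; apply/andP; split; lra.
by case/andP: ht => s0 sp; apply/andP; split; lra.
Qed.

(** The factor [y / sin x ^+ 2] is the modulus of the derivative of [y * cot]; the indicator keeps
    one period, on which the cotangent is a bijection onto the line. *)
Definition cot_density (y x : R) : R := \1_(`]0, pi[ : set R) x * (y / sin x ^+ 2).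

(** The inverse is discontinuous at [0], so it is written with the measurable function [powR]
    applied to a square; at [0] both expressions take the value [0]. *)
Lemma measurable_inv : measurable_fun setT (@GRing.inv R).
Proof.
rewrite (_ : GRing.inv = (fun x : R => x * ((x ^+ 2) `^ (-1)))).
  apply: measurable_funM => //.
  apply: (@measurableT_comp _ _ _ _ _ _ (fun y : R => y `^ (-1)) _
    (fun x : R => x ^+ 2)); first exact: measurable_powR.
  exact: measurable_funX.
apply/funext => x; rewrite powR_inv1 ?sqr_ge0//.
have [->|x0] := eqVneq x 0; first by rewrite invr0 mul0r.
by field.
Qed.

Lemma measurable_funV d (T : measurableType d) (f : T -> R) :
  measurable_fun setT f -> measurable_fun setT (fun x => (f x)^-1).
Proof. by move=> mf; exact: measurableT_comp measurable_inv mf. Qed.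

(** The cotangent decreases from [+oo] to [-oo] on []0, pi[], so the preimage of []a, b]] there is
    [[acot (b / y), acot (a / y)[]. The weight has the primitive [- y * cot], whose increment over
    this interval is [b - a]. *)
Lemma transfer_cot (y : R) : 0 < y ->
  transfer leb leb (fun x => y * (cos x / sin x)) (cot_density y).
Proof.
move=> y0.
have mcos : measurable_fun setT (@cos R).
  by apply: continuous_measurable_fun; exact: continuous_cos.
have msin : measurable_fun setT (@sin R).
  by apply: continuous_measurable_fun; exact: continuous_sin.
have k0 x : 0 <= cot_density y x.
  by rewrite /cot_density mulr_ge0 ?indicE// divr_ge0 ?sqr_ge0// ltW.
apply: transfer_of_oc => //.
- apply: measurable_funM => //; apply: measurable_funM => //.
  exact: measurable_funV.
- apply: measurable_funM; first exact: measurable_indic.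
  apply: measurable_funM => //; apply: measurable_funV.
  exact: measurable_funX.
move=> a b ab.
pose s := acot (b / y); pose t := acot (a / y).
have [s0 sp] := andP (acot_itv (b / y)); have [t0 tp] := andP (acot_itv (a / y)).
have st : s < t by rewrite /s /t /acot ltrD2l ltrN2 lt_atan// ltr_pM2r ?invr_gt0.
transitivity (\int[leb]_(x in `[s, t]) (y / sin x ^+ 2)%:E)%E.
  rewrite -integral_itv_bndo_bndc; last first.
    apply/measurable_EFinP/measurable_funTS.
    by apply: measurable_funM => //; apply: measurable_funV; exact: measurable_funX.
  have -> : `[s, t[%classic =
      (fun x => y * (cos x / sin x)) @^-1` `]a, b] `&` `]0, pi[%classic.
    apply/seteqP; split => x /=; rewrite !in_itv/=.
      move=> /andP[sx xt]; have hx : 0 < x < pi.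
        by rewrite (lt_le_trans s0 sx) (lt_trans xt tp).
      split=> //; move: xt; rewrite /t -ltr_cot ?acot_itv// acotK.
      rewrite ltr_pdivrMr// (mulrC _ y) => ->/=.
      move: sx; rewrite leNgt /s -ltr_cot ?acot_itv// acotK -leNgt.
      by rewrite ler_pdivlMr// mulrC.
    move=> [/andP[ax xb] hx]; apply/andP; split.
      rewrite leNgt /s -ltr_cot ?acot_itv// acotK -leNgt.
      by rewrite ler_pdivlMr// mulrC.
    rewrite /t -ltr_cot ?acot_itv// acotK.
    by rewrite ltr_pdivrMr// (mulrC _ y).
  rewrite integral_mkcondr; apply: eq_integral => x _.
  rewrite /cot_density patchE indicE; case: ifPn; first by rewrite mul1r.
  by rewrite mul0r.
have sin0 x : x \in `[s, t] -> sin x != 0.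
  rewrite in_itv/= => /andP[sx xt]; rewrite gt_eqF// sin_gt0_pi//.
  by rewrite (lt_le_trans s0 sx) (le_lt_trans xt tp).
have dF x : x \in `[s, t] ->
    is_derive x 1 (fun x => - (y * (cos x / sin x))) (y / sin x ^+ 2).
  move=> /sin0 sx.
  have h1 := derM (is_derive_cos x) (derV sx (is_derive_sin x)).
  apply: (is_derive_eq (derN (derZ y h1))).
  have := cos2Dsin2 x; set u := cos x; set w := sin x => E.
  rewrite -[y in RHS]mulr1 -E; field; exact: sx.
have cF x : x \in `[s, t] -> {for x, continuous (fun x => - (y * (cos x / sin x)))}.
  by move=> /dF; exact: derivable_continuous1.
rewrite (@FTC2_is_derive _ (fun x : R => y / sin x ^+ 2) (fun x : R => - (y * (cos x / sin x)))) //.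
- by rewrite !acotK -EFinB; congr EFin; field; rewrite gt_eqF.
- move=> x xst.
  have sx : sin x ^+ 2 != 0 by rewrite expf_neq0// sin0.
  exact: (derivable_continuous1 (derZ y
    (derV (f := fun t => sin t ^+ 2) sx (derX 2 (is_derive_sin x))))).
- by move=> x xst; apply: dF; exact: subset_itv_oo_cc.
Qed.

End substitution.

Section measurability_rules.
Context d (T : measurableType d) (R : realType).
Implicit Types f : T -> R.

Lemma measurable_fun_cos f : measurable_fun setT f ->
  measurable_fun setT (fun x => cos (f x)).
Proof.
move=> mf; apply: measurableT_comp mf.
by apply: continuous_measurable_fun; exact: continuous_cos.
Qed.

Lemma measurable_fun_sin f : measurable_fun setT f ->
  measurable_fun setT (fun x => sin (f x)).
Proof.
move=> mf; apply: measurableT_comp mf.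
by apply: continuous_measurable_fun; exact: continuous_sin.
Qed.

Lemma measurable_fun_expR f : measurable_fun setT f ->
  measurable_fun setT (fun x => expR (f x)).
Proof. by move=> mf; exact: measurableT_comp mf. Qed.

Lemma measurable_fun_sqrt f : measurable_fun setT f ->
  measurable_fun setT (fun x => Num.sqrt (f x)).
Proof.
move=> mf; apply: measurableT_comp mf.
by apply: continuous_measurable_fun; exact: sqrt_continuous.
Qed.

Lemma measurable_fun_indic f (i : interval R) : measurable_fun setT f ->
  measurable_fun setT (fun x => \1_([set` i] : set R) (f x) : R).
Proof.
move=> mf; apply: measurableT_comp mf.
by apply: measurable_indic; exact: measurable_itv.
Qed.

End measurability_rules.

Lemma measurable_cosT {R : realType} :
  measurable_fun [set: measurableTypeR R] (fun x => cos x : R).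
Proof. by apply: continuous_measurable_fun; exact: continuous_cos. Qed.

Lemma measurable_sinT {R : realType} :
  measurable_fun [set: measurableTypeR R] (fun x => sin x : R).
Proof. by apply: continuous_measurable_fun; exact: continuous_sin. Qed.

(** * Spherical coordinates *)

(** Measurability by recursion on the syntax of the function. Differences are matched before sums
    because [a - b] is a sum with an opposite. *)
Ltac meas1 :=
  first [assumption | match goal with |- measurable_fun _ ?f => lazymatch f with
  | (fun _ => ?c) => exact: measurable_cst
  | (fun x => x) => exact: measurable_id
  | cos => exact: measurable_cosT
  | sin => exact: measurable_sinT
  | (fun x => cos x) => exact: measurable_cosT
  | (fun x => sin x) => exact: measurable_sinT
  | fst => exact: measurable_fst
  | snd => exact: measurable_snd
  | (fun x => (@?a x, @?b x)) => apply: measurable_fun_pair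
  | (fun x => fst x) => exact: measurable_fst
  | (fun x => snd x) => exact: measurable_snd
  | (fun x => fst (@?a x)) => apply: (measurableT_comp measurable_fst)
  | (fun x => snd (@?a x)) => apply: (measurableT_comp measurable_snd)
  | (fun x => EFin (@?a x)) => apply/measurable_EFinP
  | (fun x => (@?a x * @?b x)%E) => apply: emeasurable_funM
  | (fun x => cos (@?a x)) => apply: measurable_fun_cos
  | (fun x => sin (@?a x)) => apply: measurable_fun_sin
  | (fun x => expR (@?a x)) => apply: measurable_fun_expR
  | (fun x => Num.sqrt (@?a x)) => apply: measurable_fun_sqrt
  | (fun x => GRing.inv (@?a x)) => apply: measurable_funV
  | (fun x => GRing.mul (@?a x) (@?b x)) => apply: measurable_funM
  | (fun x => GRing.exp (@?a x) ?n) => apply: measurable_funX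
  | (fun x => GRing.add (@?a x) (GRing.opp (@?b x))) => apply: measurable_funB
  | (fun x => GRing.add (@?a x) (@?b x)) => apply: measurable_funD
  | (fun x => GRing.opp (@?a x)) => apply: measurable_funN
  | (fun x => indic _ (@?a x)) => apply: measurable_fun_indic
  end end].
Ltac meas := repeat meas1.

Section inner_integral.
Context d1 d2 (T1 : measurableType d1) (T2 : measurableType d2) (R : realType).
Variables (m1 : {sigma_finite_measure set T1 -> \bar R}).
Variables (m2 : {sigma_finite_measure set T2 -> \bar R}).
Local Open Scope ereal_scope.
Variable f : T1 * T2 -> \bar R.
Hypotheses (mf : measurable_fun setT f) (f0 : forall x, 0 <= f x).

Lemma measurable_inner2 : measurable_fun setT (fun x => \int[m2]_y f (x, y)).
Proof. exact: measurable_fun_fubini_tonelli_F. Qed.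

Lemma measurable_inner1 : measurable_fun setT (fun y => \int[m1]_x f (x, y)).
Proof. exact: measurable_fun_fubini_tonelli_G. Qed.

End inner_integral.

Section polar.
Variable R : realType.
Local Notation leb := (@lebesgue_measure R).
Local Notation T := (measurableTypeR R).

(** Serves to discard the endpoints of angular ranges and the single critical radius in radial
    integrals. *)
Lemma eq_integral_off_finite (A : set T) (f g : T -> \bar R) : finite_set A ->
  measurable_fun setT f -> measurable_fun setT g ->
  (forall x, ~ A x -> f x = g x) -> (\int[leb]_x f x = \int[leb]_x g x)%E.
Proof.
move=> fA mf mg fg; apply: ae_eq_integral => //.
have cA : countable A by exact: finite_set_countable.
exists A; split; first exact: countable_measurable.
  exact: countable_lebesgue_measure0.
by move=> x /= h; apply: contrapT => nA; apply: h => _; exact: fg.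
Qed.

(** Ranges of integration are encoded as indicator weights: every integral then runs over the whole
    space, and [transfer] and Tonelli apply without domains. *)
Definition ipos (s : R) : R := \1_(`]0, +oo[%classic : set R) s.
Definition ioo (t : R) : R := \1_(`]0, pi[%classic : set R) t.

Lemma ipos_ge0 s : 0 <= ipos s. Proof. by rewrite /ipos indicE. Qed.
Lemma ioo_ge0 s : 0 <= ioo s. Proof. by rewrite /ioo indicE. Qed.

Lemma iposE s : ipos s = (0 < s)%R%:R.
Proof. by rewrite /ipos indicE mem_setE in_itv/= andbT. Qed.

Lemma iooE s : ioo s = (0 < s < pi)%R%:R.
Proof. by rewrite /ioo indicE mem_setE in_itv. Qed.

Definition wpol (t s : R) : R := ipos s * s * ioo t.

Lemma wpol_ge0 t s : 0 <= wpol t s.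
Proof.
rewrite /wpol iposE mulr_ge0 ?ioo_ge0//.
by case: ltP => [/ltW|]; rewrite ?mul1r ?mul0r.
Qed.

Local Open Scope ereal_scope.

(** At fixed [y > 0] put [x = y cot t], exchange the integrals, then at fixed [t] put [y = s sin t].
    This gives [x = s cos t], and the two Jacobians multiply to [(y / sin^2 t) sin t = s]. *)
Lemma polar_half (f : T * T -> \bar R) :
  measurable_fun setT f -> (forall x, 0 <= f x) ->
  \int[leb]_y \int[leb]_x (f (x, y) * (ipos y)%:E) =
  \int[leb]_t \int[leb]_s (f (s * cos t, s * sin t)%R * (wpol t s)%:E).
Proof.
move=> mf f0.
pose F (p : T * T) : \bar R := f ((p.2 * (cos p.1 / sin p.1))%R, p.2) *
  ((\1_(`]0%R, pi[%classic : set R) p.1 * (p.2 / sin p.1 ^+ 2)) * ipos p.2)%:E.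
have mF : measurable_fun setT F.
  apply: emeasurable_funM; first by apply: (measurableT_comp mf); meas.
  by rewrite /ipos; meas.
have F0 p : 0 <= F p.
  rewrite /F mule_ge0// lee_fin iposE; case: ltP => [p0|_]; last by rewrite mulr0.
  by rewrite mulr1 mulr_ge0 ?indicE// divr_ge0 ?sqr_ge0// ltW.
transitivity (\int[leb]_y \int[leb]_t F (t, y)).
  apply: eq_integral => y _; rewrite /F /=.
  have [y0|y0] := boolP (0 < y)%R; last first.
    by rewrite iposE (negbTE y0); apply: eq_integral => x _; rewrite mulr0 !mule0.
  rewrite iposE y0; under eq_integral do rewrite mule1.
  under [RHS]eq_integral do rewrite mulr1.
  have mfy : measurable_fun setT (fun x : T => f (x, y)).
    by apply: (measurableT_comp mf); meas.
  by rewrite (transfer_cot y0 mfy)//.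
rewrite -(fubini_tonelli F mF F0).
apply: eq_integral => t _; rewrite /F /=.
have [t0|t0] := boolP (0 < t < pi)%R; last first.
  rewrite !integral0_eq// => s _.
    by rewrite /wpol iooE (negbTE t0) mulr0 mule0.
  by rewrite indicE mem_setE in_itv/= (negbTE t0) !mul0r mule0.
have st : (0 < sin t)%R by exact: sin_gt0_pi.
have st0 : sin t != 0%R by rewrite gt_eqF.
rewrite (transfer_affine 0 st0); last 2 first.
- apply: emeasurable_funM; first by apply: (measurableT_comp mf); meas.
  by rewrite /ipos; meas.
- by move=> s; exact: (F0 (t, s)).
apply: eq_integral => s _.
rewrite -muleA -EFinM addr0 gtr0_norm//; congr (f (_, _) * _%:E).
- by rewrite mulrAC mulrCA divff// mulr1 mulrC.
- by rewrite mulrC.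
- rewrite /wpol iooE t0 iposE pmulr_rgt0// -iposE indicE mem_setE in_itv/= t0.
  rewrite (_ : true%:R = 1%R :> R)//; by field.
Qed.

Definition ifull (t : R) : R := \1_(`[0%R, (2 * pi)%R]%classic : set R) t.

(** The lower half-plane is the image of the upper one under the point reflection, which shifts the
    angle by [pi]; the axis [y = 0] is null. *)
Lemma polar_plane (f : T * T -> \bar R) :
  measurable_fun setT f -> (forall x, 0 <= f x) ->
  \int[leb]_y \int[leb]_x f (x, y) =
  \int[leb]_t \int[leb]_s (f (s * cos t, s * sin t)%R * (ipos s * s * ifull t)%:E).
Proof.
move=> mf f0.
pose f' (p : T * T) := f (- p.1, - p.2)%R.
have f'0 p : 0 <= f' p by exact: f0.
have mf' : measurable_fun setT f' by apply: (measurableT_comp mf); meas.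
pose g y := \int[leb]_x f (x, y).
have mg : measurable_fun setT g by exact: (measurable_inner1 leb mf f0).
have g0 y : 0 <= g y by apply: integral_ge0.
have gy (h : R -> R) y : (0 <= h y)%R ->
    \int[leb]_x (f (x, y) * (h y)%:E) = g y * (h y)%:E.
  move=> hy; rewrite ge0_integralZr ?lee_fin//.
  by apply: (measurableT_comp mf); meas.
have m1 : measurable_fun setT (fun y : T => (ipos y)%:E) by rewrite /ipos; meas.
have m2 : measurable_fun setT (fun y : T => (ipos (- y))%:E) by rewrite /ipos; meas.
have E1 : \int[leb]_y g y = \int[leb]_y (g y * (ipos y)%:E) + \int[leb]_y (g y * (ipos (- y))%:E).
  rewrite -ge0_integralD//.
  - apply: (@eq_integral_off_finite [set 0%R]) => //.
      by apply: emeasurable_funD; exact: emeasurable_funM.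
    move=> y /= /eqP y0; rewrite -ge0_muleDr ?lee_fin ?ipos_ge0// -EFinD !iposE.
    by rewrite oppr_gt0; case: ltgtP y0 => // _ _; rewrite ?addr0 ?add0r mule1.
  - by move=> y _; rewrite mule_ge0// lee_fin ipos_ge0.
  - exact: emeasurable_funM.
  - by move=> y _; rewrite mule_ge0// lee_fin ipos_ge0.
  - exact: emeasurable_funM.
have E2 : \int[leb]_y (g y * (ipos (- y))%:E) =
    \int[leb]_y \int[leb]_x (f' (x, y) * (ipos y)%:E).
  have a0 : (-1)%R != 0%R :> R by rewrite oppr_eq0 oner_eq0.
  rewrite (transfer_affine 0 a0); last 2 first.
  - exact: emeasurable_funM.
  - by move=> y; rewrite mule_ge0// lee_fin ipos_ge0.
  apply: eq_integral => y _; rewrite mulN1r addr0 opprK normrN1 mule1.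
  have mfy : measurable_fun setT (fun x : T => f' (x, y)).
    by apply: (measurableT_comp mf'); meas.
  rewrite ge0_integralZr ?lee_fin ?ipos_ge0//.
  congr (_ * _).
  rewrite /g (transfer_affine 0 a0)//; last by apply: (measurableT_comp mf); meas.
  by apply: eq_integral => x _; rewrite mulN1r addr0 normrN1 mule1.
pose K t := \int[leb]_s (f (s * cos t, s * sin t)%R * (ipos s * s)%:E).
have K_ge0 s : (0 <= ipos s * s)%R.
  by rewrite iposE; case: ltP => [/ltW|]; rewrite ?mul1r ?mul0r.
have mKK : measurable_fun setT (fun p : T * T => f (p.2 * cos p.1, p.2 * sin p.1)%R * (ipos p.2 * p.2)%:E).
  apply: emeasurable_funM; first by apply: (measurableT_comp mf); meas.
  by rewrite /ipos; meas.
have KK0 (p : T * T) : 0 <= f (p.2 * cos p.1, p.2 * sin p.1)%R * (ipos p.2 * p.2)%:E.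
  by rewrite mule_ge0// lee_fin.
have mK : measurable_fun setT K.
  exact: (measurable_inner2 leb mKK KK0).
have K0 t : 0 <= K t by apply: integral_ge0 => s _; exact: (KK0 (t, s)).
have KZ (h : R -> R) t : (0 <= h t)%R ->
    \int[leb]_s (f (s * cos t, s * sin t)%R * (ipos s * s * h t)%:E) = K t * (h t)%:E.
  move=> ht; under eq_integral do rewrite EFinM muleA.
  rewrite ge0_integralZr ?lee_fin//.
  - exact: (measurable_fun_pair2 t mKK).
  - by move=> s _; exact: (KK0 (t, s)).
have E3 : \int[leb]_y \int[leb]_x (f' (x, y) * (ipos y)%:E) =
    \int[leb]_t (K t * (ioo (t - pi))%:E).
  rewrite (polar_half mf' f'0).
  have a0 : 1%R != 0%R :> R by rewrite oner_eq0.
  rewrite (transfer_affine (- pi) a0); last 2 first.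
  - apply: (@measurable_inner2 _ _ _ _ _ leb
      (fun p : T * T => f' (p.2 * cos p.1, p.2 * sin p.1)%R * (wpol p.1 p.2)%:E)).
      apply: emeasurable_funM; first by apply: (measurableT_comp mf'); meas.
      by rewrite /wpol /ipos /ioo; meas.
    by move=> p; rewrite mule_ge0 ?lee_fin ?wpol_ge0// f0.
  - by move=> t; apply: integral_ge0 => s _; rewrite mule_ge0 ?lee_fin ?wpol_ge0// f0.
  apply: eq_integral => t _; rewrite normr1 mule1 mul1r -(KZ (fun t => ioo (t - pi))%R) ?ioo_ge0//.
  apply: eq_integral => s _; rewrite /f' /wpol /= -[in RHS](subrK pi t) sinDpi cosDpi.
  by rewrite !mulrN subrK.
have E4 : \int[leb]_y (g y * (ipos y)%:E) = \int[leb]_t (K t * (ioo t)%:E).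
  transitivity (\int[leb]_y \int[leb]_x (f (x, y) * (ipos y)%:E)).
    by apply: eq_integral => y _; rewrite gy ?ipos_ge0.
  rewrite (polar_half mf f0); apply: eq_integral => t _.
  by rewrite -(KZ ioo) ?ioo_ge0.
rewrite -[LHS]/(\int[leb]_y g y) E1 E2 E3 E4.
transitivity (\int[leb]_t (K t * (ifull t)%:E)); last first.
  by apply: eq_integral => t _; rewrite -(KZ ifull) ?/ifull ?indicE.
have mi : measurable_fun setT (fun y : T => (ioo y)%:E) by rewrite /ioo; meas.
have mi' : measurable_fun setT (fun y : T => (ioo (y - pi))%:E) by rewrite /ioo; meas.
rewrite -ge0_integralD//.
(* The ranges []0, pi[] and []pi, 2 pi[] fill [[0, 2 pi]] except for three angles. *)
- apply: (@eq_integral_off_finite [set 0%R; pi; (2 * pi)%R]) => //.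
  + by apply: emeasurable_funD; exact: emeasurable_funM.
  + by apply: emeasurable_funM => //; rewrite /ifull; meas.
  move=> t /= h; rewrite -ge0_muleDr ?lee_fin ?ioo_ge0// -EFinD; congr (_ * _%:E).
  rewrite !iooE /ifull indicE mem_setE in_itv/= subr_gt0 ltrBlDr.
  have pi0 := pi_gt0 R.
  have t0 : t != 0%R by apply/eqP => tE; apply: h; left; left.
  have tp : t != pi by apply/eqP => tE; apply: h; left; right.
  have tpp : t != (2 * pi)%R by apply/eqP => tE; apply: h; right.
  have [h0|h0] := ltP 0%R t; last first.
    have h0' : (t < 0)%R by rewrite lt_neqAle t0.
    have -> : (pi < t)%R = false by apply/negbTE; rewrite -leNgt; lra.
    have -> : (0 <= t)%R = false by apply/negbTE; rewrite -ltNge.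
    by rewrite /= addr0.
  rewrite (ltW h0) /=; have [h1|h1] := ltP t pi.
    have -> : (pi < t)%R = false by apply/negbTE; rewrite -leNgt ltW.
    have -> : (t <= 2 * pi)%R = true by lra.
    by rewrite addr0.
  have -> : (pi < t)%R = true by rewrite lt_neqAle eq_sym tp.
  have -> : (t < pi + pi)%R = (t <= 2 * pi)%R.
    by rewrite le_eqVlt (negbTE tpp)/= mulr_natl mulr2n.
  by rewrite add0r.
- by move=> y _; rewrite mule_ge0// lee_fin ioo_ge0.
- exact: emeasurable_funM.
- by move=> y _; rewrite mule_ge0// lee_fin ioo_ge0.
- exact: emeasurable_funM.
Qed.

(** [ws] and [wsph] are the radial and angular factors of the spherical Jacobian; the angular ranges
    are closed to match those of [sphere_measure]. *)
Definition ws (s : R) : R := (ipos s * s ^+ 2)%R.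
Definition wsph (p : R * R) : R :=
  (\1_(`[0, pi]%classic : set R) p.1 * \1_(`[0, 2 * pi]%classic : set R) p.2 * sin p.1)%R.

Lemma ws_ge0 s : (0 <= ws s)%R.
Proof. by rewrite /ws mulr_ge0 ?ipos_ge0 ?sqr_ge0. Qed.

Lemma wsph_ge0 p : (0 <= wsph p)%R.
Proof.
rewrite /wsph !indicE !mem_setE !in_itv/=.
case: (boolP (0 <= p.1 <= pi)%R) => h; last by rewrite !mul0r.
by rewrite mulr_ge0// sin_ge0_pi.
Qed.

Lemma measurable_wsph : measurable_fun setT (wsph : T * T -> R).
Proof. by rewrite /wsph; meas. Qed.

Lemma measurable_sph : measurable_fun setT (fun z : mR3 R => sph z.2 z.1 : mR3 R).
Proof. by rewrite /sph; meas. Qed.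

(** Plane polar coordinates are used twice: in the planes of constant [z], giving [rho] and the
    azimuth, then in the half-plane [rho > 0] of the pairs [(z, rho)], giving [s] and the polar
    angle. The weight [rho = s sin theta] of the first step and [s] of the second multiply to
    [s^2 sin theta]. *)
Theorem polar3 : transfer (@leb3 R) (@leb3 R) (fun z => sph z.2 z.1)
  (fun z => (ws z.2 * wsph z.1)%R).
Proof.
move=> f mf f0.
pose H (u : T * T * T) : \bar R :=
  f ((u.2 * cos u.1.2)%R, (u.2 * sin u.1.2)%R, u.1.1) * (ipos u.2 * u.2 * ifull u.1.2)%:E.
have mH : measurable_fun setT H.
  apply: emeasurable_funM; first by apply: (measurableT_comp mf); meas.
  by rewrite /ipos /ifull; meas.
have H0 u : 0 <= H u.
  rewrite mule_ge0// lee_fin iposE mulr_ge0 ?indicE//.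
  by case: ltP => [/ltW|]; rewrite ?mul1r ?mul0r.
rewrite tonelli3//.
transitivity (\int[leb]_z \int[leb]_phi \int[leb]_rho H (z, phi, rho)).
  apply: eq_integral => z _.
  rewrite (@polar_plane (fun p => f (p.1, p.2, z)))//.
  by apply: (measurableT_comp mf); meas.
have mHF := measurable_inner2 leb mH H0.
have HF0 p : 0 <= \int[leb]_y H (p, y) by apply: integral_ge0.
rewrite (fubini_tonelli _ mHF HF0).
have mG : measurable_fun setT (fun z : mR3 R => f (sph z.2 z.1) * (ws z.2 * wsph z.1)%:E).
  apply: emeasurable_funM; first exact: (measurableT_comp mf measurable_sph).
  by rewrite /ws /ipos /wsph; meas.
have G0 (z : mR3 R) : 0 <= f (sph z.2 z.1) * (ws z.2 * wsph z.1)%:E.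
  by rewrite mule_ge0// lee_fin mulr_ge0 ?ws_ge0 ?wsph_ge0.
rewrite [RHS](@tonelli12 _ _ _ _ _ (@leb2 R) leb _ mG G0).
have mGF := measurable_inner2 leb mG G0.
have GF0 p : 0 <= \int[leb]_y (f (sph y p) * (ws y * wsph p)%:E).
  by apply: integral_ge0 => s _; exact: (G0 (p, s)).
rewrite [RHS](@tonelli21 _ _ _ _ _ leb leb _ mGF GF0).
apply: eq_integral => phi _.
have mHp : measurable_fun setT (fun p : T * T => H (p.1, phi, p.2)).
  by apply: (measurableT_comp mH); meas.
rewrite (fubini_tonelli _ mHp (fun p => H0 _)) /=.
pose Q (p : T * T) : \bar R := f ((p.2 * cos phi)%R, (p.2 * sin phi)%R, p.1) * (ipos p.2 * p.2 * ifull phi)%:E.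
have mQ : measurable_fun setT Q by exact: mHp.
(* The factor [ipos y] that [polar_half] expects is already contained in [Q], and it is
   idempotent. *)
transitivity (\int[leb]_y \int[leb]_x (Q (x, y) * (ipos y)%:E)).
  apply: eq_integral => y _; apply: eq_integral => x _; rewrite /H /Q /=.
  rewrite -[RHS]muleA -EFinM; congr (_ * _%:E); rewrite iposE.
  by case: ltP => _; rewrite ?mulr1 ?mul0r.
have Q0 p : 0 <= Q p by exact: (H0 (p.1, phi, p.2)).
rewrite (polar_half mQ Q0).
apply: eq_integral => theta _; apply: eq_integral => s _.
rewrite /Q /sph /= -muleA -EFinM; congr (f (_, _, _) * _%:E) => //.
rewrite /wpol /ws /wsph /ifull /= !iooE !iposE !indicE !mem_setE !in_itv/=.
have [s0|s0] := boolP (0 < s)%R; last by rewrite ?(mul0r, mulr0).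
have [h|h] := boolP (0 < theta < pi)%R.
  have -> : (0 <= theta <= pi)%R by case/andP: h => a b; rewrite !ltW.
  rewrite pmulr_rgt0// sin_gt0_pi// (_ : true%:R = 1%R :> R)//; ring.
rewrite mulr0 mulr0.
(* The open and closed ranges of the polar angle differ only at [0] and [pi], where the sine
   vanishes. *)
have [/andP[h1 h2]|] := boolP (0 <= theta <= pi)%R; last by rewrite !(mul0r, mulr0).
have : (theta == 0)%R || (theta == pi)%R.
  by move: h; rewrite !lt_neqAle h1 h2 !andbT negb_and !negbK eq_sym.
by case/orP => /eqP ->; rewrite ?sin0 ?sinpi !mulr0.
Qed.

End polar.

(** * Rotation invariance *)

Section shears.
Variable R : realType.
Local Notation leb := (@lebesgue_measure R).
Local Notation T := (measurableTypeR R).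
Local Open Scope ereal_scope.

Lemma leb_shift (b : R) (g : T -> \bar R) : measurable_fun setT g ->
  (forall x, 0 <= g x) -> \int[leb]_x g x = \int[leb]_x g (x + b)%R.
Proof.
move=> mg g0; have a0 : 1%R != 0%R :> R by rewrite oner_eq0.
rewrite (transfer_affine b a0 mg g0); apply: eq_integral => x _.
by rewrite normr1 mule1 mul1r.
Qed.

(** With the sheared variable innermost, the other coordinates are constants and the map is a
    translation; any measurable [h] is allowed. *)
Lemma shear1 (h : T * T -> T) : measurable_fun setT h ->
  transfer (@leb3 R) (@leb3 R)
    (fun x => (x.1.1 + h (x.1.2, x.2), x.1.2, x.2)%R) (fun=> 1%R).
Proof.
move=> mh f mf f0.
pose F (x : mR3 R) := f (x.1.1 + h (x.1.2, x.2), x.1.2, x.2)%R * 1.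
have mF : measurable_fun setT F.
  apply: emeasurable_funM; last exact: measurable_cst.
  apply: (measurableT_comp mf); meas.
  by apply: (measurableT_comp mh); meas.
have F0 x : 0 <= F x by rewrite /F mule1; exact: f0.
rewrite (tonelli3 mf f0) (tonelli3 mF F0).
apply: eq_integral => z _; apply: eq_integral => y _.
have m1 : measurable_fun setT (fun x : T => f (x, y, z)).
  by apply: (measurableT_comp mf); meas.
rewrite (leb_shift (h (y, z)) m1 (fun _ => f0 _)).
by apply: eq_integral => x _; rewrite /F mule1.
Qed.

Lemma shear2 (h : T * T -> T) : measurable_fun setT h ->
  transfer (@leb3 R) (@leb3 R)
    (fun x => (x.1.1, x.1.2 + h (x.1.1, x.2), x.2)%R) (fun=> 1%R).
Proof.
move=> mh f mf f0.
pose F (x : mR3 R) := f (x.1.1, x.1.2 + h (x.1.1, x.2), x.2)%R * 1.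
have mF : measurable_fun setT F.
  apply: emeasurable_funM; last exact: measurable_cst.
  apply: (measurableT_comp mf); meas.
  by apply: (measurableT_comp mh); meas.
have F0 x : 0 <= F x by rewrite /F mule1; exact: f0.
rewrite (tonelli3' mf f0) (tonelli3' mF F0).
apply: eq_integral => z _; apply: eq_integral => x _.
have m1 : measurable_fun setT (fun y : T => f (x, y, z)).
  by apply: (measurableT_comp mf); meas.
rewrite (leb_shift (h (x, z)) m1 (fun _ => f0 _)).
by apply: eq_integral => y _; rewrite /F mule1.
Qed.

Lemma shear3 (h : T * T -> T) : measurable_fun setT h ->
  transfer (@leb3 R) (@leb3 R)
    (fun x => (x.1.1, x.1.2, x.2 + h (x.1.1, x.1.2))%R) (fun=> 1%R).
Proof.
move=> mh f mf f0.
pose F (x : mR3 R) := f (x.1.1, x.1.2, x.2 + h (x.1.1, x.1.2))%R * 1.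
have mF : measurable_fun setT F.
  apply: emeasurable_funM; last exact: measurable_cst.
  apply: (measurableT_comp mf); meas.
  by apply: (measurableT_comp mh); meas.
have F0 x : 0 <= F x by rewrite /F mule1; exact: f0.
rewrite (tonelli3'' mf f0) (tonelli3'' mF F0).
apply: eq_integral => -[x y] _.
have m1 : measurable_fun setT (fun z : T => f (x, y, z)).
  by apply: (measurableT_comp mf); meas.
rewrite (leb_shift (h (x, y)) m1 (fun _ => f0 _)).
by apply: eq_integral => z _; rewrite /F mule1.
Qed.

Definition rot12 (c d : R) (x : mR3 R) : mR3 R :=
  (c * x.1.1 - d * x.1.2, d * x.1.1 + c * x.1.2, x.2)%R.

Definition rot13 (c d : R) (x : mR3 R) : mR3 R :=
  (c * x.1.1 - d * x.2, x.1.2, d * x.1.1 + c * x.2)%R.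

Lemma measurable_rot12 c d : measurable_fun setT (rot12 c d).
Proof. by rewrite /rot12; meas. Qed.

Lemma measurable_rot13 c d : measurable_fun setT (rot13 c d).
Proof. by rewrite /rot13; meas. Qed.

Lemma transfer1_comp (phi psi : mR3 R -> mR3 R) : measurable_fun setT psi ->
  transfer (@leb3 R) (@leb3 R) phi (fun=> 1%R) ->
  transfer (@leb3 R) (@leb3 R) psi (fun=> 1%R) ->
  transfer (@leb3 R) (@leb3 R) (psi \o phi) (fun=> 1%R).
Proof.
move=> mpsi Hphi Hpsi f mf f0; rewrite (Hpsi f)//.
under eq_integral do rewrite mule1.
rewrite -[LHS]/(\int[leb3]_x (f \o psi) x).
by rewrite (Hphi _ (measurableT_comp mf mpsi) (fun x => f0 _)).
Qed.

(* A plane rotation is a product of three shears. *)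
Lemma leb3_rot12 (c d : R) : (c ^+ 2 + d ^+ 2 = 1)%R -> (d != 0)%R ->
  transfer (@leb3 R) (@leb3 R) (rot12 c d) (fun=> 1%R).
Proof.
move=> cd d0; pose t : R := ((c - 1) / d)%R.
pose h1 (p : T * T) : T := (t * p.1)%R; pose h2 (p : T * T) : T := (d * p.1)%R.
have mh1 : measurable_fun setT h1 by rewrite /h1; meas.
have mh2 : measurable_fun setT h2 by rewrite /h2; meas.
have -> : rot12 c d = (fun x => (x.1.1 + h1 (x.1.2, x.2), x.1.2, x.2)%R) \o
   ((fun x => (x.1.1, x.1.2 + h2 (x.1.1, x.2), x.2)%R) \o
   (fun x => (x.1.1 + h1 (x.1.2, x.2), x.1.2, x.2)%R)).
  apply/funext => -[[x y] z]; rewrite /rot12 /h1 /h2 /t /=.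
  have c2 : (c ^+ 2 = 1 - d ^+ 2)%R by rewrite -cd addrK.
  congr (_, _, _); last by field.
  apply: (mulfI d0); field: c2 => //.
have m1 : measurable_fun setT (fun x : mR3 R => (x.1.1 + h1 (x.1.2, x.2), x.1.2, x.2)%R : mR3 R).
  by rewrite /h1; meas.
have m2 : measurable_fun setT (fun x : mR3 R => (x.1.1, x.1.2 + h2 (x.1.1, x.2), x.2)%R : mR3 R).
  by rewrite /h2; meas.
apply: transfer1_comp => //; last exact: shear1.
apply: transfer1_comp => //; [exact: shear1|exact: shear2].
Qed.

(** Here and for [rot12], the coefficient [t] of the two outer shears is minus the tangent of half
    the angle, which is finite because [d != 0]. *)
Lemma leb3_rot13 (c d : R) : (c ^+ 2 + d ^+ 2 = 1)%R -> (d != 0)%R ->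
  transfer (@leb3 R) (@leb3 R) (rot13 c d) (fun=> 1%R).
Proof.
move=> cd d0; pose t : R := ((c - 1) / d)%R.
pose h1 (p : T * T) : T := (t * p.2)%R; pose h2 (p : T * T) : T := (d * p.1)%R.
have mh1 : measurable_fun setT h1 by rewrite /h1; meas.
have mh2 : measurable_fun setT h2 by rewrite /h2; meas.
have -> : rot13 c d = (fun x => (x.1.1 + h1 (x.1.2, x.2), x.1.2, x.2)%R) \o
   ((fun x => (x.1.1, x.1.2, x.2 + h2 (x.1.1, x.1.2))%R) \o
   (fun x => (x.1.1 + h1 (x.1.2, x.2), x.1.2, x.2)%R)).
  apply/funext => -[[x y] z]; rewrite /rot13 /h1 /h2 /t /=.
  have c2 : (c ^+ 2 = 1 - d ^+ 2)%R by rewrite -cd addrK.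
  congr (_, _, _); last by field.
  apply: (mulfI d0); field: c2 => //.
have m1 : measurable_fun setT (fun x : mR3 R => (x.1.1 + h1 (x.1.2, x.2), x.1.2, x.2)%R : mR3 R).
  by rewrite /h1; meas.
have m2 : measurable_fun setT (fun x : mR3 R => (x.1.1, x.1.2, x.2 + h2 (x.1.1, x.1.2))%R : mR3 R).
  by rewrite /h2; meas.
apply: transfer1_comp => //; last exact: shear1.
apply: transfer1_comp => //; [exact: shear1|exact: shear3].
Qed.

End shears.

(** * Rotation invariance of sphere integrals *)

Section sphere_invariance.
Variable R : realType.
Local Notation leb := (@lebesgue_measure R).
Local Notation T := (measurableTypeR R).

Lemma dot_sph (s : R) p : dot (sph s p) (sph s p) = s ^+ 2.
Proof.
rewrite /dot /sph /=.
transitivity (s ^+ 2 * (sin p.1 ^+ 2 * (cos p.2 ^+ 2 + sin p.2 ^+ 2) + cos p.1 ^+ 2)).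
  by ring.
by rewrite cos2Dsin2 mulr1 addrC cos2Dsin2 mulr1.
Qed.

Lemma enorm_sph (s : R) p : enorm (sph s p) = `|s|.
Proof. by rewrite /enorm dot_sph sqrtr_sqr. Qed.

Lemma measurable_dot d (S : measurableType d) (f g : S -> mR3 R) :
  measurable_fun setT f -> measurable_fun setT g ->
  measurable_fun setT (fun x => dot (f x) (g x)).
Proof.
move=> mf mg; rewrite /dot.
by meas.
Qed.

Lemma measurable_enorm d (S : measurableType d) (f : S -> mR3 R) :
  measurable_fun setT f -> measurable_fun setT (fun x => enorm (f x)).
Proof. by move=> mf; apply: measurable_fun_sqrt; exact: measurable_dot. Qed.

Definition sphere_int (s : R) (f : mR3 R -> \bar R) : \bar R :=
  (\int[leb2]_p (f (sph s p) * (wsph p)%:E))%E.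

Definition norm_preserving (O : R3 R -> R3 R) := forall x, enorm (O x) = enorm x.
Definition scale_equivariant (O : R3 R -> R3 R) := forall (a : R) x, O (a *: x) = a *: O x.

Lemma sphZ (a s : R) p : sph (a * s) p = a *: sph s p :> R3 R.
Proof. by rewrite /sph; congr (_, _, _); rewrite /= /GRing.scale/= !mulrA. Qed.

(** The function [f] on the sphere is extended along rays and weighted by [1 / |x|^2] on the
    punctured unit ball: in polar coordinates this weight cancels the Jacobian [t^2], so each ray
    has radial mass [1]. *)
Lemma measurable_cone (s : R) (f : mR3 R -> \bar R) : measurable_fun setT f ->
  measurable_fun setT (fun x : mR3 R => f ((s / enorm x)%R *: (x : R3 R)) *
    (\1_(`]0%R, 1%R[%classic : set R) (enorm x) / (enorm x) ^+ 2)%:E)%E.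
Proof.
move=> mf; have men : measurable_fun setT (fun x : mR3 R => enorm x).
  by apply: measurable_enorm; exact: measurable_id.
apply: emeasurable_funM; last first.
  apply/measurable_EFinP; apply: measurable_funM.
    exact: measurable_fun_indic.
  by apply: measurable_funV; apply: measurable_funX.
apply: (measurableT_comp mf).
have mi : measurable_fun setT (fun x : mR3 R => s / enorm x).
  by apply: measurable_funM => //; exact: measurable_funV.
rewrite /GRing.scale/= /GRing.scale/=.
by apply: measurable_fun_pair; [apply: measurable_fun_pair|];
  apply: measurable_funM => //; meas.
Qed.

(* Rewriting the sphere integral as a volume integral lets it inherit the
   rotation invariance of Lebesgue measure. *)
Lemma sphere_int_ball (s : R) (f : mR3 R -> \bar R) :
  measurable_fun setT f -> (forall x, 0 <= f x)%E ->
  sphere_int s f = (\int[leb3]_x (f ((s / enorm x)%R *: (x : R3 R)) *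
    (\1_(`]0%R, 1%R[%classic : set R) (enorm x) / (enorm x) ^+ 2)%:E))%E.
Proof.
move=> mf f0; have mF := measurable_cone s mf.
have F0 x : (0 <= f ((s / enorm x)%R *: (x : R3 R)) *
    (\1_(`]0%R, 1%R[%classic : set R) (enorm x) / (enorm x) ^+ 2)%:E)%E.
  by rewrite mule_ge0// lee_fin divr_ge0 ?indicE ?sqr_ge0.
rewrite (polar3 mF F0) tonelli12; last 2 first.
- apply: emeasurable_funM; first exact: (measurableT_comp mF (@measurable_sph R)).
  by rewrite /ws /ipos /wsph; meas.
- move=> z; apply: mule_ge0; first exact: F0.
  by rewrite lee_fin mulr_ge0 ?ws_ge0 ?wsph_ge0.
apply: eq_integral => p _ /=.
rewrite -[LHS]mule1 -[in LHS](_ : \int[leb]_t (\1_(`]0%R, 1%R[%classic : set R) t)%:E = 1)%E; last first.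
  by rewrite integral_indic//= setIT lebesgue_measure_itv/= lte01 oppr0 adde0.
rewrite -ge0_integralZl//; last 2 first.
- by apply/measurable_EFinP; exact: measurable_indic.
- by rewrite mule_ge0// lee_fin wsph_ge0.
apply: eq_integral => t _; rewrite enorm_sph.
have [t0|t0] := ltP 0 t; last first.
  by rewrite /ws iposE ltNge t0 /= !mul0r !mule0 indicE mem_setE in_itv/= ltNge t0 /= mule0.
rewrite gtr0_norm// -sphZ divfK ?gt_eqF// -!muleA -!EFinM; congr (_ * _%:E)%E.
rewrite /ws iposE t0 (_ : true%:R = 1%R :> R)//; field.
by rewrite gt_eqF.
Qed.

(** The extension along rays is built from [enorm] and scalar multiples only, and [O] respects both,
    so the invariance of [leb3] carries over. *)
Lemma sphere_int_invariant (O : mR3 R -> mR3 R) (s : R) (f : mR3 R -> \bar R) :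
  norm_preserving O -> scale_equivariant O -> measurable_fun setT O ->
  transfer (@leb3 R) (@leb3 R) O (fun=> 1) ->
  measurable_fun setT f -> (forall x, 0 <= f x)%E ->
  sphere_int s (f \o O) = sphere_int s f.
Proof.
move=> iO hO mO trO mf f0.
rewrite (sphere_int_ball s (measurableT_comp mf mO) (fun x => f0 _)).
rewrite (sphere_int_ball s mf f0) [RHS](trO _ (measurable_cone s mf)); last first.
  by move=> x; rewrite mule_ge0// lee_fin divr_ge0 ?indicE ?sqr_ge0.
by apply: eq_integral => x _; rewrite mule1 /= iO hO.
Qed.

End sphere_invariance.

(** * The surface measure of a sphere *)

Section sphere_measure.
Variable R : realType.
Local Notation leb := (@lebesgue_measure R).
Local Notation T := (measurableTypeR R).

Lemma measurable_sph1 (s : R) : measurable_fun setT (fun p : T * T => sph s p : mR3 R).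
Proof. by rewrite /sph; meas. Qed.

(** The normalized area: for every [s] the total mass is [4 * pi]. The factor [s ^+ 2] of the true
    surface area is accounted for separately, in [ws] and in [shell_charge]. *)
Definition sigma (s : R) : {measure set (mR3 R) -> \bar R} :=
  measure_function_pushforward__canonical__measure_function_Measure
    (density (@leb2 R) (@measurable_wsph R) (@wsph_ge0 R)) (measurable_sph1 s).

Lemma transfer_sigma (s : R) :
  transfer (@leb2 R) (sigma s) (fun p => sph s p : mR3 R) (@wsph R).
Proof.
move=> f mf f0; rewrite /sigma ge0_integral_pushforward//; last exact: measurable_sph1.
rewrite preimage_setT ge0_integral_density//; last by move=> x; exact: f0.
exact: (measurableT_comp mf (measurable_sph1 s)).
Qed.

Lemma transfer_sigma_rot (s : R) (O : mR3 R -> mR3 R) :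
  norm_preserving O -> scale_equivariant O -> measurable_fun setT O ->
  transfer (@leb3 R) (@leb3 R) O (fun=> 1) ->
  transfer (@leb2 R) (sigma s) (fun p => O (sph s p)) (@wsph R).
Proof.
move=> iO hO mO trO f mf f0; rewrite (transfer_sigma s mf f0).
exact/esym/(sphere_int_invariant s iO hO mO trO mf f0).
Qed.

Lemma integrable_prod_fun (a b : T -> R) :
  leb.-integrable setT (EFin \o a) -> leb.-integrable setT (EFin \o b) ->
  (@leb2 R).-integrable setT (fun p => (a p.1 * b p.2)%:E).
Proof.
move=> /integrableP[/measurable_EFinP ma ia] /integrableP[/measurable_EFinP mb ib].
have m1 : measurable_fun setT (fun p : T * T => (a p.1 * b p.2)%:E).
  apply/measurable_EFinP; apply: measurable_funM.
    by apply: (measurableT_comp ma); meas.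
  by apply: (measurableT_comp mb); meas.
apply/(integrable12ltyP leb leb m1) => /=.
under eq_integral.
  move=> x _; rewrite (_ : \int[_]_y _ = `|(a x)%:E| * \int[leb]_y `|(b y)%:E|)%E; last first.
    rewrite -ge0_integralZl//; last first.
      by apply: measurableT_comp => //; exact/measurable_EFinP.
    by apply: eq_integral => y _; rewrite normrM EFinM.
  over.
rewrite ge0_integralZr//; last 2 first.
- by apply: measurableT_comp => //; exact/measurable_EFinP.
- by apply: integral_ge0.
apply: lte_mul_pinfty => //; first exact: integral_ge0.
by rewrite ge0_fin_numE//; exact: integral_ge0.
Qed.

Lemma Rintegral_prod_fun (a b : T -> R) :
  leb.-integrable setT (EFin \o a) -> leb.-integrable setT (EFin \o b) ->
  \int[@leb2 R]_p (a p.1 * b p.2) = (\int[leb]_x a x) * (\int[leb]_y b y).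
Proof.
move=> ia ib; have iab := integrable_prod_fun ia ib.
rewrite /Rintegral -(integral12_prod_meas1 iab) /fubini_F /=.
have fb : (\int[leb]_y (b y)%:E = (\int[leb]_y b y)%:E)%E.
  by rewrite /Rintegral fineK//; exact: integrable_fin_num ib.
rewrite (eq_integral (fun x => (a x)%:E * (\int[leb]_y b y)%:E)%E); last first.
  move=> x _; rewrite -fb -(integralZl measurableT ib).
  by apply: eq_integral => y _; rewrite EFinM.
rewrite (integralZr measurableT ia) fineM//; exact: integrable_fin_num ia.
Qed.

Lemma integrable_bounded_itv (a b M : R) (f : T -> R) : measurable_fun setT f ->
  (forall x, `|f x| <= M) ->
  leb.-integrable setT (fun x => (\1_(`[a, b]%classic : set R) x * f x)%:E).
Proof.
move=> mf fM.
have M0 : 0 <= M by exact: le_trans (fM 0).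
have i1 : leb.-integrable setT (EFin \o (\1_(`[a, b]%classic : set R) : T -> R)).
  exact: integrable_indic_itv.
have i2 := integrableZl measurableT M i1.
apply: (le_integrable measurableT _ _ i2).
  apply/measurable_EFinP; apply: measurable_funM => //; exact: measurable_indic.
move=> x _ /=; rewrite lee_fin !normrM mulrC ler_wpM2r//.
by rewrite (ger0_norm M0).
Qed.

Lemma Rintegral_indic_itv (a b : R) (f : T -> R) :
  \int[leb]_x (\1_(`[a, b]%classic : set R) x * f x) = \int[leb]_(x in `[a, b]) f x.
Proof.
rewrite [RHS]Rintegral_mkcond; apply: eq_Rintegral => x _.
by rewrite patchE indicE; case: ifPn; rewrite ?mul1r ?mul0r.
Qed.

Lemma RFTC2 (f F : R -> R) (a b : R) : a < b ->
  {in `[a, b], continuous f} ->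
  {in `]a, b[, forall x : R, is_derive x 1 F (f x)} ->
  {in `[a, b], continuous F} -> \int[leb]_(x in `[a, b]) f x = F b - F a.
Proof. by move=> ab cf dF cF; rewrite /Rintegral (FTC2_is_derive ab cf dF cF). Qed.

Lemma pi2_gt0 : 0 < 2 * pi :> R.
Proof. by rewrite mulr_gt0// pi_gt0. Qed.

Lemma int_cos : \int[leb]_(x in `[0, 2 * pi]) cos x = 0.
Proof.
rewrite (RFTC2 (F := sin) pi2_gt0).
- by rewrite sin0 mulr_natl sin2pi subr0.
- by move=> x _; exact: continuous_cos.
- by move=> x _; exact: is_derive_sin.
- by move=> x _; exact: continuous_sin.
Qed.

Lemma int_sin : \int[leb]_(x in `[0, 2 * pi]) sin x = 0.
Proof.
rewrite (RFTC2 (F := fun x => - cos x) pi2_gt0).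
- by rewrite cos0 mulr_natl cos2pi subrr.
- by move=> x _; exact: continuous_sin.
- by move=> x _; apply: (is_derive_eq (derN (is_derive_cos x))); rewrite opprK.
- by move=> x _; exact: (derivable_continuous1 (derN (is_derive_cos x))).
Qed.

Lemma int_sin_pi : \int[leb]_(x in `[0, pi]) sin x = 2.
Proof.
rewrite (RFTC2 (F := fun x => - cos x) (pi_gt0 R)).
- by rewrite cos0 cospi; ring.
- by move=> x _; exact: continuous_sin.
- by move=> x _; apply: (is_derive_eq (derN (is_derive_cos x))); rewrite opprK.
- by move=> x _; exact: (derivable_continuous1 (derN (is_derive_cos x))).
Qed.

Lemma int_one : \int[leb]_(x in `[0, 2 * pi]) (1 : R) = 2 * pi.
Proof.
rewrite (RFTC2 (F := id) pi2_gt0) ?subr0//.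
- by move=> x _; exact: cst_continuous.
- by move=> x _; exact: is_derive_id.
- by move=> x _; exact: cvg_id.
Qed.

(** The root, called [q] below, is the distance from the axis point at height [rho] to the points of
    the sphere at polar angle [t]. Taking [q] as the variable, [q dq = rho s sin t dt] and [rho - s
    cos t = (rho^2 - s^2 + q^2) / (2 rho)], so the integrand becomes a polynomial in [q]. *)
Lemma axis_integral (rho s : R) : 0 < s -> `|rho| <= s ->
  \int[leb]_(t in `[0, pi])
    (sin t * ((rho - s * cos t) / Num.sqrt (s ^+ 2 + rho ^+ 2 - 2 * rho * s * cos t)))
  = 4 * rho / (3 * s).
Proof.
(* The substitution divides by [rho], so the centre of the sphere is treated apart: there the
   integrand is [- cos t * sin t]. *)
move=> s0 rs; have [->|rho0] := eqVneq rho 0.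
  rewrite (_ : (fun t => _) = (fun t : R => - (cos t * sin t))); last first.
    apply/funext => t; rewrite expr0n mulr0 !mul0r subr0 addr0 sqrtr_sqr gtr0_norm//.
    by rewrite sub0r mulNr mulrAC divff ?gt_eqF// mul1r mulrN mulrC.
  rewrite (RFTC2 (F := fun t => 2^-1 * cos t ^+ 2) (pi_gt0 R)).
  - by rewrite cos0 cospi sqrrN subrr mulr0 mul0r.
  - move=> t _.
    exact: (derivable_continuous1 (derN (derM (is_derive_cos t) (is_derive_sin t)))).
  - move=> t _; apply: (is_derive_eq (derZ 2^-1 (derX 2 (is_derive_cos t)))).
    by rewrite /= expr1; field.
  - by move=> t _; exact: (derivable_continuous1 (derZ 2^-1 (derX 2 (is_derive_cos t)))).
pose w t : R := s ^+ 2 + rho ^+ 2 - 2 * rho * s * cos t.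
pose q t : R := Num.sqrt (w t).
have wE t : w t = (s - rho * cos t) ^+ 2 + rho ^+ 2 * sin t ^+ 2.
  rewrite /w; transitivity (s ^+ 2 + rho ^+ 2 * (cos t ^+ 2 + sin t ^+ 2)
    - 2 * rho * s * cos t); first by rewrite cos2Dsin2 mulr1.
  by ring.
have w0 t : 0 <= w t by rewrite wE addr_ge0 ?sqr_ge0// mulr_ge0 ?sqr_ge0.
have q2 t : q t ^+ 2 = w t by rewrite /q sqr_sqrtr.
have dw (t : R) : is_derive t 1 w (2 * rho * s * sin t).
  apply: (is_derive_eq (derD (der_cst (s ^+ 2 + rho ^+ 2) t 1)
    (derN (derZ (2 * rho * s) (is_derive_cos t))))).
  by rewrite add0r mulrN opprK.
have cq t : {for t, continuous q}.
  apply: continuous_comp; first exact: derivable_continuous1 (dw t).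
  exact: sqrt_continuous.
have dq (t : R) : 0 < w t -> is_derive t 1 q (rho * s * sin t / q t).
  move=> wt; apply: (is_derive_eq (der_comp (dw t) (is_derive1_sqrt wt))).
  rewrite -/(q t); have : q t != 0 by rewrite gt_eqF// sqrtr_gt0.
  by move=> ?; field.
pose f t : R := sin t * (((rho ^+ 2 - s ^+ 2) / q t + q t) / (2 * rho)).
rewrite (_ : (fun t => _) = f); last first.
  apply/funext => t; rewrite -/(w t) -/(q t) /f; congr (_ * _).
  (* If the point lies on the sphere, [q] has a zero; with [0^-1 = 0] both sides vanish there. *)
  have [qt|qt] := eqVneq (q t) 0; first by rewrite qt invr0 !mulr0 add0r mul0r.
  have E : 2 * rho * (rho - s * cos t) = rho ^+ 2 - s ^+ 2 + q t ^+ 2.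
    by rewrite q2 /w; ring.
  apply: (mulfI (_ : 2 * rho * q t != 0)); first by rewrite !mulf_neq0.
  transitivity (2 * rho * (rho - s * cos t)); first by field.
  by rewrite E; field; rewrite rho0.
pose F t : R := ((rho ^+ 2 - s ^+ 2) * q t + q t ^+ 3 / 3) / (2 * rho ^+ 2 * s).
have sn0 : s != 0 by rewrite gt_eqF.
have cf (t : R) : {for t, continuous f}.
  (* Continuity at a zero of [q]: if the point is on the sphere the singular term has coefficient
     [0]; otherwise [q] has no zero. *)
  have [E|NE] := eqVneq (rho ^+ 2 - s ^+ 2) 0.
    rewrite /f E.
    rewrite (_ : (fun t => _) = (fun t : R => sin t * (q t * (2 * rho)^-1))).
      apply: cvgM; first exact: continuous_sin.
      by apply: cvgM; [exact: cq|exact: cvg_cst].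
    by apply/funext => x; rewrite mul0r add0r.
  have wt : 0 < w t.
    rewrite lt_neqAle w0 andbT eq_sym; apply/eqP => wt0.
    move: wt0; rewrite wE => /eqP; rewrite paddr_eq0 ?sqr_ge0//; last by rewrite mulr_ge0 ?sqr_ge0.
    case/andP; rewrite expf_eq0 /= => /eqP h.
    rewrite mulf_eq0 expf_eq0 (negbTE rho0) /= expf_eq0 /= => /eqP h2.
    move/eqP: NE; apply; apply/eqP; rewrite subr_eq0; apply/eqP.
    have -> : s = rho * cos t by apply/eqP; rewrite -subr_eq0 h.
    by rewrite exprMn cos2sin2 h2 expr0n subr0 mulr1.
  have qt : q t != 0 by rewrite gt_eqF// sqrtr_gt0.
  exact: (derivable_continuous1 (derM (is_derive_sin t)
    (derM (derD (derZ (rho ^+ 2 - s ^+ 2) (derV qt (dq t wt))) (dq t wt))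
       (der_cst (2 * rho)^-1 t 1)))).
rewrite (RFTC2 (f := f) (F := F) (pi_gt0 R)).
(* The hypothesis that the point is not outside the sphere decides the signs of the roots:
   [q pi = s + rho] and [q 0 = s - rho]. *)
- have [l1 l2] : - s <= rho /\ rho <= s by apply/andP; rewrite -ler_norml.
  have qpi : q pi = s + rho.
    rewrite /q (_ : w pi = (s + rho) ^+ 2) ?sqrtr_sqr ?ger0_norm//; first lra.
    by rewrite /w cospi; ring.
  have q0 : q 0 = s - rho.
    rewrite /q (_ : w 0 = (s - rho) ^+ 2) ?sqrtr_sqr ?ger0_norm//; first lra.
    by rewrite /w cos0; ring.
  by rewrite /F qpi q0; field; rewrite rho0 sn0.
- by move=> t _; exact: cf.
- move=> t /[!in_itv]/= tI; have st := sin_gt0_pi tI.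
  have wt : 0 < w t.
    by rewrite wE ltr_wpDl ?sqr_ge0// mulr_gt0// exprn_even_gt0//= gt_eqF.
  have qt : q t != 0 by rewrite gt_eqF// sqrtr_gt0.
  apply: (is_derive_eq (derM (derD (derZ (rho ^+ 2 - s ^+ 2) (dq t wt))
    (derM (derX 3 (dq t wt)) (der_cst 3^-1 t 1)))
       (der_cst (2 * rho ^+ 2 * s)^-1 t 1))).
  by rewrite /f /=; field; rewrite qt rho0 sn0.
- move=> t _; apply: cvgM; last exact: cvg_cst.
  apply: cvgD; first by apply: cvgM; [exact: cvg_cst|exact: cq].
  apply: cvgM; last exact: cvg_cst.
  exact: (continuous_comp (cq t) (@exprn_continuous _ 3 _)).
Qed.

End sphere_measure.

(** * The convolution of K0 with a sphere *)

Section sphere_K0.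
Variable R : realType.
Local Notation leb := (@lebesgue_measure R).
Local Notation T := (measurableTypeR R).
Implicit Types x y v : R3 R.

Lemma dot_ge0 x : 0 <= dot x x.
Proof. by rewrite /dot !addr_ge0// -expr2 sqr_ge0. Qed.

Lemma enorm_ge0 x : 0 <= enorm x. Proof. exact: sqrtr_ge0. Qed.

Lemma enorm2 x : enorm x ^+ 2 = dot x x.
Proof. by rewrite /enorm sqr_sqrtr// dot_ge0. Qed.

Lemma dotZr (a : R) v x : dot v (a *: x) = a * dot v x.
Proof. by rewrite /dot /= /GRing.scale/=; ring. Qed.

Lemma enormZ (a : R) x : enorm (a *: x) = `|a| * enorm x.
Proof.
rewrite /enorm -sqrtr_sqr -sqrtrM ?sqr_ge0//; congr (Num.sqrt _).
by rewrite /dot /= /GRing.scale/=; ring.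
Qed.

Lemma normr_le_enorm x : [/\ `|x.1.1| <= enorm x, `|x.1.2| <= enorm x & `|x.2| <= enorm x].
Proof.
have H (a b : R) : 0 <= b -> `|a| <= Num.sqrt (a ^+ 2 + b).
  by move=> b0; rewrite -[X in X <= _]sqrtr_sqr ler_wsqrtr// lerDl.
rewrite /enorm /dot; split.
- by rewrite -!expr2 -addrA; apply: H; rewrite addr_ge0 ?sqr_ge0.
- by rewrite -!expr2 (addrC (x.1.1 ^+ 2)) -addrA; apply: H; rewrite addr_ge0 ?sqr_ge0.
- by rewrite -!expr2 addrC; apply: H; rewrite addr_ge0 ?sqr_ge0.
Qed.

Lemma enormN x : enorm (- x) = enorm x.
Proof. by rewrite /enorm /dot /= !mulrNN. Qed.

Lemma dot_K0_le v x : `|dot v (K0 x)| <= `|v.1.1| + `|v.1.2| + `|v.2|.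
Proof.
have H (a b : R) : `|b| <= enorm x -> `|a * ((enorm x)^-1 * b)| <= `|a|.
  move=> bx; rewrite normrM -[leRHS]mulr1 ler_wpM2l// normrM ger0_norm ?invr_ge0 ?enorm_ge0//.
  have [e0|e0] := eqVneq (enorm x) 0; first by rewrite e0 invr0 mul0r.
  by rewrite mulrC ler_pdivrMr ?mul1r// lt_neqAle eq_sym e0 enorm_ge0.
have [h1 h2 h3] := normr_le_enorm x.
rewrite /dot /K0 /= /GRing.scale/=.
by rewrite (le_trans (ler_normD _ _))// lerD ?H// (le_trans (ler_normD _ _))// lerD ?H.
Qed.

Lemma measurable_dot_K0 d (S : measurableType d) v (f : S -> mR3 R) :
  measurable_fun setT f -> measurable_fun setT (fun t => dot v (K0 (f t))).
Proof.
move=> mf; rewrite /dot /K0 /= /GRing.scale/= /GRing.scale/=.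
have me := measurable_enorm mf.
have mi := measurable_funV me.
by meas.
Qed.

Lemma measurable_R3B d (S : measurableType d) (f g : S -> mR3 R) :
  measurable_fun setT f -> measurable_fun setT g ->
  measurable_fun setT (fun t => (f t : R3 R) - g t : mR3 R).
Proof.
move=> mf mg.
rewrite (_ : (fun t => _) = (fun t => ((f t).1.1 - (g t).1.1, (f t).1.2 - (g t).1.2, (f t).2 - (g t).2)))//.
by meas.
Qed.

Let w0 : forall p : T * T, 0 <= wsph p := @wsph_ge0 R.

(** The field is paired with a vector [v], so that a rotation of [x] can be moved onto [v] as its
    adjoint. *)
Definition JK0 (s : R) v x := \int[sigma s]_y dot v (K0 (x - y)).

(** The components across the axis carry the integral of [cos] or [sin] over a full turn and vanish.
    The axial one is [2 * pi] times [axis_integral]. *)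
Lemma JK0_axis (s rho : R) v : 0 < s -> `|rho| <= s ->
  JK0 s v (0, 0, rho) = 8 * pi / (3 * s) * dot v (0, 0, rho).
Proof.
move=> s0 rs; rewrite /JK0.
have mf : measurable_fun setT (fun y : mR3 R => dot v (K0 (((0, 0, rho) : R3 R) - y))).
  by apply: measurable_dot_K0; apply: measurable_R3B; [exact: measurable_cst|exact: measurable_id].
rewrite (transfer_Rintegral w0 (transfer_sigma s) mf).
pose q (t : R) := Num.sqrt (s ^+ 2 + rho ^+ 2 - 2 * rho * s * cos t).
have qE t : s ^+ 2 + rho ^+ 2 - 2 * rho * s * cos t = (s * sin t) ^+ 2 + (rho - s * cos t) ^+ 2.
  transitivity (s ^+ 2 * (cos t ^+ 2 + sin t ^+ 2) + rho ^+ 2 - 2 * rho * s * cos t).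
    by rewrite cos2Dsin2 mulr1.
  by ring.
have eE p : enorm (((0, 0, rho) : R3 R) - sph s p) = q p.1.
  rewrite /enorm /q; congr (Num.sqrt _); rewrite qE /dot /sph /=.
  transitivity ((s * sin p.1) ^+ 2 * (cos p.2 ^+ 2 + sin p.2 ^+ 2) + (rho - s * cos p.1) ^+ 2).
    by ring.
  by rewrite cos2Dsin2 mulr1.
have q0 t : 0 <= q t by exact: sqrtr_ge0.
have bq (a t : R) : `|a| <= q t -> `|a / q t| <= 1.
  move=> aq; rewrite normrM normfV (ger0_norm (q0 t)).
  have [e0|e0] := eqVneq (q t) 0; first by rewrite e0 invr0 mulr0.
  by rewrite ler_pdivrMr ?mul1r// lt_neqAle eq_sym e0 sqrtr_ge0.
have b1 t : `|s * sin t| <= q t.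
  by rewrite /q qE -[X in X <= _]sqrtr_sqr ler_wsqrtr// lerDl sqr_ge0.
have b2 t : `|rho - s * cos t| <= q t.
  by rewrite /q qE -[X in X <= _]sqrtr_sqr ler_wsqrtr// lerDr sqr_ge0.
have mq : measurable_fun setT (fun t : T => (q t)^-1).
  by apply: measurable_funV; rewrite /q; meas.
pose I1 (t : T) : R := \1_(`[0, pi]%classic : set R) t * (s * sin t / q t * sin t).
pose I3 (t : T) : R := \1_(`[0, pi]%classic : set R) t * (sin t * ((rho - s * cos t) / q t)).
pose C1 (t : T) : R := \1_(`[0, 2 * pi]%classic : set R) t * cos t.
pose S1 (t : T) : R := \1_(`[0, 2 * pi]%classic : set R) t * sin t.
pose O1 (t : T) : R := \1_(`[0, 2 * pi]%classic : set R) t * 1.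
have iI1 : leb.-integrable setT (EFin \o I1).
  apply: (@integrable_bounded_itv _ 0 pi 1) => [|t]; first by meas.
  by rewrite normrM -[leRHS]mulr1 ler_pM// ?bq// sin_max.
have iI3 : leb.-integrable setT (EFin \o I3).
  apply: (@integrable_bounded_itv _ 0 pi 1) => [|t]; first by meas.
  by rewrite normrM -[leRHS]mulr1 ler_pM// ?bq// sin_max.
have iC1 : leb.-integrable setT (EFin \o C1).
  apply: (@integrable_bounded_itv _ 0 (2 * pi) 1); last by move=> t; exact: cos_max.
  exact: measurable_cosT.
have iS1 : leb.-integrable setT (EFin \o S1).
  apply: (@integrable_bounded_itv _ 0 (2 * pi) 1); last by move=> t; exact: sin_max.
  exact: measurable_sinT.
have iO1 : leb.-integrable setT (EFin \o O1).
  apply: (@integrable_bounded_itv _ 0 (2 * pi) 1); last by move=> t; rewrite normr1.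
  exact: measurable_cst.
have fE p : dot v (K0 (((0, 0, rho) : R3 R) - sph s p)) * wsph p =
  (- v.1.1) * (I1 p.1 * C1 p.2) + ((- v.1.2) * (I1 p.1 * S1 p.2) + v.2 * (I3 p.1 * O1 p.2)).
  by rewrite /K0 eE /dot /wsph /I1 /C1 /S1 /O1 /I3 /sph /= /GRing.scale/=; ring.
transitivity (\int[leb2]_p ((- v.1.1) * (I1 p.1 * C1 p.2) +
  ((- v.1.2) * (I1 p.1 * S1 p.2) + v.2 * (I3 p.1 * O1 p.2)))).
  by apply: eq_Rintegral => p _; exact: fE.
have i1 := integrable_prod_fun iI1 iC1.
have i2 := integrable_prod_fun iI1 iS1.
have i3 := integrable_prod_fun iI3 iO1.
have j1 : (@leb2 R).-integrable setT (EFin \o (fun p => (- v.1.1) * (I1 p.1 * C1 p.2))).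
  exact: (integrableZl measurableT (- v.1.1) i1).
have j2 : (@leb2 R).-integrable setT (EFin \o (fun p => (- v.1.2) * (I1 p.1 * S1 p.2))).
  exact: (integrableZl measurableT (- v.1.2) i2).
have j3 : (@leb2 R).-integrable setT (EFin \o (fun p => v.2 * (I3 p.1 * O1 p.2))).
  exact: (integrableZl measurableT v.2 i3).
have j23 : (@leb2 R).-integrable setT (EFin \o (fun p => (- v.1.2) * (I1 p.1 * S1 p.2) + v.2 * (I3 p.1 * O1 p.2))).
  exact: (integrableD measurableT j2 j3).
rewrite (RintegralD measurableT j1 j23) (RintegralD measurableT j2 j3).
rewrite (RintegralZl _ measurableT i1) (RintegralZl _ measurableT i2) (RintegralZl _ measurableT i3).
rewrite (Rintegral_prod_fun iI1 iC1) (Rintegral_prod_fun iI1 iS1) (Rintegral_prod_fun iI3 iO1).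
rewrite /C1 /S1 /O1 /I3 !Rintegral_indic_itv int_cos int_sin int_one.
rewrite (axis_integral s0 rs) /dot /=; field.
by rewrite gt_eqF.
Qed.

(** The sphere is parametrized by [O (sph s p)] instead of [sph s p]; then [O] factors out of
    [K0 (O x - O y)] and passes to [v] as its adjoint [O']. *)
Lemma JK0_rot (O O' : mR3 R -> mR3 R) (s : R) v x :
  norm_preserving O -> scale_equivariant O -> measurable_fun setT O ->
  transfer (@leb3 R) (@leb3 R) O (fun=> 1) ->
  (forall y z : R3 R, O (y - z : R3 R) = (O y : R3 R) - O z) ->
  (forall y z, dot y (O z) = dot (O' y) z) ->
  JK0 s v (O x) = JK0 s (O' v) x.
Proof.
move=> iO hO mO trO OB adj; rewrite /JK0.
have mf (w z : R3 R) : measurable_fun setT (fun y : mR3 R => dot w (K0 (z - y))).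
  by apply: measurable_dot_K0; apply: measurable_R3B; [exact: measurable_cst|exact: measurable_id].
rewrite (transfer_Rintegral w0 (transfer_sigma_rot s iO hO mO trO) (mf v (O x))).
rewrite (transfer_Rintegral w0 (transfer_sigma s) (mf (O' v) x)).
apply: eq_Rintegral => p _; congr (_ * _).
by rewrite -OB /K0 iO -hO adj.
Qed.

Lemma JK0_rot12 (c d s : R) v x : c ^+ 2 + d ^+ 2 = 1 -> d != 0 ->
  JK0 s v (rot12 c d x) = JK0 s (rot12 c (- d) v) x.
Proof.
move=> cd d0; apply: JK0_rot.
- move=> y; rewrite /enorm; congr (Num.sqrt _); rewrite /dot /rot12 /=.
  transitivity ((c ^+ 2 + d ^+ 2) * (y.1.1 * y.1.1 + y.1.2 * y.1.2) + y.2 * y.2); first by ring.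
  by rewrite cd mul1r.
- by move=> a y; rewrite /rot12; congr (_, _, _); rewrite /= /GRing.scale/=; ring.
- exact: measurable_rot12.
- exact: leb3_rot12.
- by move=> y z; rewrite /rot12 /=; congr (_, _, _) => /=; ring.
- by move=> y z; rewrite /rot12 /dot /=; ring.
Qed.

Lemma JK0_rot13 (c d s : R) v x : c ^+ 2 + d ^+ 2 = 1 -> d != 0 ->
  JK0 s v (rot13 c d x) = JK0 s (rot13 c (- d) v) x.
Proof.
move=> cd d0; apply: JK0_rot.
- move=> y; rewrite /enorm; congr (Num.sqrt _); rewrite /dot /rot13 /=.
  transitivity ((c ^+ 2 + d ^+ 2) * (y.1.1 * y.1.1 + y.2 * y.2) + y.1.2 * y.1.2); first by ring.
  by rewrite cd mul1r; ring.
- by move=> a y; rewrite /rot13; congr (_, _, _); rewrite /= /GRing.scale/=; ring.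
- exact: measurable_rot13.
- exact: leb3_rot13.
- by move=> y z; rewrite /rot13 /=; congr (_, _, _) => /=; ring.
- by move=> y z; rewrite /rot13 /dot /=; ring.
Qed.

(** Cosine and sine of the angle of [(a, b)]; [b != 0] keeps the sine nonzero, as the factorization
    of rotations into shears demands. *)
Lemma rotation_param (a b : R) : b != 0 -> let r := Num.sqrt (a ^+ 2 + b ^+ 2) in
  [/\ r != 0, (a / r) ^+ 2 + (b / r) ^+ 2 = 1, b / r != 0 & r ^+ 2 = a ^+ 2 + b ^+ 2].
Proof.
move=> b0 r; have p : 0 < a ^+ 2 + b ^+ 2 by rewrite ltr_wpDl ?sqr_ge0// exprn_even_gt0.
have r0 : r != 0 by rewrite gt_eqF// sqrtr_gt0.
have r2 : r ^+ 2 = a ^+ 2 + b ^+ 2 by rewrite /r sqr_sqrtr// ltW.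
split => //; last by rewrite mulf_neq0// invr_neq0.
by rewrite !exprMn -mulrDl -r2 -exprMn divff// expr1n.
Qed.

Lemma JK0_plane (s : R) v (a z : R) : 0 < s -> enorm (a, 0, z) <= s ->
  JK0 s v (a, 0, z) = 8 * pi / (3 * s) * dot v (a, 0, z).
Proof.
move=> s0; have [->|a0] := eqVneq a 0 => ns.
  by apply: JK0_axis => //; rewrite (le_trans _ ns)//; have [] := normr_le_enorm (0, 0, z).
(* [rot13 c d] sends [(0, 0, r)] to [(- d * r, 0, c * r)], hence the sign of [a]. *)
have Na : - a != 0 by rewrite oppr_eq0.
have [r0 cd d0 r2] := rotation_param z Na.
set r := Num.sqrt _ in r0 cd d0 r2.
have E : rot13 (z / r) (- a / r) (0, 0, r) = (a, 0, z).
  by rewrite /rot13 /= !mulr0 !add0r; congr (_, _, _); field.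
rewrite -E JK0_rot13// JK0_axis//; last first.
  rewrite (le_trans _ ns)// /enorm /dot /= mulr0 addr0 -!expr2 ger0_norm ?sqrtr_ge0//.
  by rewrite /r sqrrN addrC.
by congr (_ * _); rewrite /rot13 /dot /=; ring.
Qed.

(** Two rotations bring [x] to the axis. The linear form reflects Newton's theorem: the divergence
    of [K0] is [2 / |x|], whose potential over a sphere is constant inside it. *)
Lemma JK0E (s : R) v x : 0 < s -> enorm x <= s ->
  JK0 s v x = 8 * pi / (3 * s) * dot v x.
Proof.
case: x => -[x y] z s0 ns; have [E|y0] := eqVneq y 0.
  by move: ns; rewrite E => ns; exact: JK0_plane.
have [r0 cd d0 r2] := rotation_param x y0.
set r := Num.sqrt _ in r0 cd d0 r2.
have E : rot12 (x / r) (y / r) (r, 0, z) = (x, y, z).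
  by rewrite /rot12 /= !mulr0 subr0 addr0; congr (_, _, _); field.
rewrite -E JK0_rot12// JK0_plane//; last first.
  rewrite (le_trans _ ns)// /enorm ler_wsqrtr// /dot /= mulr0 addr0 -!expr2.
  by rewrite r2.
by congr (_ * _); rewrite /rot12 /dot /=; ring.
Qed.

Lemma sigma_setT (s : R) : sigma s setT = (4 * pi)%:E.
Proof.
have -> : sigma s setT = (\int[sigma s]_y (1 : R)%:E)%E.
  by rewrite integral_cst// mul1e.
rewrite (transfer_sigma s)//.
pose I1 (t : T) : R := \1_(`[0, pi]%classic : set R) t * sin t.
pose O1 (t : T) : R := \1_(`[0, 2 * pi]%classic : set R) t * 1.
have iI1 : leb.-integrable setT (EFin \o I1).
  apply: (@integrable_bounded_itv _ 0 pi 1); last by move=> t; exact: sin_max.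
  exact: measurable_sinT.
have iO1 : leb.-integrable setT (EFin \o O1).
  apply: (@integrable_bounded_itv _ 0 (2 * pi) 1); last by move=> t; rewrite normr1.
  exact: measurable_cst.
have := Rintegral_prod_fun iI1 iO1.
rewrite /I1 /O1 !Rintegral_indic_itv int_one int_sin_pi /Rintegral => E.
rewrite -[LHS]fineK; last first.
  rewrite (eq_integral (fun p => (I1 p.1 * O1 p.2)%:E)).
    exact: (integrable_fin_num measurableT (integrable_prod_fun iI1 iO1)).
  by move=> p _; rewrite mul1e /wsph /I1 /O1; congr EFin; ring.
rewrite (_ : 4 * pi = 2 * (2 * pi)); last by ring.
rewrite -E; congr (fine _)%:E; apply: eq_integral => p _.
by rewrite mul1e /wsph; congr EFin; ring.
Qed.

End sphere_K0.

(** * The error function *)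

Section gauss_erf.
Variable R : realType.
Local Notation leb := (@lebesgue_measure R).
Implicit Types (z m r : R).

Let g (u : R) : R := expR (- u ^+ 2).

Let der_g (u : R) : is_derive u 1 g (- (2 * u) * g u).
Proof.
have h := derN (derX 2 (is_derive_id u 1)).
apply: (is_derive_eq (der_comp h (is_derive_expR _))).
by rewrite /g /= expr1 mulr1 mulrC.
Qed.

Let cont_g : continuous g.
Proof. by move=> u; exact: derivable_continuous1 (der_g u). Qed.

Let I0 z := \int[leb]_(u in `[0, z]) g u.

Lemma erf_pos z : 0 <= z -> erf z = 2 / Num.sqrt pi * I0 z.
Proof.
move=> z0; suff E : \int[leb]_(u in `[z, 0]) expR (- u ^+ 2) = 0.
  by rewrite /erf E subr0.
have [->|zn0] := eqVneq z 0; first by rewrite set_itv1 Rintegral_set1.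
rewrite set_itv_ge ?Rintegral_set0// bnd_simp -ltNge.
by rewrite lt_neqAle eq_sym zn0.
Qed.

Let int_g z : leb.-integrable `[0, z] (EFin \o g).
Proof.
apply: continuous_compact_integrable; first exact: segment_compact.
by apply: continuous_subspaceT; exact: cont_g.
Qed.

Lemma is_derive_erf z : 0 < z ->
  is_derive z 1 (@erf R) (2 / Num.sqrt pi * expR (- z ^+ 2)).
Proof.
move=> z0.
have zu : z < z + 1 by rewrite ltrDl.
have [d1 d2] := @continuous_FTC1 _ g (BLeft 0) z (z + 1) zu (int_g (z + 1)) z0 (@cont_g z).
have D : is_derive z 1 I0 (g z) by split; [exact: d1|rewrite -derive1E; exact: d2].
apply: (near_eq_is_derive _ (derZ (2 / Num.sqrt pi) D)).
near=> y; rewrite erf_pos//; apply: ltW.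
by near: y; exact: lt_nbhsr.
Unshelve. all: by end_near. Qed.

Lemma erf0 : erf (0 : R) = 0.
Proof. by rewrite erf_pos// /I0 set_itv1 Rintegral_set1 mulr0. Qed.

Lemma erf_within z : 0 <= z -> {within `[0, z], continuous (@erf R)}.
Proof.
move=> z0; have cI : {within `[0, z], continuous I0}.
  by apply: parameterized_integral_continuous => //; exact: int_g.
apply: (@subspace_eq_continuous _ _ _ (fun z => 2 / Num.sqrt pi * I0 z)).
  by move=> x /set_mem /=; rewrite in_itv/= => /andP[x0 _]; exact/esym/erf_pos.
by move=> x; apply: cvgM; [exact: cvg_cst|exact: cI].
Qed.

Lemma erf_right0 : erf x @[x --> (0 : R)^'+] --> (0 : R).
Proof.
have /(continuous_within_itvP _ (ltr01 : (0 : R) < 1)) [_ h _] := erf_within (ler01 : (0 : R) <= 1).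
by move: h; rewrite erf0.
Qed.

Lemma ltr_erf z1 z2 : 0 <= z1 -> z1 < z2 -> erf z1 < erf z2.
Proof.
move=> z10 z12; have z20 : 0 <= z2 by rewrite (le_trans z10)// ltW.
apply: (gtr0_derive1_incr _ _ (erf_within z20) z10 z12 (lexx z2)).
- by move=> x /[!in_itv]/= /andP[x0 _]; have [] := is_derive_erf x0.
- move=> x /[!in_itv]/= /andP[x0 _]; rewrite derive1E.
  have [_ ->] := is_derive_erf x0.
  by rewrite mulr_gt0 ?expR_gt0// divr_gt0// sqrtr_gt0 pi_gt0.
Qed.

Lemma cvgy_erf : erf x @[x --> +oo] --> (1 : R).
Proof.
have spi : Num.sqrt pi != 0 :> R by rewrite gt_eqF// sqrtr_gt0 pi_gt0.
have cI : I0 x @[x --> +oo] --> Num.sqrt pi / 2.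
  (* The Gaussian integral is available for the square of the partial integral; nonnegativity of
     [I0] allows taking the root. *)
  have : Num.sqrt (I0 x ^+ 2) @[x --> +oo] --> Num.sqrt (pi / 4 : R).
    apply: continuous_cvg => //; first exact: sqrt_continuous.
    exact: gauss_integral_proof.cvg_integral0_gauss_sqr.
  rewrite sqrtrM ?pi_ge0// sqrtrV// (_ : 4 = 2 ^+ 2); last by rewrite expr2 -natrM.
  rewrite sqrtr_sqr ger0_norm// (_ : (fun _ => Num.sqrt _) = I0)//.
  apply/funext => x; rewrite sqrtr_sqr ger0_norm//.
  by apply: Rintegral_ge0 => t _; exact: expR_ge0.
have : 2 / Num.sqrt pi * I0 x @[x --> +oo] --> 2 / Num.sqrt pi * (Num.sqrt pi / 2).
  by apply: cvgM => //; exact: cvg_cst.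
rewrite (_ : 2 / Num.sqrt pi * (Num.sqrt pi / 2) = 1 :> R); last by field.
apply: cvg_trans; apply: near_eq_cvg.
near=> x; rewrite erf_pos//; near: x; exact: nbhs_pinfty_ge.
Unshelve. all: by end_near. Qed.

Lemma erf_ge0 z : 0 <= z -> 0 <= erf z.
Proof.
move=> z0; rewrite erf_pos// mulr_ge0 ?divr_ge0 ?sqrtr_ge0//.
by apply: Rintegral_ge0 => t _; exact: expR_ge0.
Qed.

Lemma erf_le1 z : 0 <= z -> erf z <= 1.
Proof.
move=> z0; apply: (cvgr_to_ge cvgy_erf); near=> x.
have zx : z < x by near: x; apply: nbhs_pinfty_gt; exact: num_real.
by rewrite ltW// ltr_erf.
Unshelve. all: by end_near. Qed.

Lemma erf_exists_unique m : 1 < m ->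
  exists! r, 0 < r /\ erf (r / Num.sqrt 2) = 1 / m.
Proof.
move=> m1; have m0 : 0 < m by exact: lt_trans m1.
have s2 : 0 < Num.sqrt 2 :> R by rewrite sqrtr_gt0.
have im : 1 / m < 1 by rewrite div1r invf_lt1.
have im0 : 0 < 1 / m by rewrite div1r invr_gt0.
have [b [b0 eb]] : exists b : R, 0 <= b /\ 1 / m <= erf b.
  near (pinfty_nbhs R) => b; exists b; split.
    by near: b; exact: nbhs_pinfty_ge.
  by apply: ltW; near: b; exact: (cvgr_gt _ cvgy_erf).
have [||z z0b ez] := @IVT R (@erf R) 0 b (1 / m) b0.
- exact: erf_within.
- by rewrite erf0 min_l ?erf_ge0// max_r ?erf_ge0// eb ltW.
have z0 : 0 < z.
  rewrite lt_neqAle; move: z0b; rewrite in_itv/= => /andP[-> _]; rewrite andbT.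
  by apply/eqP => zE; move: ez im0; rewrite -zE erf0 => <-; rewrite ltxx.
exists (z * Num.sqrt 2); split.
  by split; [rewrite mulr_gt0|rewrite mulfK ?gt_eqF].
move=> r [r0 er]; suff : z = r / Num.sqrt 2 by move=> ->; rewrite divfK ?gt_eqF.
have rs : 0 < r / Num.sqrt 2 by rewrite divr_gt0.
apply/eqP; rewrite eq_le !leNgt; apply/andP; split; apply/negP => h.
  by have := ltr_erf (ltW rs) h; rewrite er ez ltxx.
by have := ltr_erf (ltW z0) h; rewrite er ez ltxx.
Unshelve. all: by end_near. Qed.

(** Written through [erf] by the substitution [u = sqrt 2 * t], so that the bounds and the limit of
    [erf] carry over. *)
Definition G (s : R) : R := Num.sqrt (pi / 2) * erf (s / Num.sqrt 2).

Lemma is_derive_G (s : R) : 0 < s -> is_derive s 1 G (expR (- s ^+ 2 / 2)).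
Proof.
move=> s0; have s2 : 0 < Num.sqrt 2 :> R by rewrite sqrtr_gt0.
have h1 : is_derive s 1 (fun t : R => (Num.sqrt 2)^-1 * t) ((Num.sqrt 2)^-1 * 1).
  exact: (derZ (Num.sqrt 2)^-1 (is_derive_id s 1)).
have sp : 0 < (Num.sqrt 2)^-1 * s by rewrite mulr_gt0 ?invr_gt0.
have h2 := derZ (Num.sqrt (pi / 2)) (der_comp h1 (is_derive_erf sp)).
rewrite /G (_ : (fun s => _) = (fun y : R => Num.sqrt (pi / 2) * erf ((Num.sqrt 2)^-1 * y))).
  apply: (is_derive_eq h2).
  have spi : Num.sqrt pi != 0 :> R by rewrite gt_eqF// sqrtr_gt0 pi_gt0.
  have -> : - ((Num.sqrt 2)^-1 * s) ^+ 2 = - s ^+ 2 / 2.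
    by rewrite exprMn exprVn sqr_sqrtr// mulrC mulNr.
  rewrite sqrtrM ?pi_ge0// sqrtrV// mulr1.
  have s22 : Num.sqrt 2 * Num.sqrt 2 = 2 :> R by rewrite -expr2 sqr_sqrtr.
  transitivity (2 / (Num.sqrt 2 * Num.sqrt 2) * expR (- s ^+ 2 / 2)).
    by field; rewrite gt_eqF.
  by rewrite s22 divff// mul1r.
by apply/funext => y; rewrite mulrC [in RHS](mulrC _^-1) mulrC.
Qed.

Lemma G_ge0 s : 0 <= s -> 0 <= G s.
Proof. by move=> s0; rewrite mulr_ge0 ?sqrtr_ge0 ?erf_ge0 ?divr_ge0 ?sqrtr_ge0. Qed.

Lemma G_le s : 0 <= s -> G s <= Num.sqrt (pi / 2).
Proof. by move=> s0; rewrite ler_piMr ?sqrtr_ge0 ?erf_le1 ?divr_ge0 ?sqrtr_ge0. Qed.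

Lemma G_right0 : G x @[x --> (0 : R)^'+] --> (0 : R).
Proof.
have s1 : 1 <= Num.sqrt 2 :> R by rewrite -[X in X <= _]sqrtr1 ler_wsqrtr// ler1n.
have s2 : 0 < Num.sqrt 2 :> R by rewrite sqrtr_gt0.
suff : G x @[x --> (0 : R)^'+] --> Num.sqrt (pi / 2) * (0 : R) by rewrite mulr0.
apply: cvgM; first exact: cvg_cst.
apply: cvg_comp erf_right0.
move=> A [d /= d0 dA]; exists d => //= t; rewrite /ball_ /= !sub0r !normrN => td t0.
apply: dA; last by rewrite divr_gt0.
rewrite /ball_ /= sub0r normrN (le_lt_trans _ td)// normrM ler_piMr//.
by rewrite normfV gtr0_norm// invf_le1.
Qed.

Lemma G0 : G 0 = 0.
Proof. by rewrite /G mul0r erf0 mulr0. Qed.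

(** The normalization of [omega m]: [Num.sqrt (pi / 2)] is the integral of [s^2 exp(- s^2 / 2)] over
    the half-line, so the left-hand side is the total mass. *)
Lemma cm_sqrt m : 4 * pi * cm m * Num.sqrt (pi / 2) = m.
Proof.
rewrite /cm.
have -> : (2 * pi) `^ (3 / 2) = (2 * pi) * (Num.sqrt 2 * Num.sqrt pi) :> R.
  have p0 : 0 <= 2 * pi :> R by rewrite mulr_ge0// pi_ge0.
  have -> : 3 / 2 = 1 + 2^-1 :> R by field.
  rewrite powRD ?powRr1// ?powR12_sqrt ?sqrtrM//.
  by rewrite mulf_eq0 negb_or pnatr_eq0/= gt_eqF ?pi_gt0 ?implybT.
rewrite sqrtrM ?pi_ge0// sqrtrV//.
have spi : Num.sqrt pi != 0 :> R by rewrite gt_eqF// sqrtr_gt0 pi_gt0.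
have p0 : pi != 0 :> R by rewrite gt_eqF// pi_gt0.
have s2 : Num.sqrt 2 != 0 :> R by rewrite gt_eqF// sqrtr_gt0.
have s22 : Num.sqrt 2 * Num.sqrt 2 = 2 :> R by rewrite -expr2 sqr_sqrtr.
have key (a b p : R) : a != 0 -> b != 0 -> p != 0 ->
    4 * p * (m / (2 * p * (a * b))) * (b / a) = m * (2 / (a * a)).
  by move=> a0 b0 q0; field; rewrite a0 b0 q0.
by rewrite key// s22 divff// mulr1.
Qed.

Lemma cmG m s : 4 * pi * cm m * G s = m * erf (s / Num.sqrt 2).
Proof. by rewrite /G mulrA cm_sqrt. Qed.

End gauss_erf.

(** * The exterior Dirichlet problem *)

Section coordinates.
Variable R : realType.
Implicit Types (x v : R3 R) (i j : 'I_3).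

Definition xcoord i x : R := dot (basis3 i) x.


Lemma sum_coord (f : R -> R) x :
  \sum_(i < 3) f (xcoord i x) = f x.1.1 + f x.1.2 + f x.2.
Proof.
rewrite !big_ord_recl big_ord0 addr0 addrA /xcoord /dot /= !mul1r !mul0r.
by rewrite !(addr0, add0r).
Qed.

Lemma xcoordD i x v : xcoord i (x + v) = xcoord i x + xcoord i v.
Proof. by rewrite /xcoord /dot /=; ring. Qed.

Lemma xcoordZ i (a : R) x : xcoord i (a *: x) = a * xcoord i x.
Proof. exact: dotZr. Qed.

Lemma xcoord_basis i j : xcoord i (basis3 j) = (i == j)%:R.
Proof.
by case: i j => -[|[|[|//]]] ? [[|[|[|//]]] ?]; rewrite /xcoord /dot /=;
  rewrite ?(mul0r, mulr0, mul1r, add0r, addr0).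
Qed.

Lemma der_coord i x v : is_derive x v (xcoord i) (xcoord i v).
Proof.
apply/is_derive_lineP.
rewrite (_ : (fun h : R => _) = (fun h => h * xcoord i v + xcoord i x)); last first.
  by apply/funext => h; rewrite xcoordD xcoordZ.
apply: (is_derive_eq (derD (derM (is_derive_id (0 : R) 1) (der_cst (xcoord i v) (0 : R) 1))
  (der_cst (xcoord i x) (0 : R) 1))).
by rewrite mul1r mulr0 !addr0.
Qed.

Lemma continuous_11 : continuous (fun y : R3 R => y.1.1).
Proof. by move=> x; apply: (cvg_comp fst fst (G := nbhs x.1)); exact: cvg_fst. Qed.

Lemma continuous_12 : continuous (fun y : R3 R => y.1.2).
Proof. by move=> x; apply: (cvg_comp fst snd (G := nbhs x.1)); [exact: cvg_fst|exact: cvg_snd]. Qed.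

Lemma continuous_2 : continuous (fun y : R3 R => y.2).
Proof. by move=> x; exact: cvg_snd. Qed.

Lemma continuous_dot (v : R3 R) : continuous (dot v).
Proof.
move=> x; rewrite /dot; apply: cvgD; [apply: cvgD|];
  (apply: cvgM; first exact: cvg_cst).
- exact: continuous_11.
- exact: continuous_12.
- exact: continuous_2.
Qed.

Lemma continuous_coord i : continuous (xcoord i).
Proof. exact: continuous_dot. Qed.

Lemma continuous_enorm : continuous (@enorm R).
Proof.
move=> x; rewrite /enorm; apply: continuous_comp; last exact: sqrt_continuous.
rewrite /dot; apply: cvgD; [apply: cvgD|]; apply: cvgM;
  by [exact: continuous_11|exact: continuous_12|exact: continuous_2].
Qed.

Lemma dotE x v : dot x v = \sum_(i < 3) xcoord i x * xcoord i v.
Proof.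
rewrite !big_ord_recl big_ord0 addr0 addrA /xcoord /dot /= !mul1r !mul0r.
by rewrite !(addr0, add0r).
Qed.

Lemma der_enorm x v : enorm x != 0 -> is_derive x v (@enorm R) (dot x v / enorm x).
Proof.
move=> x0; have xp : 0 < dot x x.
  by rewrite -enorm2 exprn_even_gt0.
have d i := derM (der_coord i x v) (der_coord i x v).
have dd : is_derive x v (fun y => dot y y) (2 * dot x v).
  rewrite (_ : (fun y => _) = (fun y => xcoord ord0 y * xcoord ord0 y +
    (xcoord (lift ord0 ord0) y * xcoord (lift ord0 ord0) y +
     xcoord (lift ord0 (lift ord0 ord0)) y * xcoord (lift ord0 (lift ord0 ord0)) y))); last first.
    by apply/funext => y; rewrite dotE !big_ord_recl big_ord0 addr0.
  apply: (is_derive_eq (derD (d _) (derD (d _) (d _)))).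
  by rewrite dotE !big_ord_recl big_ord0 addr0; ring.
apply: (is_derive_eq (der_comp dd (is_derive1_sqrt xp))).
by rewrite -/(enorm x); field.
Qed.

Lemma der_radial (h : R -> R) (dh : R) x v : enorm x != 0 ->
  is_derive (enorm x) 1 h dh ->
  is_derive x v (fun y => h (enorm y)) (dh * (dot x v / enorm x)).
Proof. by move=> x0 hh; exact: der_comp (der_enorm v x0) hh. Qed.

Lemma dot_basis x i : dot x (basis3 i) = xcoord i x.
Proof. by rewrite /xcoord /dot; ring. Qed.

Lemma open_ext r : open [set x : R3 R | r < enorm x].
Proof.
rewrite (_ : [set x | _] = @enorm R @^-1` `]r, +oo[%classic); last first.
  by apply/seteqP; split => x /=; rewrite in_itv/= andbT.
by move/continuousP : continuous_enorm; apply; exact: interval_open.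
Qed.

Lemma near_ext r x : r < enorm x -> \forall y \near x, r < enorm y.
Proof. by move=> rx; exact: (open_nbhs_nbhs (conj (@open_ext r) rx)). Qed.

End coordinates.

Section radial_solution.
Variables (R : realType) (c r : R).
Hypothesis (r0 : 0 < r).
Implicit Types (x y : R3 R) (i j : 'I_3).

Definition expg (s : R) : R := expR (- s ^+ 2 / 2).
(** This is [s ^+ 2] times the derivative of [ur], that is, the flux of the gradient of [Ur] through
    the sphere of radius [s] divided by [4 pi]. Its derivative [c * s ^+ 2 * expg s] is the Poisson
    equation in radial form. *)
Definition qr (s : R) : R := c * (G s - G r) - c * (s * expg s).
Definition ur (s : R) : R := - c * (G s - G r) / s.
(** The maximum yields the value [ur r = 0] in the ball and keeps the argument of [ur] away from
    [0], so [Ur] is globally a composition of continuous functions. *)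
Definition Ur x : R := ur (Num.max r (enorm x)).

Lemma der_expg (s : R) : is_derive s 1 expg (- s * expg s).
Proof.
have h := derM (derN (derX 2 (is_derive_id s 1))) (der_cst 2^-1 s 1).
apply: (is_derive_eq (der_comp h (is_derive_expR _))).
by rewrite /expg /= expr1 mulr0 addr0 mulr1; field.
Qed.

Lemma der_qr (s : R) : 0 < s -> is_derive s 1 qr (c * s ^+ 2 * expg s).
Proof.
move=> s0.
have h1 := derZ c (derD (is_derive_G s0) (der_cst (- G r) s 1)).
have h2 := derZ c (derM (is_derive_id s 1) (der_expg s)).
apply: (is_derive_eq (derD h1 (derN h2))).
by rewrite -/(expg s); ring.
Qed.

Lemma der_ur (s : R) : 0 < s -> is_derive s 1 ur (qr s / s ^+ 2).
Proof.
move=> s0; have sn : s != 0 by rewrite gt_eqF.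
have h1 := derZ (- c) (derD (is_derive_G s0) (der_cst (- G r) s 1)).
apply: (is_derive_eq (derM h1 (derV (f := fun y : R => y) sn (is_derive_id s 1)))).
by rewrite -/(expg s) /qr; field.
Qed.

(** The derivative of [ur] divided by [s]: the gradient of [Ur] at [x] is [q3 (enorm x)] times [x],
    and [dq3] is the derivative of [q3]. *)
Definition q3 (s : R) : R := qr s / s ^+ 3.
Definition dq3 (s : R) : R := c * expg s / s - 3 * qr s / s ^+ 4.

Lemma der_q3 (s : R) : 0 < s -> is_derive s 1 q3 (dq3 s).
Proof.
move=> s0; have sn : s != 0 by rewrite gt_eqF.
have sn3 : s ^+ 3 != 0 by rewrite expf_neq0.
apply: (is_derive_eq (derM (der_qr s0)
  (derV (f := fun y : R => y ^+ 3) sn3 (derX 3 (is_derive_id s 1))))).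
by rewrite /dq3 /=; field.
Qed.

Lemma urr : ur r = 0. Proof. by rewrite /ur subrr mulr0 mul0r. Qed.

Lemma Ur_in x : enorm x <= r -> Ur x = 0.
Proof. by move=> xr; rewrite /Ur max_l// urr. Qed.

Lemma Ur_out x : r <= enorm x -> Ur x = ur (enorm x).
Proof. by move=> xr; rewrite /Ur max_r. Qed.

Lemma enorm_neq0 x : r < enorm x -> enorm x != 0.
Proof. by move=> rx; rewrite gt_eqF// (lt_trans r0). Qed.

Lemma continuous_Ur : continuous Ur.
Proof.
move=> x; have mr : 0 < Num.max r (enorm x) by rewrite lt_max r0.
apply: (continuous_comp (f := fun y => Num.max r (enorm y))).
  apply: (cvg_comp (@enorm R) (fun s => Num.max r s) (G := nbhs (enorm x))).
    exact: continuous_enorm.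
  rewrite (_ : (fun s => Num.max r s) = (fun s => (r + s + `|r - s|) / 2)); last first.
    by apply/funext => s; rewrite maxr_absE.
  rewrite maxr_absE; apply: cvgM; last exact: cvg_cst.
  apply: cvgD; first by apply: cvgD; [exact: cvg_cst|exact: cvg_id].
  by apply: cvg_norm; apply: cvgB; [exact: cvg_cst|exact: cvg_id].
exact: derivable_continuous1 (der_ur mr).
Qed.

Definition dU i x : R := q3 (enorm x) * xcoord i x.
Definition ddU j i x : R :=
  dq3 (enorm x) / enorm x * xcoord j x * xcoord i x + q3 (enorm x) * (i == j)%:R.

Lemma der_Ur i x : r < enorm x -> is_derive x (basis3 i) Ur (dU i x).
Proof.
move=> rx; have x0 := enorm_neq0 rx; have xp := lt_trans r0 rx.
apply: (near_eq_is_derive (f := fun y => ur (enorm y))).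
  by near=> y; rewrite Ur_out// ltW//; near: y; exact: near_ext.
apply: (is_derive_eq (der_radial (basis3 i) x0 (der_ur xp))).
by rewrite /dU dot_basis /q3; field.
Unshelve. all: by end_near. Qed.

Lemma der_dU j i x : r < enorm x -> is_derive x (basis3 j) (dU i) (ddU j i x).
Proof.
move=> rx; have x0 := enorm_neq0 rx; have xp := lt_trans r0 rx.
apply: (is_derive_eq (derM (der_radial (basis3 j) x0 (der_q3 xp)) (der_coord i x (basis3 j)))).
by rewrite /ddU dot_basis xcoord_basis; ring.
Qed.

Lemma pder1_Ur i x : r < enorm x -> pder [:: i] Ur x = dU i x.
Proof. by move=> rx; rewrite /= ; exact: (@derive_val _ _ _ _ _ _ _ (der_Ur i rx)). Qed.

Lemma near_pder1_Ur i x : r < enorm x -> \forall y \near x, dU i y = pder [:: i] Ur y.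
Proof. by move=> rx; near=> y; rewrite pder1_Ur//; near: y; exact: near_ext.
Unshelve. all: by end_near. Qed.

Lemma der_pder1_Ur j i x : r < enorm x ->
  is_derive x (basis3 j) (pder [:: i] Ur) (ddU j i x).
Proof.
move=> rx; apply: (near_eq_is_derive (near_pder1_Ur i rx)); exact: der_dU.
Qed.

Lemma pder2_Ur j i x : r < enorm x -> pder [:: j; i] Ur x = ddU j i x.
Proof. by move=> rx; exact: (@derive_val _ _ _ _ _ _ _ (der_pder1_Ur j i rx)). Qed.

Lemma cvg_radial (h : R -> R) (dh : R) x : is_derive (enorm x) 1 h dh ->
  h (enorm y) @[y --> x] --> h (enorm x).
Proof.
move=> hh; apply: (continuous_comp (f := @enorm R)); first exact: continuous_enorm.
exact: derivable_continuous1 hh.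
Qed.

Lemma continuous_dU i x : r < enorm x -> {for x, continuous (dU i)}.
Proof.
move=> rx; have xp := lt_trans r0 rx; apply: cvgM; last exact: continuous_coord.
exact: cvg_radial (der_q3 xp).
Qed.

Lemma continuous_ddU j i x : r < enorm x -> {for x, continuous (ddU j i)}.
Proof.
move=> rx; have xp := lt_trans r0 rx; have x0 := enorm_neq0 rx.
have sn4 : (enorm x) ^+ 4 != 0 by rewrite expf_neq0.
apply: cvgD; apply: cvgM; [|exact: continuous_coord| |exact: cvg_cst]; last first.
  exact: cvg_radial (der_q3 xp).
apply: cvgM; last exact: continuous_coord.
apply: cvgM; last first.
  exact: (cvg_radial (derV (f := fun y : R => y) x0 (is_derive_id (enorm x) 1))).
exact: (cvg_radial (derD (derM (derZ c (der_expg (enorm x)))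
   (derV (f := fun y : R => y) x0 (is_derive_id (enorm x) 1)))
  (derN (derM (derZ 3 (der_qr xp))
   (derV (f := fun y : R => y ^+ 4) sn4 (derX 4 (is_derive_id (enorm x) 1))))))).
Qed.

Lemma C2_Ur : C2_on [set x | r < enorm x] Ur.
Proof.
move=> x /= rx; split.
  move=> [|i [|//]] j _ /=.
    by have [] := der_Ur j rx.
  by have [] := der_pder1_Ur j i rx.
move=> [|i [|j [|//]]] _.
- exact: continuous_Ur.
- have E := near_pder1_Ur i rx.
  rewrite /prop_for /continuous_at pder1_Ur//.
  move=> A HA; have /(_ A HA) H : {for x, continuous (dU i)} by exact: continuous_dU.
  by apply: filterS2 E H => y Ey Hy; change (A (pder [:: i] Ur y)); rewrite -Ey.
- have E : \forall y \near x, ddU i j y = pder [:: i; j] Ur y.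
    by near=> y; rewrite pder2_Ur//; near: y; exact: near_ext.
  rewrite /prop_for /continuous_at pder2_Ur//.
  move=> A HA; have /(_ A HA) H : {for x, continuous (ddU i j)} by exact: continuous_ddU.
  by apply: filterS2 E H => y Ey Hy; change (A (pder [:: i; j] Ur y)); rewrite -Ey.
Unshelve. all: by end_near. Qed.

Lemma laplacian_Ur x : r < enorm x -> laplacian Ur x = c * expg (enorm x).
Proof.
move=> rx; have x0 := enorm_neq0 rx.
rewrite /laplacian (eq_bigr (fun i => dq3 (enorm x) / enorm x * xcoord i x ^+ 2 + q3 (enorm x))); last first.
  by move=> i _; rewrite pder2_Ur// /ddU eqxx mulr1 expr2 mulrA.
rewrite (sum_coord (fun t => dq3 (enorm x) / enorm x * t ^+ 2 + q3 (enorm x))).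
transitivity (dq3 (enorm x) / enorm x * dot x x + 3 * q3 (enorm x)).
  by rewrite /dot; ring.
by rewrite -enorm2 /dq3 /q3; field.
Qed.

Lemma ur_le s : 0 <= c -> r <= s -> `|ur s| <= c * Num.sqrt (pi / 2) / s.
Proof.
move=> c0 rs; have s0 : 0 < s by exact: lt_le_trans rs.
rewrite /ur normrM (ger0_norm (_ : 0 <= s^-1)) ?invr_ge0 ?(ltW s0)//.
rewrite ler_pM2r ?invr_gt0// normrM normrN (ger0_norm c0) ler_wpM2l//.
have := G_ge0 (ltW s0); have := G_le (ltW s0); have := G_ge0 (ltW r0); have := G_le (ltW r0).
by rewrite ler_norml => *; apply/andP; split; lra.
Qed.

End radial_solution.

Lemma exterior_solution_Ur (R : realType) (m r : R) : 0 < m -> 0 < r ->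
  exterior_solution (omega m) r (Ur (cm m) r).
Proof.
move=> m0 r0.
have c0 : 0 < cm m by rewrite divr_gt0// powR_gt0// mulr_gt0// pi_gt0.
split.
- exact: continuous_Ur.
- exact: C2_Ur.
- by move=> x rx; rewrite laplacian_Ur.
- by move=> x xr; rewrite Ur_in// ltW.
- move=> e e0; exists (Num.max r (cm m * Num.sqrt (pi / 2) / e)) => x.
  rewrite gt_max => /andP[rx]; rewrite ltr_pdivrMr// => Mx.
  have xp := lt_trans r0 rx.
  rewrite Ur_out ?(ltW rx)// (le_lt_trans (ur_le r0 (ltW c0) (ltW rx)))//.
  by rewrite ltr_pdivrMr// (mulrC e).
Qed.

(** * Compactness and a second-derivative test *)

Section compactness.
Variable R : realType.

Lemma compact_eball (M : R) : compact [set x : R3 R | enorm x <= M].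
Proof.
have cI : compact (`[(- M), M]%classic : set R) by exact: segment_compact.
apply: (subclosed_compact _ (compact_setX (compact_setX cI cI) cI)).
  rewrite (_ : [set x | _] = @enorm R @^-1` `]-oo, M]%classic); last first.
    by apply/seteqP; split => x /=; rewrite in_itv.
  move/continuous_closedP : (@continuous_enorm R); apply; exact: interval_closed.
move=> x /= xM; have [h1 h2 h3] := normr_le_enorm x.
by split; [split|]; rewrite /= in_itv/= -ler_norml (le_trans _ xM).
Qed.

End compactness.

Section second_derivative_test.
Variable R : realType.

(** At a local maximum [h1 0 = 0], so [l > 0] makes [h1] positive just to the right of [0], and the
    mean value theorem produces a larger value of [h]. *)
Lemma not_local_max (h h1 : R -> R) (l : R) :
  (\forall t \near (0 : R), is_derive t (1 : R) h (h1 t)) -> is_derive (0 : R) 1 h1 l -> 0 < l ->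
  (\forall t \near (0 : R), h t <= h 0) -> False.
Proof.
move=> dh dh1 l0 hmax.
have [d /= d0 Hd] : \forall t \near (0 : R), is_derive t (1 : R) h (h1 t) /\ h t <= h 0.
  by near=> t; split; near: t.
have bd (t : R) : `|t| < d -> is_derive t (1 : R) h (h1 t) /\ h t <= h 0.
  by move=> td; apply: Hd; rewrite /ball_ /= sub0r normrN.
have h10 : h1 0 = 0.
  have d2 : - (d / 2) < d / 2 by rewrite gtrN// divr_gt0.
  have [_ <-] : is_derive (0 : R) (1 : R) h (h1 0) by have [] := bd 0; rewrite ?normr0.
  suff [_ ->] : is_derive (0 : R) (1 : R) h 0 by [].
  apply: (@derive1_at_max _ h (- (d / 2)) (d / 2) 0 (ltW d2)).
  - move=> t; rewrite in_itv/= => /andP[t1 t2]; have [] := bd t.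
      by rewrite ltr_norml; apply/andP; split; lra.
    by case.
  - by rewrite in_itv/= oppr_lt0 divr_gt0.
  - move=> t; rewrite in_itv/= => /andP[t1 t2]; have [] := bd t => //.
    by rewrite ltr_norml; apply/andP; split; lra.
have [e /= e0 He] : \forall t \near (0 : R)^', 0 < t^-1 * h1 t.
  have [ex dv] := dh1.
  have : (fun t => t^-1 *: ((h1 \o shift 0) (t *: 1) - h1 0)) @ (0 : R)^' --> l by rewrite -dv; exact: ex.
  move/cvgr_gt => /(_ _ l0); apply: filter_app; near=> t => /=.
  by rewrite !scaleRE mulr1 addr0 h10 subr0.
pose b := Num.min d e / 2.
have m0 : 0 < Num.min d e by rewrite lt_min d0 e0.
have b0 : 0 < b by rewrite divr_gt0.
have bm : b < Num.min d e by rewrite /b ltr_pdivrMr// mulr_natr mulr2n ltrDl.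
move: (bm); rewrite lt_min => /andP[bd' be].
have cI : {within `[0, b], continuous h}.
  apply: continuous_in_subspaceT => t /set_mem /=; rewrite in_itv/= => /andP[t0 tb].
  have td : `|t| < d by rewrite ger0_norm// (le_lt_trans tb).
  have [D _] := bd t td.
  by apply: (@derivable_continuous1 _ h t (h1 t)).
have [|c /[!in_itv]/= /andP[c0 cb] E] := MVT b0 _ cI (df := h1).
  move=> t /[!in_itv]/= /andP[t0 tb]; have [] := bd t => //.
  by rewrite gtr0_norm// (lt_trans tb).
have hb : h b <= h 0 by have [] := bd b; rewrite ?gtr0_norm.
have := He c; rewrite /ball_ /= sub0r normrN gtr0_norm// (lt_trans cb be) => /(_ erefl).
rewrite gt_eqF// => /(_ erefl); rewrite pmulr_rgt0 ?invr_gt0// => hc.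
have : 0 < h b - h 0 by rewrite E subr0 mulr_gt0.
by rewrite subr_gt0 ltNge hb.
Unshelve. all: by end_near. Qed.

End second_derivative_test.

(** * Uniqueness for the exterior problem *)

Section uniqueness.
Variable R : realType.
Implicit Types (U V : R3 R -> R) (x : R3 R).

Lemma is_derive_line (f : R3 R -> R) x v (t d : R) :
  is_derive (t *: v + x) v f d -> is_derive t 1 (fun s : R => f (s *: v + x)) d.
Proof.
move=> /is_derive_lineP H; apply/is_derive_lineP.
rewrite (_ : (fun h : R => _) = (fun h : R => f (h *: v + (t *: v + x))))//.
by apply/funext => h; rewrite scaleRE mulr1 scalerDl addrA.
Qed.

Lemma near_line (A : set (R3 R)) x v : open A -> A x ->
  \forall t \near (0 : R), A (t *: v + x).
Proof.
move=> oA Ax.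
have : (fun t : R => t *: v + x) t @[t --> (0 : R)] --> x.
  rewrite -[X in _ --> X]add0r -(scale0r v); apply: cvgD; last exact: cvg_cst.
  by apply: cvgZr_tmp; exact: cvg_id.
by apply; exact: open_nbhs_nbhs.
Qed.

Lemma exterior_solution_le (w : R3 R -> R) (r : R) U V : 0 < r ->
  exterior_solution w r U -> exterior_solution w r V -> forall x, U x <= V x.
Proof.
move=> r0 [cU C2U lU U0 dU] [cV C2V lV V0 dV] x0; rewrite leNgt; apply/negP => UV.
pose D x := U x - V x; pose d := D x0.
have d0 : 0 < d by rewrite subr_gt0.
have cD : continuous D by move=> x; apply: cvgB; [exact: cU|exact: cV].
(* The solutions are prescribed on the open ball only; boundary points are reached along
   [(1 - 1 / (n + 1)) x] by continuity. *)
have D0 x : enorm x <= r -> D x = 0.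
  rewrite le_eqVlt => /predU1P[xr|xr]; last by rewrite /D U0// V0// subrr.
  have x_ne0 : enorm x != 0 by rewrite xr gt_eqF.
  have cl : D ((1 - n.+1%:R^-1) *: x) @[n --> \oo] --> D x.
    apply: (cvg_comp (fun n : nat => (1 - n.+1%:R^-1) *: x) D (G := nbhs x)); last exact: cD.
    have : (1 - n.+1%:R^-1) *: x @[n --> \oo] --> (1 - 0) *: x.
      apply: cvgZr_tmp.
      by apply: cvgB; [exact: cvg_cst|exact: cvg_harmonic].
    by rewrite subr0 scale1r.
  have : D ((1 - n.+1%:R^-1) *: x) @[n --> \oo] --> (0 : R).
    rewrite (_ : (fun n => _) = (fun n : nat => 0 : R)); first exact: cvg_cst.
    apply/funext => n; have n1 : n.+1%:R^-1 <= 1 :> R by rewrite invf_le1// ler1n.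
    have n0 : 0 < n.+1%:R^-1 :> R by rewrite invr_gt0.
    have : eball r ((1 - n.+1%:R^-1) *: x).
      rewrite /eball /= enormZ ger0_norm ?subr_ge0// xr mulrBl mul1r ltrBlDr ltrDl.
      by rewrite mulr_gt0.
    by move=> h; rewrite /D U0// V0// subrr.
  by move/cvg_unique: cl => h /h ->.
have d4 : 0 < d / 4 by rewrite divr_gt0.
have [M1 HM1] := dU _ d4; have [M2 HM2] := dV _ d4.
(* [M] lies strictly beyond both decay radii, so [U] and [V] are below [d / 4] in modulus on the
   sphere of radius [M]. With [e * M ^+ 2 = d / 4], [v] is below [3 d / 4] there and at most [d / 4]
   in the ball of radius [r], while [v x0 >= d]: the maximum is attained strictly in between. *)
pose M := Num.max (Num.max M1 M2) (Num.max r (enorm x0)) + 1.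
have [Mm1 Mm2 Mmr Mmx] : [/\ M1 < M, M2 < M, r < M & enorm x0 < M].
  have H a : a <= Num.max (Num.max M1 M2) (Num.max r (enorm x0)) -> a < M.
    by move=> h; rewrite /M (le_lt_trans h)// ltrDl.
  by split; apply: H; rewrite !le_max lexx ?orbT.
have M0 : 0 < M by exact: lt_trans Mmr.
pose e := d / (4 * M ^+ 2).
have e0 : 0 < e by rewrite divr_gt0// mulr_gt0// exprn_gt0.
pose v x := D x + e * enorm x ^+ 2.
have cv : continuous v.
  move=> x; apply: cvgD; first exact: cD.
  apply: cvgM; first exact: cvg_cst.
  exact: (continuous_comp (@continuous_enorm R x) (@exprn_continuous _ 2 _)).
have [xs [xsM xsmax]] : exists xs : R3 R, enorm xs <= M /\ forall t : R3 R, enorm t <= M -> v t <= v xs.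
  have [||xs xsK xsmax] := @compact_EVT_max _ _ v _ _ (@compact_eball R M).
  - by exists x0; rewrite /= ltW.
  - by apply: continuous_subspaceT.
  exists xs; split; first by move: xsK; rewrite inE.
  by move=> t tM; apply: xsmax; rewrite inE.
have vd : d <= v xs.
  apply: le_trans (xsmax x0 _); last by rewrite ltW.
  by rewrite /v lerDl mulr_ge0 ?(ltW e0) ?sqr_ge0.
have eM : e * enorm xs ^+ 2 <= d / 4.
  have -> : d / 4 = e * M ^+ 2 by rewrite /e; field; rewrite gt_eqF.
  by rewrite ler_pM2l// ler_sqr// nnegrE ?enorm_ge0// ltW.
have rxs : r < enorm xs.
  by rewrite ltNge; apply/negP => h; move: vd; rewrite /v D0// add0r => ?; lra.
have xsM' : enorm xs < M.
  rewrite lt_neqAle xsM andbT; apply/eqP => E.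
  have h1 := HM1 xs; have h2 := HM2 xs; move: h1 h2; rewrite E => /(_ Mm1) h1 /(_ Mm2) h2.
  move: h1 h2 vd; rewrite !ltr_norml /v /D => /andP[? ?] /andP[? ?] ?; lra.
(* The pure second derivatives of [v] at its maximum. The Laplacians of [U] and [V] cancel, so they
   add up to [6 * e], and one of them is positive. *)
pose l i := pder [:: i; i] U xs - pder [:: i; i] V xs + 2 * e.
have suml : \sum_(i < 3) l i = 6 * e.
  rewrite !big_split/= sumrN.
  have lUx := lU _ rxs; have lVx := lV _ rxs.
  rewrite /laplacian in lUx lVx; rewrite lUx lVx.
  by rewrite subrr add0r sumr_const card_ord -mulr_natl; ring.
have [i li] : exists i, 0 < l i.
  apply: contrapT => h; have : \sum_(i < 3) l i <= 0.
    by apply: sumr_le0 => i _; rewrite leNgt; apply/negP => li; apply: h; exists i.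
  by rewrite suml leNgt mulr_gt0.
pose h (t : R) := v (t *: basis3 i + xs).
pose h1 (t : R) := pder [:: i] U (t *: basis3 i + xs) - pder [:: i] V (t *: basis3 i + xs)
   + 2 * e * xcoord i (t *: basis3 i + xs).
have sq y : is_derive y (basis3 i) (fun y => e * enorm y ^+ 2) (2 * e * xcoord i y).
  rewrite (_ : (fun y => _) = (fun y => e * (xcoord ord0 y ^+ 2 +
    (xcoord (lift ord0 ord0) y ^+ 2 + xcoord (lift ord0 (lift ord0 ord0)) y ^+ 2)))); last first.
    by apply/funext => z; rewrite enorm2 dotE !big_ord_recl big_ord0 addr0.
  have dc j := derX 2 (der_coord j y (basis3 i)).
  apply: (is_derive_eq (derZ e (derD (dc _) (derD (dc _) (dc _))))).
  transitivity (2 * e * dot y (basis3 i)); last by rewrite dot_basis.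
  by rewrite dotE !big_ord_recl big_ord0 addr0 /=; ring.
have dfst (W : R3 R -> R) y : C2_on [set x | r < enorm x] W -> r < enorm y ->
    is_derive y (basis3 i) W (pder [:: i] W y).
  by move=> C2 ry; have [ex _] := C2 y ry; split; [exact: (ex [::] i)|].
have dsnd (W : R3 R -> R) y : C2_on [set x | r < enorm x] W -> r < enorm y ->
    is_derive y (basis3 i) (pder [:: i] W) (pder [:: i; i] W y).
  by move=> C2 ry; have [ex _] := C2 y ry; split; [exact: (ex [:: i] i)|].
apply: (@not_local_max _ h h1 (l i)) => //.
- near=> t; apply: is_derive_line.
  have rt : r < enorm (t *: basis3 i + xs).
    by near: t; apply: (@near_line [set x | r < enorm x] _ _ _ rxs); exact: open_ext.
  exact: (derD (derD (dfst U _ C2U rt) (derN (dfst V _ C2V rt))) (sq _)).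
- apply: (@is_derive_line (fun y => pder [:: i] U y - pder [:: i] V y + 2 * e * xcoord i y)).
  rewrite scale0r add0r.
  apply: (is_derive_eq (derD (derD (dsnd U _ C2U rxs) (derN (dsnd V _ C2V rxs)))
    (derZ (2 * e) (der_coord i xs (basis3 i))))).
  by rewrite xcoord_basis eqxx mulr1.
- near=> t; rewrite /h scale0r add0r; apply: xsmax.
  apply: ltW; near: t.
  apply: (@near_line [set x | enorm x < M]) => //.
  rewrite (_ : [set x | _] = @enorm R @^-1` `]-oo, M[%classic); last first.
    by apply/seteqP; split => x /=; rewrite in_itv.
  by move/continuousP : (@continuous_enorm R); apply; exact: interval_open.
Unshelve. all: by end_near. Qed.

Lemma exterior_solution_eq (w : R3 R -> R) (r : R) U V : 0 < r ->
  exterior_solution w r U -> exterior_solution w r V -> U = V.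
Proof.
move=> r0 sU sV; apply/funext => x; apply/eqP; rewrite eq_le.
by rewrite (exterior_solution_le r0 sU sV) (exterior_solution_le r0 sV sU).
Qed.

End uniqueness.

(** * Integration by parts *)

Section euclidean_norm.
Variable R : realType.
Local Notation T := (measurableTypeR R).
Implicit Types (x y v : R3 R) (i : 'I_3).

Lemma enorm_basis i : enorm (basis3 i : R3 R) = 1.
Proof.
rewrite /enorm (_ : dot _ _ = xcoord i (basis3 i))//.
by rewrite xcoord_basis eqxx sqrtr1.
Qed.

(** Cauchy-Schwarz, read off from Lagrange's identity. *)
Lemma dot_le_enorm x y : dot x y <= enorm x * enorm y.
Proof.
have xy0 : 0 <= enorm x * enorm y by rewrite mulr_ge0 ?enorm_ge0.
rewrite (le_trans (ler_norm _))// -ler_sqr ?nnegrE// real_normK ?num_real//.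
rewrite exprMn !enorm2 -subr_ge0 /dot.
rewrite [X in 0 <= X](_ : _ = (x.1.1 * y.1.2 - x.1.2 * y.1.1) ^+ 2 +
  (x.1.1 * y.2 - x.2 * y.1.1) ^+ 2 + (x.1.2 * y.2 - x.2 * y.1.2) ^+ 2); last by ring.
by rewrite !addr_ge0 ?sqr_ge0.
Qed.

Lemma enormD x y : enorm (x + y) <= enorm x + enorm y.
Proof.
rewrite -ler_sqr ?nnegrE ?addr_ge0 ?enorm_ge0// sqrrD !enorm2.
have -> : dot (x + y) (x + y) = dot x x + dot x y *+ 2 + dot y y.
  by rewrite /dot /=; ring.
by rewrite lerD2r lerD2l lerMn2r dot_le_enorm orbT.
Qed.

Lemma enorm_dist x y : `|enorm (x + y) - enorm y| <= enorm x.
Proof.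
rewrite ler_norml; apply/andP; split; last by rewrite lerBlDr enormD.
rewrite lerBrDr -lerBrDl opprK addrC.
have := enormD (- x) (x + y); rewrite enormN addrA addNr add0r => h.
by rewrite (le_trans h).
Qed.

Lemma enorm_dist_basis i (h : R) x : `|enorm (h *: basis3 i + x) - enorm x| <= `|h|.
Proof. by rewrite (le_trans (enorm_dist _ _))// enormZ enorm_basis mulr1. Qed.

Lemma measurable_closed_ball (L : R) : measurable ([set x | enorm x <= L] : set (mR3 R)).
Proof.
rewrite (_ : [set x | _] = (@enorm R : mR3 R -> R) @^-1` `]-oo, L]%classic); last first.
  by apply/seteqP; split => x /=; rewrite in_itv.
rewrite -[X in measurable X]setTI; apply: (measurable_enorm (@measurable_id _ _ setT)) => //.
Qed.

Lemma leb3_closed_ball_fin (L : R) : (@leb3 R [set x : mR3 R | (enorm x <= L)%R] < +oo)%E.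
Proof.
pose I : set T := `[- L, L]%classic.
have mI : measurable I by exact: measurable_itv.
have fI : (@lebesgue_measure R I < +oo)%E.
  by rewrite /I lebesgue_measure_itv/=; case: ifP => _; rewrite ?ltry// -EFinD ltry.
apply: (@le_lt_trans _ _ (@leb3 R ((I `*` I) `*` I))).
  apply: le_measure; rewrite ?inE; [exact: measurable_closed_ball| |].
    by do 2 apply: measurableX => //.
  move=> x /= xM; have [h1 h2 h3] := normr_le_enorm x.
  by split; [split|]; rewrite /I /= in_itv/= -ler_norml (le_trans _ xM).
rewrite /leb3 product_measure1E//=; last exact: measurableX.
rewrite /leb2 product_measure1E//=.
have fn : (@lebesgue_measure R I) \is a fin_num by rewrite ge0_fin_numE.
by rewrite -(fineK fn) -!EFinM ltry.
Qed.

Lemma integrable_closed_ball (L M : R) : (@leb3 R).-integrable setT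
  (fun x => (M * \1_([set x : mR3 R | enorm x <= L]) x)%:E).
Proof.
pose B : set (mR3 R) := [set x : mR3 R | enorm x <= L].
have mB : measurable B := measurable_closed_ball L.
have iB : (@leb3 R).-integrable setT (EFin \o (\1_B : mR3 R -> R)).
  apply/integrableP; split; first by apply/measurable_EFinP; exact: measurable_indic.
  suff -> : (\int[leb3]_x `|(EFin \o (\1_B : mR3 R -> R)) x| = @leb3 R B)%E.
    exact: leb3_closed_ball_fin.
  transitivity (\int[leb3]_x (\1_B x)%:E)%E.
    by apply: eq_integral => x _ /=; rewrite ger0_norm.
  by rewrite integral_indic// setIT.
exact: (integrableZl measurableT M iB).
Qed.

Lemma integrable_bounded_support (f : mR3 R -> R) (M L : R) :
  measurable_fun setT f -> (forall x, `|f x| <= M) ->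
  (forall x, L < enorm x -> f x = 0) -> (@leb3 R).-integrable setT (EFin \o f).
Proof.
move=> mf fM fL; have M0 : 0 <= M by exact: le_trans (fM 0).
apply: (le_integrable measurableT _ _ (integrable_closed_ball L M)).
  exact/measurable_EFinP.
move=> x _; rewrite lee_fin /= normrM (ger0_norm M0) indicE.
have [xL|xL] := leP (enorm x) L; first by rewrite mem_set//= normr1 mulr1.
by rewrite fL// normr0 mulr_ge0.
Qed.

(** In polar coordinates every ray meets the sphere in finitely many parameters, so each inner
    integral is zero. *)
Lemma leb3_sphere0 (r : R) : @leb3 R [set x : mR3 R | enorm x = r] = 0%E.
Proof.
pose S := [set x : mR3 R | enorm x = r].
have mS : measurable S.
  rewrite (_ : S = (@enorm R : mR3 R -> R) @^-1` [set r])//.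
  by rewrite -[X in measurable X]setTI; apply: (measurable_enorm (@measurable_id _ _ setT)).
rewrite -/S -[S]setIT -integral_indic//.
have m1 : measurable_fun setT (fun x : mR3 R => (\1_S x : R)%:E).
  by apply/measurable_EFinP; exact: measurable_indic.
rewrite (polar3 m1); last by move=> x; rewrite lee_fin indicE.
rewrite tonelli12; last 2 first.
- apply: emeasurable_funM; first exact: (measurableT_comp m1 (@measurable_sph R)).
  by rewrite /ws /ipos /wsph; meas.
- by move=> z; rewrite mule_ge0// lee_fin ?indicE// mulr_ge0 ?ws_ge0 ?wsph_ge0.
apply: integral0_eq => p _.
transitivity (\int[@lebesgue_measure R]_x (cst 0%E x : \bar R))%E; last exact: integral0.
apply: (@eq_integral_off_finite _ [set r; - r]).
- by [].
- apply: emeasurable_funM.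
    by apply: (measurableT_comp m1); rewrite /sph /=; meas.
  by rewrite /ws /ipos /wsph /=; meas.
- exact: measurable_cst.
move=> s /= sr; rewrite indicE memNset ?mul0e// /S /= enorm_sph => sE; apply: sr.
by rewrite -sE; case: (ger0P s) => _; [left|right; rewrite opprK].
Qed.

End euclidean_norm.

Section translation.
Variable R : realType.
Local Notation T := (measurableTypeR R).

Lemma leb3_translation (i : 'I_3) (a : R) : transfer (@leb3 R) (@leb3 R)
  (fun x => a *: basis3 i + (x : R3 R) : mR3 R) (fun=> 1).
Proof.
(* A translation along a coordinate axis is a shear with constant [h]. *)
have mc b : measurable_fun setT (fun _ : T * T => b : T) by exact: measurable_cst.
case: i => -[|[|[|//]]] Hi.
- rewrite (_ : (fun x => _) = (fun x : mR3 R => (x.1.1 + a, x.1.2, x.2))); first exact: (shear1 (mc a)).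
  by apply/funext => -[[x y] z]; congr (_, _, _) => /=; rewrite scaleRE ?mulr1 ?mulr0 ?add0r// addrC.
- rewrite (_ : (fun x => _) = (fun x : mR3 R => (x.1.1, x.1.2 + a, x.2))); first exact: (shear2 (mc a)).
  by apply/funext => -[[x y] z]; congr (_, _, _) => /=; rewrite scaleRE ?mulr1 ?mulr0 ?add0r// addrC.
- rewrite (_ : (fun x => _) = (fun x : mR3 R => (x.1.1, x.1.2, x.2 + a))); first exact: (shear3 (mc a)).
  by apply/funext => -[[x y] z]; congr (_, _, _) => /=; rewrite scaleRE ?mulr1 ?mulr0 ?add0r// addrC.
Qed.

Lemma measurable_translation (v : R3 R) :
  measurable_fun setT (fun x : mR3 R => v + (x : R3 R) : mR3 R).
Proof.
rewrite (_ : (fun x => _) = (fun x : mR3 R => (v.1.1 + x.1.1, v.1.2 + x.1.2, v.2 + x.2)))//.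
by meas.
Qed.

(* The integral of the difference quotients vanishes by translation invariance. *)
Lemma Rintegral_partial_eq0 (F dF : mR3 R -> R) (i : 'I_3) (C L : R) :
  measurable_fun setT F -> measurable_fun setT dF ->
  (forall (h : R) x, `|F (h *: basis3 i + (x : R3 R)) - F x| <= C * `|h|) ->
  (forall x, L < enorm x -> F x = 0) ->
  {ae @leb3 R, forall x, is_derive (x : R3 R) (basis3 i) (F : R3 R -> R) (dF x)} ->
  \int[@leb3 R]_x dF x = 0.
Proof.
move=> mF mdF FC FL dFE; have C0 : 0 <= C.
  by have := le_trans (normr_ge0 _) (FC 1 0); rewrite normr1 mulr1.
(* A bound for [F]: a shift by [2 * L + 1] takes every point of the ball of radius [L] out of it,
   where [F] vanishes, at the Lipschitz cost [C * (2 * L + 1)]. *)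
pose M := C * (2 * `|L| + 3).
have FM x : `|F x| <= M.
  have [xL|/FL ->] := leP (enorm x) L; last by rewrite normr0 mulr_ge0// addr_ge0// mulr_ge0.
  have Lp : 0 <= L := le_trans (enorm_ge0 x) xL.
  have := FC (2 * L + 1) x; rewrite FL.
    rewrite sub0r normrN => h; apply: (le_trans h); rewrite ler_wpM2l//.
    rewrite (ger0_norm Lp) ger0_norm; first by lra.
    by rewrite addr_ge0// mulr_ge0.
  have := enorm_dist x ((2 * L + 1) *: basis3 i); rewrite enormZ enorm_basis mulr1.
  rewrite (ger0_norm (_ : 0 <= 2 * L + 1)) ?addr_ge0 ?mulr_ge0// (addrC x) ler_norml.
  by move=> /andP[h _]; lra.
have iF := integrable_bounded_support mF FM FL.
pose h n : R := n.+1%:R^-1.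
have h0 n : 0 < h n by rewrite invr_gt0.
have h1 n : h n <= 1 by rewrite invf_le1// ler1n.
pose Fn n x := n.+1%:R * (F (h n *: basis3 i + (x : R3 R)) - F x).
have mFt n : measurable_fun setT (fun x : mR3 R => F (h n *: basis3 i + (x : R3 R))).
  exact: (measurableT_comp mF (measurable_translation _)).
have mFn n : measurable_fun setT (Fn n).
  rewrite /Fn; apply: measurable_funM; first exact: measurable_cst.
  exact: (measurable_funB (mFt n) mF).
have FnC n x : `|Fn n x| <= C.
  rewrite /Fn normrM ger0_norm// -ler_pdivlMl// (le_trans (FC _ _))//.
  by rewrite ger0_norm ?(ltW (h0 n))// mulrC.
have iFn n : (@leb3 R).-integrable setT (EFin \o (fun x => F (h n *: basis3 i + (x : R3 R)))).
  apply: (@integrable_bounded_support _ _ M (L + 1)) => // x Lx; apply: FL.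
  have := enorm_dist_basis i (h n) x; rewrite ler_norml gtr0_norm// => /andP[+ _].
  by have := h1 n; lra.
have IFn n : \int[@leb3 R]_x Fn n x = 0.
  rewrite /Fn.
  have iD : (@leb3 R).-integrable setT
      (EFin \o (fun x => F (h n *: basis3 i + (x : R3 R)) - F x)).
    exact: (integrableB measurableT (iFn n) iF).
  rewrite (RintegralZl _ measurableT iD) (RintegralB measurableT (iFn n) iF).
  rewrite [X in _ * (_ - X)](transfer_Rintegral (fun=> ler01) (leb3_translation i (h n)) mF).
  rewrite [X in _ * (X - _)](_ : _ = \int[leb3]_t (F (h n *: basis3 i + (t : R3 R)) * 1)).
    by rewrite subrr mulr0.
  by apply: eq_Rintegral => x _; rewrite mulr1.
have cFn : \forall x \ae @leb3 R, setT x -> (Fn n x)%:E @[n --> \oo] --> (dF x)%:E.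
  have [N [mN N0 NF]] := dFE; exists N; split => // x /= nx; apply: NF => -[ex dv].
  apply: nx => _; apply: cvg_EFin; first exact: nearW.
  have cx : (fun h : R => h^-1 *: (((F : R3 R -> R) \o shift (x : R3 R)) (h *: basis3 i) - F x)) @ 0^' --> dF x.
    by rewrite -dv; exact: ex.
  have ch : h n @[n --> \oo] --> (0 : R)^'.
    move=> A [d /= d0 dA].
    have /cvgrPdist_lt/(_ _ d0)[k _ Hk] := @cvg_harmonic R.
    exists k => // n /= Nn; apply: dA => //=; first exact: Hk.
    by rewrite gt_eqF.
  have -> : fine \o (fun n => (Fn n x)%:E) =
      (fun h : R => h^-1 *: (((F : R3 R -> R) \o shift (x : R3 R)) (h *: basis3 i) - F x)) \o h.
    by apply/funext => n; rewrite /Fn /h /= invrK.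
  exact: cvg_comp ch cx.
(* The steps satisfy [h n <= 1], so all difference quotients live in the ball of radius [L + 1] and
   are bounded there by [C]. *)
have dom : \forall x \ae @leb3 R, forall n, setT x ->
    (`|(Fn n x)%:E| <= (C * \1_([set x : mR3 R | enorm x <= L + 1]) x)%:E)%E.
  exists set0; split; [exact: measurable0|exact: measure0|] => x /= nx; apply: nx => n _.
  rewrite lee_fin indicE.
  have [xL|xL] := leP (enorm x) (L + 1); first by rewrite mem_set// mulr1.
  rewrite memNset /=; last by rewrite leNgt xL.
  rewrite mulr0 /Fn !FL ?subrr ?mulr0 ?normr0//; first by lra.
  have := enorm_dist_basis i (h n) x; rewrite ler_norml gtr0_norm// => /andP[+ _].
  by have := h1 n; lra.
have [_ _] := @dominated_convergence _ _ _ (@leb3 R) setT measurableT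
  (fun n x => (Fn n x)%:E) (fun x => (dF x)%:E)
  (fun x => (C * \1_([set x : mR3 R | enorm x <= L + 1]) x)%:E) (fun n => (measurable_EFinP _ _).2 (mFn n)) ((measurable_EFinP _ _).2 mdF) cFn
  (integrable_closed_ball (L + 1) C) dom.
have iFnn n : (@leb3 R).-integrable setT (EFin \o Fn n).
  apply: (integrable_bounded_support (M := C) (L := L + 1) (mFn n) (FnC n)) => x xL.
  rewrite /Fn !FL ?subrr ?mulr0//; first by lra.
  have := enorm_dist_basis i (h n) x; rewrite ler_norml gtr0_norm// => /andP[+ _].
  by have := h1 n; lra.
rewrite (_ : (fun n => _) = (fun=> 0%E)); last first.
  apply/funext => n; have := IFn n; rewrite /Rintegral => E.
  by rewrite -[LHS]fineK ?E//; exact: (integrable_fin_num measurableT (iFnn n)).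
move=> H; have E := cvg_lim (@ereal_hausdorff R) H.
rewrite /Rintegral -E (_ : lim _ = 0%E)//; exact: lim_cst.
Qed.

End translation.

Lemma sum_ord3 (V : nmodType) (F : 'I_3 -> V) :
  \sum_(i < 3) F i = F ord0 + (F (lift ord0 ord0) + F (lift ord0 (lift ord0 ord0))).
Proof. by rewrite !big_ord_recl big_ord0 addr0. Qed.

Section Rintegral_sum_ord3.
Context d (T : measurableType d) (R : realType) (mu : {measure set T -> \bar R}).
Variable f : 'I_3 -> T -> R.
Hypothesis fi : forall i, mu.-integrable setT (EFin \o f i).

Lemma integrable_sum_ord3 : mu.-integrable setT (EFin \o (fun x => \sum_(i < 3) f i x)).
Proof.
have := integrableD measurableT (fi ord0)
  (integrableD measurableT (fi (lift ord0 ord0)) (fi (lift ord0 (lift ord0 ord0)))).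
by apply: eq_integrable => // x _; rewrite /= sum_ord3.
Qed.

Lemma Rintegral_sum_ord3 : \int[mu]_x (\sum_(i < 3) f i x) = \sum_(i < 3) \int[mu]_x f i x.
Proof.
have i12 := integrableD measurableT (fi (lift ord0 ord0)) (fi (lift ord0 (lift ord0 ord0))).
rewrite sum_ord3 -(RintegralD measurableT (fi _) (fi _)).
rewrite -(RintegralD measurableT (fi ord0) i12).
by apply: eq_Rintegral => x _; rewrite sum_ord3.
Qed.

End Rintegral_sum_ord3.

Lemma normr_prod_diff (R : realDomainType) (u v a b A B C D h : R) :
  `|u| <= A -> `|a - b| <= B * h -> `|u - v| <= C * h -> `|b| <= D ->
  `|u * a - v * b| <= (A * B + C * D) * h.
Proof.
move=> uA ab uv bD; have -> : u * a - v * b = u * (a - b) + (u - v) * b by ring.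
rewrite (le_trans (ler_normD _ _))// [leRHS]mulrDl !normrM lerD//.
  by rewrite -mulrA ler_pM.
by rewrite mulrAC ler_pM.
Qed.

(** * Directional derivatives from continuous partial derivatives *)

Section chain_rule.
Variable R : realType.
Implicit Types (x v : R3 R) (i : 'I_3).

Lemma partial_MVT (f df : R3 R -> R) i (a : R) x :
  (forall y, is_derive y (basis3 i) f (df y)) ->
  exists t : R, `|t| <= `|a| /\
    f (a *: basis3 i + x) - f x = a * df (t *: basis3 i + x).
Proof.
move=> fd; pose h (t : R) := f (t *: basis3 i + x).
pose dh (t : R) := df (t *: basis3 i + x).
have hd (t : R) : is_derive t (1 : R) h (dh t) by apply: is_derive_line; exact: fd.
have hc (b c : R) : {within `[b, c], continuous h}.
  by apply: continuous_subspaceT => t; exact: (derivable_continuous1 (hd t)).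
have h0 : h 0 = f x by rewrite /h scale0r add0r.
have [a0|a0] := leP 0 a.
  have [c] := @MVT_segment R h dh 0 a a0 (fun t _ => hd t) (hc 0 a).
  rewrite in_itv/= => /andP[c0 ca] E; exists c; split; first by rewrite !ger0_norm.
  by rewrite -h0 E subr0 mulrC.
have [c] := @MVT_segment R h dh a 0 (ltW a0) (fun t _ => hd t) (hc a 0).
rewrite in_itv/= => /andP[ca c0] E; exists c; split.
  by rewrite !ler0_norm ?(ltW a0)// lerN2.
by apply: oppr_inj; rewrite opprB -h0 E sub0r mulrN mulrC.
Qed.

Lemma partial_lipschitz (f df : R3 R -> R) i (M : R) :
  (forall y, is_derive y (basis3 i) f (df y)) -> (forall y, `|df y| <= M) ->
  forall (a : R) x, `|f (a *: basis3 i + x) - f x| <= M * `|a|.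
Proof.
move=> fd dM a x; have [t [_ ->]] := partial_MVT a x fd.
by rewrite normrM mulrC ler_wpM2r.
Qed.

Let i0 : 'I_3 := ord0.
Let i1 : 'I_3 := lift ord0 ord0.
Let i2 : 'I_3 := lift ord0 (lift ord0 ord0).

Let expansion (h : R) v x : h *: v + x = (h * xcoord i2 v) *: basis3 i2 +
  ((h * xcoord i1 v) *: basis3 i1 + ((h * xcoord i0 v) *: basis3 i0 + x)).
Proof.
case: v x => -[v1 v2] v3 [[x1 x2] x3]; rewrite /xcoord /dot /=.
by congr (_, _, _); rewrite /= ?scaleRE /GRing.scale /=; ring.
Qed.

(** The displacement [h *: v] is split into three moves along the axes, and the mean value theorem
    applies to each; the intermediate points tend to [x], where the partials are continuous. This
    differentiates test functions along rays. *)
Lemma is_derive_partials (f : R3 R -> R) (df : 'I_3 -> R3 R -> R) x v :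
  (forall i y, is_derive y (basis3 i) f (df i y)) ->
  (forall i, {for x, continuous (df i)}) ->
  is_derive x v f (\sum_(i < 3) xcoord i v * df i x).
Proof.
move=> fd dc.
have id0 : (fun h : R => h) h @[h --> (0 : R)^'] --> (0 : R).
  by move=> A [e e0 eA]; exists e => // h he _; exact: eA.
pose y0 (h : R) : R3 R := x.
pose y1 (h : R) := (h * xcoord i0 v) *: basis3 i0 + x.
pose y2 (h : R) := (h * xcoord i1 v) *: basis3 i1 + y1 h.
have mvt i (y : R -> R3 R) : exists t : R -> R, forall h,
    `|t h| <= `|h * xcoord i v| /\
    f ((h * xcoord i v) *: basis3 i + y h) - f (y h) =
    h * xcoord i v * df i (t h *: basis3 i + y h).
  (* The mean value points are chosen as functions of [h], so that limits can be taken. *)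
  have /choice[t Ht] h := partial_MVT (h * xcoord i v) (y h) (fd i).
  by exists t.
have lim i (y : R -> R3 R) (t : R -> R) : (forall h, `|t h| <= `|h * xcoord i v|) ->
    y h @[h --> (0 : R)^'] --> x ->
    xcoord i v * df i (t h *: basis3 i + y h) @[h --> (0 : R)^'] --> xcoord i v * df i x.
  move=> ht hy; apply: cvgM; first exact: cvg_cst.
  apply: (cvg_comp (fun h => t h *: basis3 i + y h) (df i) (G := nbhs x)); last exact: dc.
  have : t h *: basis3 i + y h @[h --> (0 : R)^'] --> (0 : R) *: basis3 i + x.
    apply: cvgD => //; apply: cvgZr_tmp; apply: norm_cvg0.
    apply: (@squeeze_cvgr _ _ _ _ (fun=> 0) (fun h => `|h * xcoord i v|)).
    - by near=> h; rewrite normr_ge0 ht.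
    - exact: cvg_cst.
    have : `|h * xcoord i v| @[h --> (0 : R)^'] --> `|0 * xcoord i v|.
      apply: cvg_norm; apply: cvgM; last exact: cvg_cst.
      exact: id0.
    by rewrite mul0r normr0.
  by rewrite scale0r add0r.
have step i (y : R -> R3 R) : y h @[h --> (0 : R)^'] --> x ->
    (h * xcoord i v) *: basis3 i + y h @[h --> (0 : R)^'] --> x.
  move=> hy; have : (h * xcoord i v) *: basis3 i + y h @[h --> (0 : R)^'] --> (0 * xcoord i v) *: basis3 i + x.
    apply: cvgD => //; apply: cvgZr_tmp; apply: cvgM; last exact: cvg_cst.
    exact: id0.
  by rewrite mul0r scale0r add0r.
have c0 : y0 h @[h --> (0 : R)^'] --> x by exact: cvg_cst.
have c1 : y1 h @[h --> (0 : R)^'] --> x by exact: (step i0 y0 c0).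
have c2 : y2 h @[h --> (0 : R)^'] --> x by exact: (step i1 y1 c1).
have [t0 H0] := mvt i0 y0; have [t1 H1] := mvt i1 y1; have [t2 H2] := mvt i2 y2.
have C : (fun h : R => h^-1 *: ((f \o shift x) (h *: v) - f x)) @ (0 : R)^' -->
    \sum_(i < 3) xcoord i v * df i x.
  rewrite !big_ord_recl big_ord0 addr0.
  have C0 : xcoord i0 v * df i0 (t0 h *: basis3 i0 + y0 h) +
      (xcoord i1 v * df i1 (t1 h *: basis3 i1 + y1 h) +
       xcoord i2 v * df i2 (t2 h *: basis3 i2 + y2 h)) @[h --> (0 : R)^'] -->
      xcoord i0 v * df i0 x + (xcoord i1 v * df i1 x + xcoord i2 v * df i2 x).
    apply: cvgD; first exact: (lim i0 y0 t0 (fun h => (H0 h).1) c0).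
    apply: cvgD; first exact: (lim i1 y1 t1 (fun h => (H1 h).1) c1).
    exact: (lim i2 y2 t2 (fun h => (H2 h).1) c2).
  apply: cvg_trans C0; apply: near_eq_cvg; near=> h.
  have hn : h != 0 by near: h; exact: nbhs_dnbhs_neq.
  rewrite /= (expansion h v x).
  have -> : f ((h * xcoord i2 v) *: basis3 i2 + y2 h) - f x =
    (f ((h * xcoord i2 v) *: basis3 i2 + y2 h) - f (y2 h)) +
    ((f ((h * xcoord i1 v) *: basis3 i1 + y1 h) - f (y1 h)) +
     (f ((h * xcoord i0 v) *: basis3 i0 + y0 h) - f (y0 h))).
    by rewrite /y2 /y1 /y0; ring.
  rewrite (H0 h).2 (H1 h).2 (H2 h).2 scaleRE.
  by field.
split; first by apply/cvg_ex; exists (\sum_(i < 3) xcoord i v * df i x).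
exact: (cvg_lim (@Rhausdorff R) C).
Unshelve. all: by end_near. Qed.

End chain_rule.

(** * Bounds and supports of test functions *)

Section test_functions.
Variable R : realType.
Implicit Types (x v : R3 R) (i : 'I_3).

Lemma bounded_outside (f : R3 R -> R) (L : R) : continuous f ->
  (forall x, L < enorm x -> f x = 0) -> exists M : R, forall x, `|f x| <= M.
Proof.
move=> cf fL; have [K0|K0] := pselect ([set x : R3 R | enorm x <= L] !=set0).
  have cn : {within [set x : R3 R | enorm x <= L], continuous (fun x => `|f x| : R)}.
    by apply: continuous_subspaceT => x; apply: cvg_norm; exact: cf.
  have [c _ Hc] := compact_EVT_max K0 (@compact_eball R L) cn.
  exists `|f c| => x; have [xL|xL] := leP (enorm x) L; last by rewrite fL// normr0.
  by apply: Hc; rewrite inE.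
exists 0 => x; rewrite fL ?normr0// ltNge; apply/negP => xL; apply: K0.
by exists x.
Qed.

Variable eta : R3 R -> R.
Hypothesis teta : test_function eta.

Lemma test_function_outside : exists L : R, forall x, L < enorm x -> eta x = 0.
Proof.
have [_ cK] := teta; set K := closure _ in cK.
have sK x : eta x != 0 -> K x by move=> ex; exact: subset_closure.
have [K0|K0] := pselect (K !=set0); last first.
  by exists 0 => x _; apply: contrapT => /eqP/sK Kx; apply: K0; exists x.
have [|c _ Hc] := @compact_EVT_max _ _ (@enorm R) _ K0 cK.
  by apply: continuous_subspaceT; exact: continuous_enorm.
exists (enorm c) => x cx; apply: contrapT => /eqP/sK Kx.
by have := Hc x; rewrite inE leNgt cx => /(_ Kx).
Qed.

Lemma pder_outside (L : R) s : (forall x, L < enorm x -> eta x = 0) ->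
  forall x, L < enorm x -> pder s eta x = 0.
Proof.
move=> H; elim: s => [|i s IH] x xL; first exact: H.
have E : \forall y \near x, (fun=> 0 : R) y = pder s eta y.
  by near=> y; rewrite IH//; near: y; exact: near_ext.
exact: (@derive_val _ _ _ _ _ _ _ (near_eq_is_derive E (der_cst (0 : R) x (basis3 i)))).
Unshelve. all: by end_near. Qed.

Lemma is_derive_pder s i x : is_derive x (basis3 i) (pder s eta) (pder (i :: s) eta x).
Proof. by have [sm _] := teta; have [_ d] := sm s; split; [exact: d|]. Qed.

Lemma continuous_pder s : continuous (pder s eta).
Proof. by have [sm _] := teta; have [] := sm s. Qed.

Lemma bounded_pder s : exists M : R, forall x, `|pder s eta x| <= M.
Proof.
have [L HL] := test_function_outside.
have [M HM] := bounded_outside (@continuous_pder s) (pder_outside s HL); by exists M.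
Qed.

Lemma measurable_pder s : measurable_fun setT (pder s eta : mR3 R -> R).
Proof. by apply: continuous_measurable_R3; exact: continuous_pder. Qed.

End test_functions.

(** * The distributional Laplacian of the radial solution *)

Section distributional_laplacian.
Variables (R : realType) (c r : R).
Hypotheses (c0 : 0 <= c) (r0 : 0 < r).
Local Notation T := (measurableTypeR R).
Local Notation leb := (@lebesgue_measure R).
Implicit Types (x v : R3 R) (i : 'I_3).

Lemma qr_le s : r <= s -> `|qr c r s| <= c * (Num.sqrt (pi / 2) + 1).
Proof.
move=> rs; have s0 : 0 < s by exact: lt_le_trans rs.
rewrite /qr -mulrBr normrM (ger0_norm c0) ler_wpM2l// (le_trans (ler_normB _ _))//.
apply: lerD.
  have := G_ge0 (ltW s0); have := G_le (ltW s0); have := G_ge0 (ltW r0); have := G_le (ltW r0).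
  by rewrite ler_norml => *; apply/andP; split; lra.
(* [s * exp(- s^2 / 2) <= 1] follows from [s <= 1 + s^2 / 2 <= exp(s^2 / 2)]. *)
rewrite ger0_norm ?mulr_ge0 ?expR_ge0 ?(ltW s0)// /expg mulNr expRN ler_pdivrMr ?expR_gt0// mul1r.
have := expR_ge1Dx (s ^+ 2 / 2); have : 0 <= (s - 1) ^+ 2 by exact: sqr_ge0.
by rewrite sqrrB1 => ? ?; lra.
Qed.

Let Q : R := c * (Num.sqrt (pi / 2) + 1) / r ^+ 2.

Let Q0 : 0 <= Q.
Proof. by rewrite divr_ge0 ?sqr_ge0// mulr_ge0// addr_ge0// sqrtr_ge0. Qed.

Lemma ur_lipschitz s t : r <= s -> r <= t -> `|ur c r s - ur c r t| <= Q * `|s - t|.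
Proof.
wlog ts : s t / t <= s.
  move=> H rs rt; have [ts|/ltW st] := leP t s; first exact: H.
  by rewrite distrC [leRHS](_ : _ = Q * `|t - s|) ?H// distrC.
move=> rs rt.
have d (y : R) : t <= y -> is_derive y (1 : R) (ur c r) (qr c r y / y ^+ 2).
  by move=> ty; apply: der_ur; rewrite (lt_le_trans r0)// (le_trans rt).
have dy (y : R) : y \in `]t, s[%R -> is_derive y (1 : R) (ur c r) (qr c r y / y ^+ 2).
  by rewrite in_itv/= => /andP[ty _]; apply: d; exact: ltW.
have cu : {within `[t, s], continuous (ur c r)}.
  apply: continuous_in_subspaceT => y /set_mem /=; rewrite in_itv/= => /andP[ty _].
  exact: (derivable_continuous1 (d y ty)).
have [y] := MVT_segment ts dy cu; rewrite in_itv/= => /andP[ty ys] ->.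
rewrite normrM ler_wpM2r// normrM normfV /Q.
have ry : r <= y by exact: le_trans rt ty.
have y0 : 0 < y by exact: lt_le_trans ry.
rewrite ler_pM ?invr_ge0//; first exact: qr_le.
have ry2 : r ^+ 2 <= y ^+ 2 by rewrite ler_sqr// nnegrE ltW.
by rewrite ger0_norm ?sqr_ge0// lef_pV2 ?posrE ?exprn_gt0.
Qed.

(** [Ur] has a kink on the sphere of radius [r], but [Num.max r] is 1-Lipschitz, so [Ur] inherits
    the Lipschitz constant of [ur]. This is what admits it to an integration by parts whose
    derivative exists only almost everywhere. *)
Lemma Ur_lipschitz i (h : R) x : `|Ur c r (h *: basis3 i + x) - Ur c r x| <= Q * `|h|.
Proof.
rewrite /Ur (le_trans (ur_lipschitz _ _)) ?le_max ?lexx// ler_wpM2l//.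
apply: le_trans (enorm_dist_basis i h x).
set a := enorm _; set b := enorm x.
have := ler_norm (a - b); have := ler_norm (b - a); rewrite (distrC b).
by case: (leP r a) => ?; case: (leP r b) => ? ? ?; rewrite ler_norml; apply/andP; split; lra.
Qed.

Lemma Ur_le x : `|Ur c r x| <= c * Num.sqrt (pi / 2) / r.
Proof.
rewrite /Ur; set s := Num.max _ _; have rs : r <= s by rewrite le_max lexx.
rewrite (le_trans (ur_le r0 c0 rs))// ler_wpM2l ?mulr_ge0 ?sqrtr_ge0//.
by rewrite lef_pV2 ?posrE// (lt_le_trans r0).
Qed.

Definition iout x : R := \1_(`[r, +oo[%classic : set R) (enorm x).

Lemma ioutE x : iout x = (r <= enorm x)%R%:R.
Proof. by rewrite /iout indicE mem_setE in_itv/= andbT. Qed.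

Lemma measurable_iout : measurable_fun setT (iout : mR3 R -> R).
Proof.
rewrite /iout; have me := measurable_enorm (@measurable_id _ (mR3 R) setT).
by meas.
Qed.

(** Frozen at its value for radius [r] inside the ball, the coefficient is continuous everywhere, so
    integrability against test functions is immediate; the cut-off is left to [iout]. *)
Definition q3m x : R := q3 c r (Num.max r (enorm x)).

Lemma continuous_q3m : continuous q3m.
Proof.
move=> x; have mr : 0 < Num.max r (enorm x) by rewrite lt_max r0.
apply: (continuous_comp (f := fun x => Num.max r (enorm x)) (g := q3 c r)); last first.
  exact: derivable_continuous1 (der_q3 c r mr).
apply: (continuous_comp (@continuous_enorm R x)).
rewrite (_ : Num.max r = fun t => (r + t + `|r - t|) / 2).
  apply: cvgM; last exact: cvg_cst.
  apply: cvgD; first by apply: cvgD; [exact: cvg_cst|exact: cvg_id].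
  by apply: cvg_norm; apply: cvgB; [exact: cvg_cst|exact: cvg_id].
by apply/funext => t; rewrite maxr_absE.
Qed.

Variable eta : R3 R -> R.
Hypothesis teta : test_function eta.
Local Notation g i := (pder [:: i] eta).
Local Notation gg i := (pder [:: i; i] eta).

Definition outer_flux i x : R := iout x * (q3m x * xcoord i x * pder [:: i] eta x).

Let wexp x : R := c * expg (enorm x).

Let cwexp : continuous wexp.
Proof.
move=> x; apply: cvgM; first exact: cvg_cst.
exact: (cvg_radial (der_expg (enorm x))).
Qed.

Lemma integrable_cont_pder (f : R3 R -> R) s : continuous f ->
  (@leb3 R).-integrable setT (fun x => (f x * pder s eta x)%:E).
Proof.
move=> cf; have [L HL] := test_function_outside teta.
have cfg : continuous (fun x => f x * pder s eta x).
  by move=> x; apply: cvgM; [exact: cf|exact: (continuous_pder teta)].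
have fL x : L < enorm x -> f x * pder s eta x = 0.
  by move=> xL; rewrite (pder_outside s HL)// mulr0.
have [M HM] := bounded_outside cfg fL.
exact: (integrable_bounded_support (continuous_measurable_R3 cfg) HM fL).
Qed.

Lemma integrable_iout (f : R3 R -> R) : (@leb3 R).-integrable setT (fun x => (f x)%:E) ->
  (@leb3 R).-integrable setT (fun x => (iout x * f x)%:E).
Proof.
move=> fi; have /integrableP[/measurable_EFinP mf _] := fi.
apply: (le_integrable measurableT _ _ fi).
  by apply/measurable_EFinP; apply: measurable_funM => //; exact: measurable_iout.
move=> x _; rewrite lee_fin ioutE; case: (r <= enorm x).
  by rewrite mul1r.
by rewrite mul0r normr0.
Qed.

Let cq3 i : continuous (fun x => q3m x * xcoord i x).
Proof. by move=> x; apply: cvgM; [exact: continuous_q3m|exact: continuous_coord]. Qed.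

Lemma integrable_outer_flux i : (@leb3 R).-integrable setT (fun x => (outer_flux i x)%:E).
Proof. have H := integrable_iout (integrable_cont_pder [:: i] (@cq3 i)).
exact H. Qed.

(** Off the null sphere of radius [r] the integrand is the [i]-th partial derivative of [Ur * pder
    [:: i] eta], a compactly supported Lipschitz function in that direction. *)
Lemma integral_outer_flux i :
  \int[@leb3 R]_x (outer_flux i x + Ur c r x * pder [:: i; i] eta x) = 0.
Proof.
have [L HL] := test_function_outside teta.
have [M HM] := bounded_pder teta [:: i]; have [M' HM'] := bounded_pder teta [:: i; i].
have mU : measurable_fun setT (Ur c r : mR3 R -> R).
  by apply: continuous_measurable_R3; exact: continuous_Ur.
have mE : measurable_fun setT (outer_flux i : mR3 R -> R).
  by have /integrableP[/measurable_EFinP] := integrable_outer_flux i.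
apply: (@Rintegral_partial_eq0 _ (fun x => Ur c r x * pder [:: i] eta x) _ i
  (c * Num.sqrt (pi / 2) / r * M' + Q * M) L).
- by apply: measurable_funM => //; exact: (measurable_pder teta).
- apply: measurable_funD => //.
  by apply: measurable_funM => //; exact: (measurable_pder teta).
- move=> h x; apply: normr_prod_diff; [exact: Ur_le| |exact: Ur_lipschitz|exact: HM].
  exact: (partial_lipschitz (is_derive_pder teta [:: i] i) HM').
- by move=> x xL; rewrite (pder_outside [:: i] HL)// mulr0.
exists [set x : mR3 R | enorm x = r]; split.
- rewrite (_ : [set x : mR3 R | _] = (@enorm R : mR3 R -> R) @^-1` [set r])//.
  rewrite -[X in measurable X]setTI.
  by apply: (measurable_enorm (@measurable_id _ _ setT)).
- exact: leb3_sphere0.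
move=> x /= nx; apply: contrapT => xr; apply: nx.
have dg := is_derive_pder teta [:: i] i x.
have [rx|xr'] := ltP r (enorm x).
  apply: (is_derive_eq (derM (der_Ur c r0 i rx) dg)).
  by rewrite /outer_flux ioutE (ltW rx) mul1r /q3m max_r ?(ltW rx).
have xr2 : enorm x < r by rewrite lt_neqAle xr' andbT; apply/eqP.
have dU0 : is_derive (x : R3 R) (basis3 i) (Ur c r) 0.
  apply: (near_eq_is_derive _ (der_cst (0 : R) (x : R3 R) (basis3 i))).
  have : \forall y \near (x : R3 R), enorm y < r.
    have := @continuous_enorm R x; move/cvgr_lt; exact.
  by apply: filterS => y /ltW yr; rewrite Ur_in.
apply: (is_derive_eq (derM dU0 dg)).
by rewrite /outer_flux ioutE leNgt xr2 /= !mul0r.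
Qed.

(** In the exterior this is the divergence of [eta] times the gradient of [Ur], because the
    Laplacian of [Ur] is [wexp]. *)
Let hD x : R := iout x * (wexp x * eta x + q3m x * \sum_(i < 3) xcoord i x * pder [:: i] eta x).

Let hDE x : hD x = iout x * (wexp x * eta x) + \sum_(i < 3) outer_flux i x.
Proof.
rewrite /hD mulrDr; congr (_ + _); rewrite mulr_sumr mulr_sumr.
by apply: eq_bigr => i _; rewrite /outer_flux !mulrA.
Qed.

Let psi (p : T * T) (s : R) : R := wsph p * (c * s ^+ 2 * expg s * eta (sph s p) +
  qr c r s * \sum_(i < 3) xcoord i (sph 1 p) * pder [:: i] eta (sph s p)).
Let Psi (p : T * T) (s : R) : R := wsph p * (qr c r s * eta (sph s p)).

Let sph1 (s : R) (p : T * T) : sph s p = s *: (sph 1 p : R3 R).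
Proof. by rewrite -sphZ mulr1. Qed.

Let der_ray (p : T * T) (s : R) : is_derive s (1 : R) (fun s => eta (sph s p))
  (\sum_(i < 3) xcoord i (sph 1 p) * pder [:: i] eta (sph s p)).
Proof.
rewrite (_ : (fun s => _) = (fun s : R => eta (s *: (sph 1 p : R3 R) + 0))); last first.
  by apply/funext => t; rewrite sph1 addr0.
apply: is_derive_line; rewrite addr0 -sph1.
apply: (is_derive_partials _ (fun i y => is_derive_pder teta [::] i y)) => i.
exact: (continuous_pder teta).
Qed.

Let der_Psi (p : T * T) (s : R) : 0 < s -> is_derive s (1 : R) (Psi p) (psi p s).
Proof. by move=> s0; exact: (derZ (wsph p) (derM (der_qr c r s0) (der_ray p s))). Qed.

Let cont_ray (f : R3 R -> R) (p : T * T) : continuous f -> continuous (fun s : R => f (sph s p)).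
Proof.
move=> cf s; apply: (cvg_comp (fun s => sph s p) f (G := nbhs (sph s p))); last exact: cf.
rewrite (_ : (fun s => sph s p) = (fun s : R => s *: (sph 1 p : R3 R))); last first.
  by apply/funext => t; exact: sph1.
have H : (fun t : R => t *: (sph 1 p : R3 R)) t @[t --> s] --> s *: (sph 1 p : R3 R).
  by apply: cvgZr_tmp; exact: cvg_id.
by rewrite -(sph1 s p) in H.
Qed.

Let cont_psi (p : T * T) (s : R) : 0 < s -> {for s, continuous (psi p)}.
Proof.
move=> s0; apply: cvgM; first exact: cvg_cst.
apply: cvgD; apply: cvgM.
- apply: cvgM; last exact: (derivable_continuous1 (der_expg s)).
  apply: cvgM; first exact: cvg_cst.
  exact: (derivable_continuous1 (derX 2 (is_derive_id s 1))).
- exact: (@cont_ray eta p (continuous_pder teta (s := [::])) s).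
- exact: (derivable_continuous1 (der_qr c r s0)).
rewrite (_ : (fun s => _) = (fun s : R =>
   xcoord ord0 (sph 1 p) * g ord0 (sph s p) +
   (xcoord (lift ord0 ord0) (sph 1 p) * g (lift ord0 ord0) (sph s p) +
    xcoord (lift ord0 (lift ord0 ord0)) (sph 1 p) * g (lift ord0 (lift ord0 ord0)) (sph s p)))); last first.
  by apply/funext => t; rewrite sum_ord3.
rewrite sum_ord3.
have cg i : xcoord i (sph 1 p) * g i (sph t p) @[t --> s] --> xcoord i (sph 1 p) * g i (sph s p).
  apply: cvgM; first exact: cvg_cst.
  exact: (@cont_ray (g i) p (continuous_pder teta (s := [:: i])) s).
by apply: cvgD; [exact: cg|apply: cvgD; exact: cg].
Qed.

Let integrable_hD : (@leb3 R).-integrable setT (fun x => (hD x)%:E).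
Proof.
have i1 := integrable_iout (integrable_cont_pder [::] cwexp).
have i2 := integrableD measurableT (integrable_outer_flux (lift ord0 ord0)) (integrable_outer_flux (lift ord0 (lift ord0 ord0))).
have i3 := integrableD measurableT (integrable_outer_flux ord0) i2.
have := integrableD measurableT i1 i3.
apply: eq_integrable => // x _.
by rewrite hDE sum_ord3 /=.
Qed.

Let wsph0 : forall p : T * T, 0 <= wsph p := @wsph_ge0 R.

(* Along a ray, [s ^+ 2 * hD] is the derivative of [qr * eta], so each ray
   contributes the boundary term at radius [r]. *)
Lemma integral_hD : \int[@leb3 R]_x hD x = \int[sigma r]_x (- qr c r r * eta x).
Proof.
have [L HL] := test_function_outside teta.
have mhD : measurable_fun setT (hD : mR3 R -> R).
  by have /integrableP[/measurable_EFinP] := integrable_hD.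
have w0 (z : mR3 R) : 0 <= ws z.2 * wsph z.1 by rewrite mulr_ge0 ?ws_ge0 ?wsph_ge0.
have mw : measurable_fun setT (fun z : mR3 R => ws z.2 * wsph z.1).
  by rewrite /ws /ipos /wsph; meas.
have ik := (transfer_integrable w0 (@polar3 R) (@measurable_sph R) mw
  ((measurable_EFinP _ _).2 mhD)).1 integrable_hD.
have meta : measurable_fun setT (fun x : mR3 R => - qr c r r * eta x).
  by apply: measurable_funM; [exact: measurable_cst|exact: (measurable_pder teta [::])].
rewrite (transfer_Rintegral wsph0 (transfer_sigma r) meta).
rewrite /Rintegral (transfer_integral w0 (@polar3 R) ((measurable_EFinP _ _).2 mhD)).
congr fine; rewrite -(@integral12_prod_meas1 _ _ _ _ _ (@leb2 R) leb _ ik).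
apply: eq_integral => p _; rewrite /fubini_F /=.
(* Beyond both [r] and the support of [eta], so that only the boundary term at [r] survives. *)
pose b := Num.max r L + 1.
have rb : r < b by rewrite /b (le_lt_trans (_ : r <= Num.max r L)) ?le_max ?lexx ?ltrDl.
have Lb : L < b by rewrite /b (le_lt_trans (_ : L <= Num.max r L)) ?le_max ?lexx ?orbT ?ltrDl.
have b0 : 0 < b := lt_trans r0 rb.
transitivity (\int[leb]_(s in `[r, b]) (psi p s)%:E)%E; last first.
  rewrite (FTC2_is_derive (F := Psi p) rb).
  - rewrite /Psi (HL (sph b p)) ?enorm_sph ?gtr0_norm// -EFinB; congr EFin; ring.
  - by move=> s; rewrite in_itv/= => /andP[rs _]; apply: cont_psi; exact: lt_le_trans rs.
  - by move=> s; rewrite in_itv/= => /andP[rs _]; apply: der_Psi; exact: lt_trans rs.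
  - move=> s; rewrite in_itv/= => /andP[rs _].
    exact: (derivable_continuous1 (der_Psi p (lt_le_trans r0 rs))).
rewrite [RHS]integral_mkcond; apply: eq_integral => s _.
rewrite patchE -EFinM.
have [s0|s0] := leP s 0.
  rewrite memNset /=; last by rewrite in_itv/= => /andP[/(lt_le_trans r0)]; rewrite ltNge s0.
  by rewrite /ws iposE ltNge s0 /= !mul0r mulr0.
have es : enorm (sph s p) = s by rewrite enorm_sph gtr0_norm.
have [rs|sr] := leP r s; last first.
  rewrite memNset /=; last by rewrite in_itv/= => /andP[]; rewrite leNgt sr.
  by rewrite /hD ioutE es leNgt sr /= !mul0r.
have [sb|bs] := leP s b; last first.
  rewrite memNset /=; last by rewrite in_itv/= => /andP[_]; rewrite leNgt bs.
  have sL : L < enorm (sph s p) by rewrite es (lt_trans Lb).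
  rewrite /hD HL// big1 => [|i _]; last by rewrite (pder_outside [:: i] HL)// mulr0.
  by rewrite !mulr0 addr0 mulr0 mul0r.
rewrite mem_set /=; last by rewrite in_itv/= rs.
congr EFin; rewrite /hD ioutE es rs mul1r /wexp es /q3m es max_r// /q3 /ws iposE s0.
have -> : \sum_(i < 3) xcoord i (sph s p) * g i (sph s p) =
   s * \sum_(i < 3) xcoord i (sph 1 p) * g i (sph s p).
  by rewrite mulr_sumr; apply: eq_bigr => i _; rewrite mulrA -xcoordZ -sph1.
rewrite /psi (_ : true%:R = 1%R :> R)//; set S := \sum_(_ < _) _.
by field; rewrite gt_eqF.
Qed.

(** Summing [integral_outer_flux] over [i] trades the Laplacian of [eta] for the exterior pairing of
    gradients; adding the exterior part of [omega] turns it into [hD], whose integral is the surface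
    term. What remains of [omega] is its restriction to the ball. *)
Lemma integral_Ur_laplacian :
  \int[@leb3 R]_x (c * expg (enorm x) * eta x) - \int[@leb3 R]_x (Ur c r x * laplacian eta x) =
  \int[@leb3 R]_x ((1 - iout x) * (c * expg (enorm x) * eta x)) + \int[sigma r]_x (- qr c r r * eta x).
Proof.
have iw := integrable_cont_pder [::] cwexp; have iow := integrable_iout iw.
have iU i := integrable_cont_pder [:: i; i] (@continuous_Ur R c r r0).
have iE i := integrable_outer_flux i.
have sE := Rintegral_sum_ord3 iE; have isE := integrable_sum_ord3 iE.
have sU : \int[@leb3 R]_x (Ur c r x * laplacian eta x) = \sum_(i < 3) \int[@leb3 R]_x (Ur c r x * gg i x).
  rewrite -(Rintegral_sum_ord3 iU).
  by apply: eq_Rintegral => x _; rewrite /laplacian mulr_sumr.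
have EU i : \int[@leb3 R]_x outer_flux i x = - \int[@leb3 R]_x (Ur c r x * gg i x).
  have /eqP := etrans (esym (RintegralD measurableT (iE i) (iU i))) (integral_outer_flux i).
  by rewrite addr_eq0 => /eqP.
have hE : \int[@leb3 R]_x hD x = \int[@leb3 R]_x (iout x * (wexp x * eta x)) - \int[@leb3 R]_x (Ur c r x * laplacian eta x).
  rewrite sU -sumrN -(eq_bigr _ (fun i _ => EU i)) -sE.
  transitivity (\int[@leb3 R]_x (iout x * (wexp x * eta x) + \sum_(i < 3) outer_flux i x)).
    by apply: eq_Rintegral => x _; exact: hDE.
  exact: (RintegralD measurableT iow isE).
rewrite -integral_hD hE.
have -> : \int[@leb3 R]_x ((1 - iout x) * (c * expg (enorm x) * eta x)) =
   \int[@leb3 R]_x (wexp x * eta x) - \int[@leb3 R]_x (iout x * (wexp x * eta x)).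
  transitivity (\int[@leb3 R]_x (wexp x * eta x - iout x * (wexp x * eta x))).
    by apply: eq_Rintegral => x _; rewrite mulrBl mul1r.
  exact: (RintegralB measurableT iw iow).
by rewrite /wexp; ring.
Qed.

End distributional_laplacian.

(** * The stationary measure *)

Section integral_lemmas.
Context d (T : measurableType d) (R : realType) (mu : {measure set T -> \bar R}).

Lemma integrable_bounded (f : T -> R) (M : R) : (mu setT < +oo)%E ->
  measurable_fun setT f -> (forall x, `|f x| <= M) -> mu.-integrable setT (EFin \o f).
Proof.
move=> fm mf fM; apply: measurable_bounded_integrable => //.
exists M; split; first exact: num_real.
by move=> y My x _ /=; rewrite (le_trans (fM x))// ltW.
Qed.

Lemma integrable_mulr_bounded (g f : T -> R) (M : R) :
  mu.-integrable setT (EFin \o g) -> measurable_fun setT f -> (forall x, `|f x| <= M) ->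
  mu.-integrable setT (EFin \o (fun x => g x * f x)).
Proof.
move=> gi mf fM; have /integrableP[/measurable_EFinP mg _] := gi.
have i1 : mu.-integrable setT (EFin \o (fun x => M * g x)).
  exact: (integrableZl measurableT M gi).
apply: (le_integrable measurableT _ _ i1).
  by apply/measurable_EFinP; exact: measurable_funM.
move=> x _; rewrite /= lee_fin (mulrC M) !normrM ler_wpM2l// (le_trans (fM x))//.
exact: ler_norm.
Qed.

Lemma normr_Rintegral_le (f : T -> R) (M a : R) : mu setT = a%:E ->
  measurable_fun setT f -> (forall x, `|f x| <= M) -> `|\int[mu]_x f x| <= M * a.
Proof.
move=> mua mf fM; have fin : (mu setT < +oo)%E by rewrite mua ltry.
have fi := integrable_bounded fin mf fM.
rewrite (le_trans (le_normr_Rintegral measurableT fi))//.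
have nf : measurable_fun setT (fun x => `|f x|) by exact: measurableT_comp.
have ni : mu.-integrable setT (EFin \o (fun x => `|f x|)).
  by apply: (integrable_bounded (M := M)) => // x; rewrite normr_id.
have ci : mu.-integrable setT (EFin \o (fun=> M)).
  by apply: (integrable_bounded (M := `|M|)).
rewrite (le_trans (le_Rintegral measurableT ni ci (fun x _ => fM x)))//.
by rewrite Rintegral_cst// mua.
Qed.

Import HBNNSimple.

(* [f] may be nonmeasurable: a simple function below [f] vanishes off [N]. *)
Lemma ge0_integral_null (N : set T) (f : T -> \bar R) : measurable N -> mu N = 0%E ->
  (forall x, 0 <= f x)%E -> (forall x, ~ N x -> f x = 0%E) -> (\int[mu]_x f x = 0)%E.
Proof.
move=> mN N0 f0 fN; apply/eqP; rewrite eq_le integral_ge0 ?andbT//.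
rewrite ge0_integralTE//; apply: ub_ereal_sup => _ /= [h hf <-].
rewrite -integralT_nnsfun (ge0_negligible_integral mN)//=; last 2 first.
- exact/measurable_EFinP.
- by move=> x _; rewrite lee_fin.
rewrite integral0_eq// => x [_ Nx].
have := hf x; rewrite (fN x Nx) lee_fin => hx0.
by congr EFin; apply/eqP; rewrite eq_le hx0 /=.
Qed.

Lemma Rintegral_null (N : set T) (f : T -> R) : measurable N -> mu N = 0%E ->
  (forall x, ~ N x -> f x = 0) -> \int[mu]_x f x = 0.
Proof.
move=> mN N0 fN; rewrite /Rintegral integralE !(ge0_integral_null mN N0) ?subee//.
- by move=> x Nx; rewrite funenegE fN//= oppr0 maxxx.
- by move=> x Nx; rewrite funeposE fN//= maxxx.
Qed.

Lemma Rintegral_density (k : T -> R) (mk : measurable_fun setT k) (k0 : forall x, 0 <= k x)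
    (f : T -> R) : measurable_fun setT f ->
  \int[density mu mk k0]_x f x = \int[mu]_x (f x * k x).
Proof.
have tr : transfer mu (density mu mk k0) id k.
  by move=> h mh h0; exact: ge0_integral_density.
by move=> mf; exact: (transfer_Rintegral k0 tr mf).
Qed.

End integral_lemmas.

Lemma Rintegral_measure_add d (T : measurableType d) (R : realType)
    (m1 m2 : {measure set T -> \bar R}) (f : T -> R) :
  m1.-integrable setT (EFin \o f) -> m2.-integrable setT (EFin \o f) ->
  \int[measure_add m1 m2]_x f x = \int[m1]_x f x + \int[m2]_x f x.
Proof.
move=> i1 i2; rewrite /Rintegral (integral_measure_add measurableT i1 i2) fineD//.
- exact: (integrable_fin_num measurableT i1).
- exact: (integrable_fin_num measurableT i2).
Qed.

Section unit_mass.
Context d (T : measurableType d) (R : realType) (mu : {measure set T -> \bar R}).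
Hypothesis mu1 : mu setT = 1%E.

(** A copy of [mu] indexed by the mass hypothesis, to which the probability structure can be
    attached. *)
Definition unit_mass of mu setT = 1%E : set T -> \bar R := mu.

HB.instance Definition _ := Measure.on (unit_mass mu1).
HB.instance Definition _ := Measure_isProbability.Build _ _ _ (unit_mass mu1) mu1.

Lemma probability_of_measure : exists P : probability T R, forall A, P A = mu A.
Proof. by exists (unit_mass mu1). Qed.

End unit_mass.


(** * Radial Gaussian integrals *)

Section radial_integrals.
Variable R : realType.
Local Notation T := (measurableTypeR R).
Local Notation leb := (@lebesgue_measure R).

Lemma measurable_expg : measurable_fun setT (@expg R : T -> R).
Proof. by rewrite /expg; meas. Qed.

Lemma expg_ge0 (s : R) : 0 <= expg s. Proof. exact: expR_ge0. Qed.

Lemma continuous_expg : continuous (@expg R).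
Proof. by move=> s; exact: (derivable_continuous1 (der_expg s)). Qed.

Lemma cvgy_mul_expg : (fun s : R => s * expg s) s @[s --> +oo] --> (0 : R).
Proof.
apply/cvgrPdist_lt => e e0; near=> s.
have s0 : 0 < s by near: s; apply: nbhs_pinfty_gt; exact: num_real.
have se : 2 / e < s by near: s; apply: nbhs_pinfty_gt; exact: num_real.
rewrite sub0r normrN ger0_norm ?mulr_ge0 ?expg_ge0 ?(ltW s0)//.
(* [s * exp(- s^2 / 2) <= 2 / s], from [s^2 / 2 <= exp(s^2 / 2)]. *)
apply: (@le_lt_trans _ _ (2 / s)); last first.
  by rewrite ltr_pdivrMr// mulrC -ltr_pdivrMr.
rewrite /expg mulNr expRN ler_pdivrMr ?expR_gt0// mulrAC ler_pdivlMr//.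
have := expR_ge1Dx (s ^+ 2 / 2); rewrite -expr2; lra.
Unshelve. all: by end_near. Qed.

Lemma cvgy_expg : (@expg R) s @[s --> +oo] --> (0 : R).
Proof.
apply: (@squeeze_cvgr _ _ _ _ (fun=> 0) (fun s => s * expg s)); last 2 first.
- exact: cvg_cst.
- exact: cvgy_mul_expg.
near=> s; rewrite expg_ge0 ler_peMl ?expg_ge0//.
Unshelve. all: by end_near. Qed.

Lemma cvgy_G : (@G R) s @[s --> +oo] --> Num.sqrt (pi / 2 : R).
Proof.
rewrite -[X in _ --> X]mulr1; apply: cvgM; first exact: cvg_cst.
apply: (cvg_comp (fun s : R => s / Num.sqrt 2) (@erf R)); last exact: cvgy_erf.
have s2 : 0 < Num.sqrt 2 :> R by rewrite sqrtr_gt0.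
apply/cvgryPge => A; near=> s; rewrite ler_pdivlMr//.
Unshelve. all: by end_near. Qed.

(** The primitive of [s ^+ 2 * expg s] vanishing at [0], found by integrating by parts. *)
Definition Q2 (s : R) : R := G s - s * expg s.

Lemma der_Q2 (s : R) : 0 < s -> is_derive s (1 : R) Q2 (s ^+ 2 * expg s).
Proof.
move=> s0; apply: (is_derive_eq (derD (is_derive_G s0) (derN (derM (is_derive_id s 1) (der_expg s))))).
by rewrite -/(expg s); ring.
Qed.

Lemma Q2_right0 : Q2 s @[s --> (0 : R)^'+] --> Q2 0.
Proof.
rewrite /Q2; apply: cvgB; first by rewrite G0; exact: G_right0.
apply: cvg_at_right_filter.
by apply: cvgM; [exact: cvg_id|exact: continuous_expg].
Qed.

Lemma Q20 : Q2 0 = 0. Proof. by rewrite /Q2 G0 mul0r subrr. Qed.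

Let cont_f (s : R) : {for s, continuous (fun s : R => s ^+ 2 * expg s)}.
Proof. by apply: cvgM; [exact: exprn_continuous|exact: continuous_expg]. Qed.

Lemma integral_sqr_expg (r : R) : 0 < r ->
  (\int[leb]_(s in `[0%R, r]) (s ^+ 2 * expg s)%:E = (Q2 r)%:E)%E.
Proof.
move=> r0; rewrite (continuous_FTC2 (F := Q2) r0).
- by rewrite Q20 sube0.
- by apply: continuous_subspaceT => s; exact: cont_f.
- split.
  + by move=> s; rewrite in_itv/= => /andP[s0 _]; have [] := der_Q2 s0.
  + exact: Q2_right0.
  + by apply: cvg_at_left_filter; exact: (derivable_continuous1 (der_Q2 r0)).
- move=> s; rewrite in_itv/= => /andP[s0 _]; rewrite derive1E.
  by have [_ ->] := der_Q2 s0.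
Qed.

Lemma integraly_sqr_expg :
  (\int[leb]_(s in `[0%R, +oo[) (s ^+ 2 * expg s)%:E = (Num.sqrt (pi / 2))%:E)%E.
Proof.
rewrite (@ge0_continuous_FTC2y _ _ Q2 0 (Num.sqrt (pi / 2))).
- by rewrite Q20 sube0.
- by move=> s _; rewrite mulr_ge0 ?sqr_ge0 ?expg_ge0.
- by apply: continuous_subspaceT => s; exact: cont_f.
- rewrite -[X in _ --> X]subr0; apply: cvgB; [exact: cvgy_G|exact: cvgy_mul_expg].
- by move=> s s0; have [] := der_Q2 s0.
- exact: Q2_right0.
- move=> s; rewrite in_itv/= andbT => s0; rewrite derive1E.
  by have [_ ->] := der_Q2 s0.
Qed.

Lemma integraly_expg (r : R) : 0 < r ->
  (\int[leb]_(s in `[r, +oo[) (s * expg s)%:E = (expg r)%:E)%E.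
Proof.
move=> r0; have d (s : R) := derN (der_expg s).
rewrite (@ge0_continuous_FTC2y _ _ (fun s => - expg s) r 0).
- by rewrite EFinN oppeK add0e.
- by move=> s rs; rewrite mulr_ge0 ?expg_ge0// ltW// (lt_le_trans r0).
- apply: continuous_subspaceT => s.
  by apply: cvgM; [exact: cvg_id|exact: continuous_expg].
- by rewrite -[X in _ --> X]oppr0; apply: cvgN; exact: cvgy_expg.
- by move=> s _; have [] := d s.
- by apply: cvg_at_right_filter; apply: cvgN; exact: continuous_expg.
- by move=> s _; rewrite derive1E; have [_ ->] := d s; rewrite mulNr opprK.
Qed.

Lemma integral_wsph : (\int[@leb2 R]_p (wsph p)%:E = (4 * pi)%:E)%E.
Proof.
rewrite -(sigma_setT 1) -[RHS]mul1e -(integral_cst _ measurableT 1%E).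
rewrite (transfer_sigma 1)//.
by apply: eq_integral => p _; rewrite mul1e.
Qed.

Lemma integral_radial (h : T -> \bar R) : measurable_fun setT h -> (forall s, 0 <= h s)%E ->
  (\int[@leb3 R]_x h (enorm x) = (4 * pi)%:E * \int[leb]_s (h s * (ws s)%:E))%E.
Proof.
move=> mh h0.
have mf : measurable_fun setT (fun x : mR3 R => h (enorm x)).
  exact: (measurableT_comp mh (measurable_enorm (@measurable_id _ (mR3 R) setT))).
rewrite (polar3 mf) ?tonelli21//; last 2 first.
- apply: emeasurable_funM; first exact: (measurableT_comp mf (@measurable_sph R)).
  by rewrite /ws /ipos /wsph; meas.
- by move=> z; rewrite mule_ge0// lee_fin mulr_ge0 ?ws_ge0 ?wsph_ge0.
have mhw : measurable_fun setT (fun s : T => h s * (ws s)%:E)%E.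
  by apply: emeasurable_funM => //; rewrite /ws /ipos; meas.
rewrite muleC -ge0_integralZr//; last 2 first.
- by move=> s _; rewrite mule_ge0// lee_fin ws_ge0.
- by rewrite lee_fin mulr_ge0// pi_ge0.
apply: eq_integral => s _; rewrite -integral_wsph -ge0_integralZl//; last 3 first.
- by apply/measurable_EFinP; exact: measurable_wsph.
- by move=> p _; rewrite lee_fin wsph_ge0.
- by rewrite mule_ge0// lee_fin ws_ge0.
apply: eq_integral => p _; rewrite /= enorm_sph EFinM muleA.
have [s0|s0] := leP s 0; first by rewrite /ws iposE ltNge s0 /= !mul0r !mule0.
by rewrite gtr0_norm.
Qed.

End radial_integrals.

(** * Construction and total mass of the measure *)

Section stationary_measure.
Variables (R : realType) (m r : R).
Hypotheses (m0 : 0 < m) (r0 : 0 < r).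
Local Notation T := (measurableTypeR R).
Local Notation leb := (@lebesgue_measure R).
Implicit Types (x v : R3 R).

Lemma cm_gt0 : 0 < cm m.
Proof. by rewrite divr_gt0// powR_gt0// mulr_gt0// pi_gt0. Qed.

Lemma omega_ge0 x : 0 <= omega m x.
Proof. by rewrite mulr_ge0 ?expR_ge0// ltW// cm_gt0. Qed.

Lemma measurable_omega : measurable_fun setT (omega m : mR3 R -> R).
Proof.
have me := measurable_enorm (@measurable_id _ (mR3 R) setT).
by rewrite /omega; meas.
Qed.

Definition inner_density x : R := omega m x * (1 - iout r x).

Lemma inner_density_ge0 x : 0 <= inner_density x.
Proof.
by rewrite mulr_ge0 ?omega_ge0// ioutE subr_ge0; case: (r <= enorm x).
Qed.

Lemma measurable_inner_density : measurable_fun setT (inner_density : mR3 R -> R).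
Proof.
have mw := measurable_omega; have mi := @measurable_iout R r.
by rewrite /inner_density; meas.
Qed.

(** The surface density times [r ^+ 2], since [sigma r] has mass [4 * pi] for every [r]. *)
Definition shell_charge : R := cm m * expR (- r ^+ 2 / 2) / r * r ^+ 2.

Lemma shell_charge_ge0 : 0 <= shell_charge.
Proof. by rewrite mulr_ge0 ?sqr_ge0// divr_ge0 ?(ltW r0)// mulr_ge0 ?expR_ge0// ltW// cm_gt0. Qed.

Lemma shell_chargeE : shell_charge = cm m * (r * expg r).
Proof. by rewrite /shell_charge /expg; field; rewrite gt_eqF. Qed.

Definition phi0 : {measure set (mR3 R) -> \bar R} :=
  measure_add (density (@leb3 R) measurable_inner_density inner_density_ge0)
    (density (sigma r) (measurable_cst shell_charge) (fun=> shell_charge_ge0)).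

Lemma phi0D A : phi0 A = (density (@leb3 R) measurable_inner_density inner_density_ge0 A +
  density (sigma r) (measurable_cst shell_charge) (fun=> shell_charge_ge0) A)%E.
Proof. exact: measure_addE. Qed.

Lemma density_sigma_setT :
  density (sigma r) (measurable_cst shell_charge) (fun=> shell_charge_ge0) setT = (shell_charge * (4 * pi))%:E.
Proof.
transitivity (\int[sigma r]_(x in setT) (cst shell_charge%:E x : \bar R))%E; first by [].
transitivity (shell_charge%:E * sigma r setT)%E; first exact: integral_cst.
by rewrite sigma_setT EFinM.
Qed.

Lemma phi0E A : measurable A -> phi0 A = phi_measure m r A.
Proof.
move=> mA; rewrite phi0D /phi_measure; congr (_ + _)%E.
  rewrite /density /gaussian_measure [LHS]integral_mkcond [RHS]integral_mkcond.
  apply: eq_integral => x _; rewrite !patchE in_setI.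
  case: (x \in A) => //=; rewrite /inner_density ioutE.
  have [rx|xr] := leP r (enorm x).
    by rewrite memNset ?subrr ?mulr0// /eball /= ltNge rx.
  by rewrite mem_set// subr0 mulr1.
have mf : measurable_fun setT (fun x : mR3 R => (shell_charge * \1_A x)%:E).
  by apply/measurable_EFinP; apply: measurable_funM => //; exact: measurable_indic.
have -> : density (sigma r) (measurable_cst shell_charge) (fun=> shell_charge_ge0) A = (\int[sigma r]_x (shell_charge * \1_A x)%:E)%E.
  rewrite /density [LHS]integral_mkcond; apply: eq_integral => x _.
  by rewrite patchE indicE; case: (x \in A); rewrite ?mulr1 ?mulr0.
rewrite (transfer_sigma r mf); last by move=> x; rewrite lee_fin mulr_ge0 ?shell_charge_ge0 ?indicE.
rewrite /sphere_measure [X in (_ * X)%E]integral_mkcond.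
set w := cm m * _ / r.
have w0 : 0 <= w by rewrite divr_ge0 ?(ltW r0)// mulr_ge0 ?expR_ge0// ltW// cm_gt0.
rewrite -ge0_integralZl//; last 2 first.
- apply/(measurable_restrictT _ _).1.
    by apply: measurableX; exact: measurable_itv.
  apply/measurable_EFinP; apply: measurable_funTS.
  have mi : measurable_fun setT (fun p : T * T => \1_A (sph r p : mR3 R) : R).
    by apply: (measurableT_comp _ (measurable_sph1 r)); exact: measurable_indic.
  by meas.
- move=> p _; rewrite patchE; case: ifPn => //; rewrite in_setX => /andP[].
  rewrite !mem_setE => h _.
  by rewrite lee_fin mulr_ge0 ?indicE// mulr_ge0 ?sqr_ge0// sin_ge0_pi.
apply: eq_integral => p _; rewrite patchE /wsph !indicE in_setX.
case: (p.1 \in _); case: (p.2 \in _); rewrite /= ?(mul0r, mulr0, mule0)//.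
rewrite -!EFinM; congr EFin; rewrite !mul1r /shell_charge -/w; ring.
Qed.

Lemma integral_inner_density : (\int[@leb3 R]_x (inner_density x)%:E = (4 * pi * (cm m * Q2 r))%:E)%E.
Proof.
have cm0 := ltW cm_gt0.
pose h (s : T) : \bar R := (cm m * expg s * (1 - \1_(`[r, +oo[%classic : set R) s))%:E.
have mh : measurable_fun setT h.
  by rewrite /h; have me := @measurable_expg R; meas.
have h0 s : (0 <= h s)%E.
  rewrite lee_fin; apply: mulr_ge0; first by rewrite mulr_ge0 ?expg_ge0.
  by rewrite indicE subr_ge0; case: (_ \in _).
transitivity (\int[@leb3 R]_x h (enorm x))%E; first by [].
rewrite (integral_radial mh h0).
have -> : (4 * pi * (cm m * Q2 r))%:E = ((4 * pi)%:E * ((cm m)%:E * (Q2 r)%:E))%E.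
  by rewrite -!EFinM.
rewrite -(integral_sqr_expg r0); congr (_ * _)%E.
rewrite [X in _ = (_ * X)%E]integral_mkcond -ge0_integralZl//; last 2 first.
- apply/(measurable_restrictT _ _).1; first exact: measurable_itv.
  by apply: measurable_funTS; have me := @measurable_expg R; meas.
- move=> s _; rewrite patchE; case: ifPn => // _.
  by rewrite lee_fin mulr_ge0 ?sqr_ge0 ?expg_ge0.
apply: (@eq_integral_off_finite _ [set r]).
- by [].
- by apply: emeasurable_funM => //; rewrite /ws /ipos; meas.
- apply: emeasurable_funM; first exact: measurable_cst.
  apply/(measurable_restrictT _ _).1; first exact: measurable_itv.
  by apply: measurable_funTS; have me := @measurable_expg R; meas.
move=> s /= /eqP sr; rewrite patchE /h /ws iposE indicE !mem_setE !in_itv/= andbT.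
have [s0|s0] := leP s 0.
  have [->|sn0] := eqVneq s 0; first by rewrite lexx (ltW r0) /= expr0n /= !mul0r !mule0.
  have -> : (0 <= s) = false by apply/negbTE; rewrite -ltNge lt_neqAle sn0.
  by rewrite /= mul0r !mule0.
rewrite (ltW s0) /=; have [rs|sr'] := leP r s.
  have -> : (s <= r) = false by apply/negbTE; rewrite -ltNge lt_neqAle eq_sym sr.
  by rewrite subrr mulr0 mul0e mule0.
by rewrite (ltW sr') -!EFinM; congr EFin; rewrite subr0 !mulr1 mul1r; ring.
Qed.

(** The shell restores exactly the term [r * expg r] subtracted in [Q2], so only [G r] is left, and
    [cmG] expresses it by [erf]. *)
Lemma phi0_setT : phi0 setT = (m * erf (r / Num.sqrt 2))%:E.
Proof.
rewrite phi0D density_sigma_setT.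
have -> : density (@leb3 R) measurable_inner_density inner_density_ge0 setT = (4 * pi * (cm m * Q2 r))%:E := integral_inner_density.
rewrite -EFinD; congr EFin.
by rewrite shell_chargeE /Q2 -cmG; ring.
Qed.

Lemma Rintegral_phi0 (f : mR3 R -> R) (M : R) : measurable_fun setT f ->
  (forall x, `|f x| <= M) ->
  \int[phi0]_x f x = \int[@leb3 R]_x (f x * inner_density x) + \int[sigma r]_x (f x * shell_charge).
Proof.
move=> mf fM.
have f1 : (density (@leb3 R) measurable_inner_density inner_density_ge0 setT < +oo)%E.
  by rewrite /density integral_inner_density ltry.
have f2 : (density (sigma r) (measurable_cst shell_charge) (fun=> shell_charge_ge0) setT < +oo)%E.
  by rewrite density_sigma_setT ltry.
have i1 := integrable_bounded f1 mf fM; have i2 := integrable_bounded f2 mf fM.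
have E1 : \int[density (@leb3 R) measurable_inner_density inner_density_ge0]_x f x = \int[@leb3 R]_x (f x * inner_density x).
  exact: Rintegral_density.
have E2 : \int[density (sigma r) (measurable_cst shell_charge) (fun=> shell_charge_ge0)]_x f x = \int[sigma r]_x (f x * shell_charge).
  exact: Rintegral_density.
rewrite -E1 -E2; exact: (Rintegral_measure_add i1 i2).
Qed.

Lemma integral_omega : (\int[@leb3 R]_x (omega m x)%:E = m%:E)%E.
Proof.
have cm0 := ltW cm_gt0.
pose h (s : T) : \bar R := (cm m * expg s)%:E.
have mh : measurable_fun setT h by rewrite /h; have me := @measurable_expg R; meas.
have h0 s : (0 <= h s)%E by rewrite lee_fin mulr_ge0 ?expg_ge0.
transitivity (\int[@leb3 R]_x h (enorm x))%E; first by [].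
rewrite (integral_radial mh h0).
have -> : m%:E = ((4 * pi)%:E * ((cm m)%:E * (Num.sqrt (pi / 2))%:E))%E.
  by rewrite -!EFinM -[in LHS](cm_sqrt m) !mulrA.
congr (_ * _)%E.
rewrite -integraly_sqr_expg [X in (_ * X)%E]integral_mkcond -ge0_integralZl//; last 2 first.
- apply/(measurable_restrictT _ _).1; first exact: measurable_itv.
  by apply: measurable_funTS; have me := @measurable_expg R; meas.
- move=> s _; rewrite patchE; case: ifPn => // _.
  by rewrite lee_fin mulr_ge0 ?sqr_ge0 ?expg_ge0.
apply: eq_integral => s _; rewrite patchE /h /ws iposE mem_setE in_itv/= andbT.
have [s0|s0|<-] := ltgtP 0 s; rewrite ?mul0r ?mule0//.
  by rewrite -!EFinM; congr EFin; rewrite mul1r; ring.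
by rewrite expr0n /= !mul0r !mule0.
Qed.

Lemma integrable_omega : (@leb3 R).-integrable setT (EFin \o omega m).
Proof.
have mo := measurable_omega; apply/integrableP; split; first exact/measurable_EFinP.
suff -> : (\int[@leb3 R]_x `|(EFin \o omega m) x| = m%:E)%E by rewrite ltry.
rewrite -integral_omega; apply: eq_integral => x _.
by rewrite gee0_abs// lee_fin omega_ge0.
Qed.

(* Both convolutions agree inside the ball: the part of omega outside and the
   surface charge both act there linearly in x, by [JK0E]. *)
Lemma Rintegral_outer x v : enorm x <= r ->
  \int[@leb3 R]_y (iout r y * (omega m y * dot v (K0 (x - y)))) = shell_charge * JK0 r v x.
Proof.
move=> xr; have cm0 := ltW cm_gt0.
pose F (y : mR3 R) : R := iout r y * (omega m y * dot v (K0 (x - y))).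
have mK : measurable_fun setT (fun y : mR3 R => dot v (K0 (x - (y : R3 R)))).
  by apply: measurable_dot_K0; apply: measurable_R3B; [exact: measurable_cst|exact: measurable_id].
have mF : measurable_fun setT F.
  by have mi := @measurable_iout R r; have mo := measurable_omega; rewrite /F; meas.
have w0 (z : mR3 R) : 0 <= ws z.2 * wsph z.1 by rewrite mulr_ge0 ?ws_ge0 ?wsph_ge0.
have wsph0 (p : T * T) : 0 <= wsph p by exact: wsph_ge0.
have mw : measurable_fun setT (fun z : mR3 R => ws z.2 * wsph z.1).
  by rewrite /ws /ipos /wsph; meas.
have iF : (@leb3 R).-integrable setT (EFin \o F).
  have /integrable_iout := integrable_mulr_bounded integrable_omega mK
    (fun y => dot_K0_le v (x - (y : R3 R))).
  exact.
have ik := (transfer_integrable w0 (@polar3 R) (@measurable_sph R) mw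
  ((measurable_EFinP _ _).2 mF)).1 iF.
rewrite /Rintegral (transfer_integral w0 (@polar3 R) ((measurable_EFinP _ _).2 mF)).
rewrite -(@integral21_prod_meas1 _ _ _ _ _ (@leb2 R) leb _ ik).
(* At radius [s] the field is [cm m * expg s * s^2] times [8 pi / (3 s)] times [dot v x], that is
   [C * (s * expg s)]. Its integral over [s >= r] is [C * expg r], which is also the field of the
   shell. *)
pose C := 8 * pi / 3 * dot v x * cm m.
transitivity (fine (\int[leb]_s (C%:E * ((fun s : R => (s * expg s)%:E) \_ `[r, +oo[) s))%E).
  congr fine; apply: eq_integral => s _; rewrite /fubini_G /= patchE.
  have [s0|s0] := leP s 0.
    rewrite memNset /=; last by rewrite in_itv/= andbT => /(lt_le_trans r0); rewrite ltNge s0.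
    rewrite mule0 integral0_eq// => p _.
    by rewrite /ws iposE ltNge s0 /= !mul0r mule0.
  have [rs|sr] := leP r s; last first.
    rewrite memNset /=; last by rewrite in_itv/= andbT leNgt sr.
    rewrite mule0 integral0_eq// => p _.
    by rewrite /F ioutE enorm_sph gtr0_norm// leNgt sr /= mul0r mul0e.
  rewrite mem_set /=; last by rewrite in_itv/= rs.
  have sfin : (sigma s setT < +oo)%E by rewrite sigma_setT ltry.
  have iK := integrable_bounded sfin mK (fun y => dot_K0_le v (x - (y : R3 R))).
  have iKp := (transfer_integrable wsph0 (transfer_sigma s) (measurable_sph1 s)
    (@measurable_wsph R) ((measurable_EFinP _ _).2 mK)).1 iK.
  have JE : (\int[@leb2 R]_p ((dot v (K0 (x - sph s p)))%:E * (wsph p)%:E) = (JK0 s v x)%:E)%E.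
    rewrite -(transfer_integral wsph0 (transfer_sigma s) ((measurable_EFinP _ _).2 mK)).
    by rewrite /JK0 /Rintegral fineK//; exact: (integrable_fin_num measurableT iK).
  transitivity (\int[@leb2 R]_p ((cm m * expg s * s ^+ 2)%:E * ((dot v (K0 (x - sph s p)))%:E * (wsph p)%:E)))%E.
    apply: eq_integral => p _; rewrite /F ioutE enorm_sph gtr0_norm// rs /omega enorm_sph gtr0_norm//.
    rewrite /ws iposE s0 -!EFinM; congr EFin.
    by rewrite -/(expg s) (_ : true%:R = 1%R :> R)//; ring.
  rewrite (integralZl measurableT iKp) JE JK0E//; last exact: le_trans rs.
  by rewrite -!EFinM; congr EFin; rewrite /C; field; rewrite gt_eqF.
have iT : leb.-integrable setT ((fun s : R => (s * expg s)%:E) \_ `[r, +oo[).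
  apply/integrableP; split.
    apply/(measurable_restrictT _ _).1; first exact: measurable_itv.
    by apply: measurable_funTS; have me := @measurable_expg R; meas.
  suff -> : (\int[leb]_s `|((fun s : R => (s * expg s)%:E) \_ `[r, +oo[) s| = (expg r)%:E)%E.
    by rewrite ltry.
  rewrite -(integraly_expg r0) [RHS]integral_mkcond; apply: eq_integral => s _.
  rewrite gee0_abs// patchE; case: ifPn => //; rewrite mem_setE in_itv/= andbT => rs.
  by rewrite lee_fin mulr_ge0 ?expg_ge0// ltW// (lt_le_trans r0).
rewrite (integralZl measurableT iT) -integral_mkcond integraly_expg// /=.
by rewrite JK0E// shell_chargeE /C; field; rewrite gt_eqF.
Qed.

End stationary_measure.

Lemma K0_conv_eq (R : realType) (w : R3 R -> R) (mu : {measure set (mR3 R) -> \bar R}) (x : R3 R) :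
  (forall v, \int[@leb3 R]_y (w y * dot v (K0 (x - y))) = \int[mu]_y dot v (K0 (x - y))) ->
  K0_conv_density w x = K0_conv_measure mu x.
Proof.
move=> H; rewrite /K0_conv_density /K0_conv_measure /vint.
have E1 (z : R3 R) : z.1.1 = dot (1, 0, 0) z by rewrite /dot /= mul1r !mul0r !addr0.
have E2 (z : R3 R) : z.1.2 = dot (0, 1, 0) z by rewrite /dot /= mul1r !mul0r addr0 add0r.
have E3 (z : R3 R) : z.2 = dot (0, 0, 1) z by rewrite /dot /= mul1r !mul0r !add0r.
congr (_, _, _).
- apply: etrans (etrans (H (1, 0, 0)) _); apply: eq_Rintegral => y _.
    by rewrite -E1.
  by rewrite -E1.
- apply: etrans (etrans (H (0, 1, 0)) _); apply: eq_Rintegral => y _.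
    by rewrite -E2.
  by rewrite -E2.
- apply: etrans (etrans (H (0, 0, 1)) _); apply: eq_Rintegral => y _.
    by rewrite -E3.
  by rewrite -E3.
Qed.

(** * Distributional identity and zero flux *)

Section surface_charge.
Variables (R : realType) (m r : R).
Hypotheses (m0 : 0 < m) (r0 : 0 < r).
Variable mu : {measure set (mR3 R) -> \bar R}.
Hypothesis muE : forall A : set (mR3 R), measurable A -> mu A = phi_measure m r A.
Implicit Types (x v : R3 R).

(** [mu] is prescribed on measurable sets only, and these determine all integrals. *)
Let mu_phi0 (f : mR3 R -> R) : \int[mu]_x f x = \int[phi0 m0 r0]_x f x.
Proof.
congr fine; apply: eq_measure_integral => A mA _.
by rewrite muE// phi0E.
Qed.

Lemma Rintegral_mu (f : mR3 R -> R) (M : R) : measurable_fun setT f ->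
  (forall x, `|f x| <= M) ->
  \int[mu]_x f x = \int[@leb3 R]_x (f x * inner_density m r x) + \int[sigma r]_x (f x * shell_charge m r).
Proof. by move=> mf fM; rewrite mu_phi0 (Rintegral_phi0 m0 r0 mf fM). Qed.

Lemma distribution_Ur : distribution_eq_measure (omega m) (Ur (cm m) r) mu.
Proof.
move=> eta teta; have [M HM] := bounded_pder teta [::].
rewrite (Rintegral_mu (measurable_pder teta [::]) HM).
have H := integral_Ur_laplacian (ltW (cm_gt0 m0)) r0 teta.
apply: etrans (esym H); congr (_ + _); apply: eq_Rintegral => x _.
- change (eta x * (cm m * expg (enorm x) * (1 - iout r x)) =
    (1 - iout r x) * (cm m * expg (enorm x) * eta x)).
  by ring.
(* At [s = r] the two [G] terms of [qr] cancel, so [- qr r] is the shell charge. *)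
- by rewrite shell_chargeE// /qr subrr mulr0 sub0r opprK mulrC.
Qed.

(** The restriction of [omega] to the ball is common to both sides; [Rintegral_outer] matches the
    rest of [omega] with the shell. *)
Lemma convolution_component x v : enorm x <= r ->
  \int[@leb3 R]_y (omega m y * dot v (K0 (x - y))) = \int[mu]_y dot v (K0 (x - y)).
Proof.
move=> xr.
have mK : measurable_fun setT (fun y : mR3 R => dot v (K0 (x - (y : R3 R)))).
  by apply: measurable_dot_K0; apply: measurable_R3B; [exact: measurable_cst|exact: measurable_id].
have bK (y : mR3 R) := dot_K0_le v (x - (y : R3 R)).
rewrite (Rintegral_mu mK bK).
have sfin : (sigma r setT < +oo)%E by rewrite sigma_setT ltry.
have iK := integrable_bounded sfin mK bK.
have -> : \int[sigma r]_y (dot v (K0 (x - (y : R3 R))) * shell_charge m r) = shell_charge m r * JK0 r v x.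
  transitivity (\int[sigma r]_y (shell_charge m r * dot v (K0 (x - (y : R3 R))))).
    by apply: eq_Rintegral => y _; rewrite mulrC.
  exact: (RintegralZl _ measurableT iK).
rewrite -(Rintegral_outer m0 r0 v xr).
have iw := integrable_mulr_bounded (integrable_omega m0) mK bK.
have io := integrable_iout r iw.
have ii : (@leb3 R).-integrable setT (EFin \o (fun y : mR3 R => dot v (K0 (x - (y : R3 R))) * inner_density m r y)).
  have := integrableB measurableT iw io; apply: eq_integrable => // y _.
  by rewrite /= -EFinB /inner_density; congr EFin; ring.
apply: etrans (RintegralD measurableT ii io).
by apply: eq_Rintegral => y _; rewrite /inner_density; ring.
Qed.

Lemma convolution_eq x : enorm x <= r ->
  K0_conv_density (omega m) x = K0_conv_measure mu x.
Proof. by move=> xr; apply: K0_conv_eq => v; exact: convolution_component. Qed.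

Lemma mu_exterior0 : mu [set x : mR3 R | r < enorm x] = 0%E.
Proof.
set N := [set x : mR3 R | _].
have mN : measurable N by exact: (open_measurable_R3 (@open_ext R r)).
rewrite muE// -(phi0E m0 r0 mN) phi0D.
have -> : density (@leb3 R) (measurable_inner_density m r) (inner_density_ge0 r m0) N = 0%E.
  rewrite /density integral0_eq// => x Nx.
  by rewrite /inner_density ioutE (ltW Nx) subrr mulr0.
rewrite add0e.
transitivity ((shell_charge m r)%:E * sigma r N)%E; 
  first exact: (integral_cst (sigma r) mN (shell_charge m r)%:E).
rewrite (_ : sigma r N = 0%E) ?mule0//.
transitivity (density (@leb2 R) (@measurable_wsph R) (@wsph_ge0 R) set0); last exact: measure0.
congr (density _ _ _); apply/seteqP; split => // p.
by rewrite /N /= enorm_sph gtr0_norm// ltxx.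
Qed.

(** [mu] is carried by the closed ball, where the two fields agree. The integrand vanishes off a
    null set, so [Rintegral_null] applies without any study of how the fields depend on [x]. *)
Lemma zero_flux_mu : zero_flux_stationary (omega m) mu.
Proof.
move=> xi _; apply: (@Rintegral_null _ _ _ mu [set x : mR3 R | r < enorm x]).
- exact: (open_measurable_R3 (@open_ext R r)).
- exact: mu_exterior0.
move=> x /negP; rewrite -leNgt => xr.
by rewrite convolution_eq// subrr /dot /= !mulr0 !addr0.
Qed.

End surface_charge.

(** * The limit of mass one *)

Section gaussian_limit.
Variable R : realType.

Lemma erf_sqrt2_gt0 (r : R) : 0 < r -> 0 < erf (r / Num.sqrt 2).
Proof.
move=> r0; have r2 : 0 < r / Num.sqrt 2 by rewrite divr_gt0// sqrtr_gt0.
by rewrite -erf0; exact: ltr_erf.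
Qed.

Lemma cvgy_erf_sqrt2 : (erf (r / Num.sqrt 2))^-1 @[r --> +oo] --> (1 : R).
Proof.
rewrite -[X in _ --> X]invr1; apply: cvgV; first by rewrite oner_eq0.
apply: (cvg_comp (fun s : R => s / Num.sqrt 2) (@erf R)); last exact: cvgy_erf.
have s2 : 0 < Num.sqrt 2 :> R by rewrite sqrtr_gt0.
by apply/cvgryPge => A; near=> s; rewrite ler_pdivlMr//.
Unshelve. all: by end_near. Qed.

Definition gauss1 : {measure set (mR3 R) -> \bar R} :=
  density (@leb3 R) (measurable_omega (1 : R)) (omega_ge0 ltr01).

Lemma gauss1_setT : gauss1 setT = 1%E.
Proof. exact: (integral_omega ltr01). Qed.

(** The mass of the shell when [m] is tied to [r] by [m = 1 / erf(r / sqrt 2)]. *)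
Let mass_error (r : R) : R :=
  4 * pi * ((erf (r / Num.sqrt 2))^-1 * cm 1 * (r * expg r)).

Let cvgy_mass_error : mass_error r @[r --> +oo] --> (0 : R).
Proof.
rewrite -[X in _ --> X](_ : 4 * pi * (1 * cm 1 * (0 : R)) = 0); last by rewrite !mulr0.
apply: cvgM; first exact: cvg_cst.
apply: cvgM; last exact: cvgy_mul_expg.
by apply: cvgM; [exact: cvgy_erf_sqrt2|exact: cvg_cst].
Qed.

(* [|inner_density - omega 1| <= (2 m - 1) omega 1 - inner_density], and the
   integral of the right-hand side is explicit because the total mass is 1. *)
Lemma Rintegral_gauss_error (r M : R) (mu : {measure set (mR3 R) -> \bar R})
    (f : mR3 R -> R) : 0 < r ->
  (forall A : set (mR3 R), measurable A ->
     mu A = phi_measure (erf (r / Num.sqrt 2))^-1 r A) ->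
  measurable_fun setT f -> (forall x, `|f x| <= M) ->
  `|\int[mu]_x f x - \int[gauss1]_x f x| <=
    M * (2 * ((erf (r / Num.sqrt 2))^-1 - 1) + mass_error r) + M * mass_error r.
Proof.
(* To be used with [a = m * omega 1 x], [w = omega 1 x] and [b] telling whether [x] is outside the
   ball: equality holds inside, and outside it reads [w <= 2 * a - w]. *)
have key (a w : R) (b : bool) : 0 <= w -> w <= a ->
    `|a * (1 - b%:R) - w| <= 2 * a - w - a * (1 - b%:R).
  by move=> w0 wa; case: b; rewrite ?subrr ?subr0 ?mulr0 ?mulr1 ler_norml;
    apply/andP; split; lra.
move=> r0 muE mf fM; set m := (erf _)^-1.
have e0 := erf_sqrt2_gt0 r0; have m0 : 0 < m by rewrite invr_gt0.
have m1 : 1 <= m.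
  by rewrite invf_ge1// erf_le1// divr_ge0 ?(ltW r0)// sqrtr_ge0.
have cmm : cm m = m * cm 1 by rewrite /cm mul1r.
have kE : 4 * pi * shell_charge m r = mass_error r by rewrite shell_chargeE// cmm.
have mass : 4 * pi * (cm m * Q2 r) + mass_error r = 1.
  rewrite -kE shell_chargeE//; transitivity (4 * pi * cm m * G r); first by rewrite /Q2; ring.
  by rewrite cmG mulVf// gt_eqF.
have i1 := integrable_omega (ltr01 : 0 < (1 : R)).
have ik : (@leb3 R).-integrable setT (EFin \o inner_density m r).
  apply/integrableP; split; first by apply/measurable_EFinP; exact: measurable_inner_density.
  suff -> : (\int[@leb3 R]_x `|(EFin \o inner_density m r) x| = (4 * pi * (cm m * Q2 r))%:E)%E by rewrite ltry.
  rewrite -(integral_inner_density m0 r0); apply: eq_integral => x _.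
  by rewrite gee0_abs// lee_fin inner_density_ge0.
have ifk := integrable_mulr_bounded ik mf fM.
have if1 := integrable_mulr_bounded i1 mf fM.
have ib : (@leb3 R).-integrable setT (EFin \o (fun x => M * ((2 * m - 1) * omega 1 x - inner_density m r x))).
  have iz := integrableB measurableT (integrableZl measurableT (2 * m - 1) i1) ik.
  exact: (integrableZl measurableT M iz).
have I1 : \int[@leb3 R]_x omega 1 x = 1 by rewrite /Rintegral (integral_omega ltr01).
have Ik : \int[@leb3 R]_x inner_density m r x = 4 * pi * (cm m * Q2 r) by rewrite /Rintegral (integral_inner_density m0 r0).
have Ib : \int[@leb3 R]_x (M * ((2 * m - 1) * omega 1 x - inner_density m r x)) = M * (2 * (m - 1) + mass_error r).
  have iz := integrableZl measurableT (2 * m - 1) i1.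
  rewrite (RintegralZl _ measurableT (integrableB measurableT iz ik)).
  rewrite (RintegralB measurableT iz ik) (RintegralZl _ measurableT i1) I1 Ik.
  by rewrite -[in X in _ - X](addrK (mass_error r) (4 * pi * (cm m * Q2 r))) mass; ring.
rewrite (Rintegral_mu m0 r0 muE mf fM).
have -> : \int[gauss1]_x f x = \int[@leb3 R]_x (f x * omega 1 x) by exact: Rintegral_density.
rewrite addrAC (le_trans (ler_normD _ _))// lerD//; last first.
  have mk : measurable_fun setT (fun x : mR3 R => f x * shell_charge m r) by exact: measurable_funM.
  have kb x : `|f x * shell_charge m r| <= M * shell_charge m r.
    by rewrite normrM (ger0_norm (shell_charge_ge0 m0 r0)) ler_wpM2r// shell_charge_ge0.
  rewrite (le_trans (normr_Rintegral_le (sigma_setT r) mk kb))//.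
  by rewrite -kE -mulrA (mulrC (shell_charge m r)).
have -> : \int[@leb3 R]_x (f x * inner_density m r x) - \int[@leb3 R]_x (f x * omega 1 x) =
    \int[@leb3 R]_x (inner_density m r x * f x - omega 1 x * f x).
  rewrite (RintegralB measurableT ifk if1).
  by congr (_ - _); apply: eq_Rintegral => x _; rewrite mulrC.
have iD := integrableB measurableT ifk if1.
rewrite (le_trans (le_normr_Rintegral measurableT iD))// -Ib.
have iN : (@leb3 R).-integrable setT (EFin \o (fun x => `|inner_density m r x * f x - omega 1 x * f x|)).
  exact: (@integrable_norm _ _ _ (@leb3 R) setT (fun x => inner_density m r x * f x - omega 1 x * f x) iD).
apply: (le_Rintegral measurableT iN ib) => x _.
rewrite -mulrBl normrM mulrC ler_pM//.
have w1 := omega_ge0 (ltr01 : 0 < (1 : R)) x.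
have -> : inner_density m r x = m * omega 1 x * (1 - iout r x) by rewrite /inner_density /omega cmm !mulrA.
have mw : omega 1 x <= m * omega 1 x by rewrite ler_peMl.
rewrite ioutE (_ : (2 * m - 1) * omega 1 x = 2 * (m * omega 1 x) - omega 1 x); last by ring.
exact: key.
Qed.

Lemma cvgy_Rintegral_gauss (mu : R -> {measure set (mR3 R) -> \bar R}) (f : mR3 R -> R) (M : R) :
  (forall r : R, 0 < r -> forall A : set (mR3 R), measurable A ->
     mu r A = phi_measure (erf (r / Num.sqrt 2))^-1 r A) ->
  measurable_fun setT f -> (forall x, `|f x| <= M) ->
  (\int[mu r]_x f x) @[r --> +oo] --> \int[gauss1]_x f x.
Proof.
move=> muE mf fM.
have cb : M * (2 * ((erf (r / Num.sqrt 2))^-1 - 1) + mass_error r) + M * mass_error r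
    @[r --> +oo] --> (0 : R).
  rewrite -[X in _ --> X](_ : M * (2 * (1 - 1) + 0) + M * 0 = 0); last by ring.
  apply: cvgD; apply: cvgM; [exact: cvg_cst| |exact: cvg_cst|exact: cvgy_mass_error].
  apply: cvgD; last exact: cvgy_mass_error.
  apply: cvgM; first exact: cvg_cst.
  by apply: cvgB; [exact: cvgy_erf_sqrt2|exact: cvg_cst].
apply/cvgrPdist_lt => e e0; near=> r.
have r0 : 0 < r by near: r; apply: nbhs_pinfty_gt; exact: num_real.
rewrite distrC (le_lt_trans (Rintegral_gauss_error r0 (muE r r0) mf fM))//.
by near: r; exact: (cvgr_lt _ cb).
Unshelve. all: by end_near. Qed.

End gaussian_limit.

(** The case of mass one is parametrized by the radius: each [r > 0] determines the mass
    [1 / erf(r / sqrt 2)], which tends to [1], and the convergence of the measures is the weak one,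
    against bounded continuous functions. *)
Theorem proposition7p6 (R : realType) :
  (forall m : R, 1 < m ->
     (exists! r : R, 0 < r /\ erf (r / Num.sqrt 2) = 1 / m) /\
     (forall r : R, 0 < r -> erf (r / Num.sqrt 2) = 1 / m ->
        (exists! U : R3 R -> R, exterior_solution (omega m) r U) /\
        (forall U : R3 R -> R, exterior_solution (omega m) r U ->
           exists phi : probability (mR3 R) R,
             [/\ forall A : set (mR3 R), measurable A ->
                   phi A = phi_measure m r A,
                 distribution_eq_measure (omega m) U phi &
                 zero_flux_stationary (omega m) phi]))) /\
  (exists phi : probability (mR3 R) R,
     [/\ forall A : set (mR3 R), measurable A -> phi A = gaussian_measure 1 A,
         zero_flux_stationary (omega 1) phi,
         (erf (r / Num.sqrt 2))^-1 @[r --> +oo] --> (1 : R) &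
         forall phi_ : R -> probability (mR3 R) R,
           (forall r : R, 0 < r -> forall A : set (mR3 R), measurable A ->
              phi_ r A = phi_measure (erf (r / Num.sqrt 2))^-1 r A) ->
           forall f : R3 R -> R, continuous f ->
             (exists M : R, forall x, `|f x| <= M) ->
             (\int[phi_ r]_x f x) @[r --> +oo] --> \int[phi]_x f x]).
Proof.
split=> [m m1|].
  have m0 : 0 < m by exact: lt_trans m1.
  split=> [|r r0 er]; first exact: erf_exists_unique.
  split.
    exists (Ur (cm m) r); split; first exact: exterior_solution_Ur.
    by move=> V; apply: exterior_solution_eq => //; exact: exterior_solution_Ur.
  move=> U sU; have -> : U = Ur (cm m) r.
    by apply: (exterior_solution_eq r0 sU); exact: exterior_solution_Ur.
  have phi1 : phi0 m0 r0 setT = 1%E.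
    by rewrite phi0_setT er div1r divff// gt_eqF.
  have [P PE] := probability_of_measure phi1; exists P.
  have PE' (A : set (mR3 R)) : measurable A -> P A = phi_measure m r A.
    by move=> mA; rewrite PE phi0E.
  by split; [exact: PE'|exact: (distribution_Ur m0 r0 PE')|exact: (zero_flux_mu m0 r0 PE')].
have [P PE] := probability_of_measure (gauss1_setT R); exists P.
have intP (f : mR3 R -> R) : \int[P]_x f x = \int[gauss1 R]_x f x.
  by congr fine; apply: eq_measure_integral => A _ _; exact: PE.
split.
- by move=> A mA; rewrite PE.
(* Here [P] has density [omega 1], so the two fields coincide at every point and not only in a
   ball. *)
- move=> xi _; rewrite (_ : (fun x => _) = fun=> 0).
    by rewrite /Rintegral integral0.
  apply/funext => x; rewrite (_ : K0_conv_density _ x = K0_conv_measure P x).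
    by rewrite subrr /dot /= !mulr0 !addr0.
  have mK v : measurable_fun setT (fun y : mR3 R => dot v (K0 (x - (y : R3 R)))).
    by apply: measurable_dot_K0; apply: measurable_R3B; [exact: measurable_cst|exact: measurable_id].
  apply: K0_conv_eq => v; rewrite intP.
  transitivity (\int[@leb3 R]_y (dot v (K0 (x - y)) * omega 1 y)).
    by apply: eq_Rintegral => y _; rewrite mulrC.
  by apply/esym; apply: Rintegral_density; exact: mK.
- exact: cvgy_erf_sqrt2.
- move=> phi_ phiE f cf [M fM]; rewrite intP.
  exact: (cvgy_Rintegral_gauss phiE (continuous_measurable_R3 cf) fM).
Qed.
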